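(* Let $m\in\mathbb{N}^*$, let $\mathbf{H}$ be a complex Hilbert space, and let $\mathsf{S},\mathsf{T}$ be operators such that (1) $\mathsf{S}\in\mathscr{B}_{\mathbf{H}\otimes\mathbf{H}}$, $\|\mathsf{S}\|_{\mathrm{op}}<1$, $\mathsf{S}^*=\mathsf{S}$, and $(\mathrm{id}_{\mathbf{H}}\otimes\mathsf{S})(\mathsf{S}\otimes\mathrm{id}_{\mathbf{H}})(\mathrm{id}_{\mathbf{H}}\otimes\mathsf{S})=(\mathsf{S}\otimes\mathrm{id}_{\mathbf{H}})(\mathrm{id}_{\mathbf{H}}\otimes\mathsf{S})(\mathsf{S}\otimes\mathrm{id}_{\mathbf{H}})$; (2) $\mathsf{T}\in\mathscr{B}_{\mathbf{H}}$, $\|\mathsf{T}\|_{\mathrm{op}}<1$, $\sum_{i\in[m-1]}(\mathsf{T}^i)^*=\sum_{i\in[m-1]}\mathsf{T}^i$, and $$(\mathsf{T}\otimes\mathrm{id}_{\mathbf{H}})\mathsf{S}(\mathsf{T}\otimes\mathrm{id}_{\mathbf{H}})\mathsf{S}=\mathsf{S}(\mathsf{T}\otimes\mathrm{id}_{\mathbf{H}})\mathsf{S}(\mathsf{T}\otimes\mathrm{id}_{\mathbf{H}}),$$ $$(\mathrm{id}_{\mathbf{H}}\otimes\mathsf{T})\mathsf{S}(\mathrm{id}_{\mathbf{H}}\otimes\mathsf{T})\mathsf{S}=\mathsf{S}(\mathrm{id}_{\mathbf{H}}\otimes\mathsf{T})\mathsf{S}(\mathrm{id}_{\mathbf{H}}\otimes\mathsf{T}).$$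 Let $\mathsf{P}_n$ ($n\in\mathbb{N}$) be the operators on $\mathbf{H}^{\otimes n}$ and $\mathsf{d}^*(x),\mathsf{d}(x)$ ($x\in\mathbf{H}$) the creation and annihilation operators on $\bigoplus_{n\in\mathbb{N}}\mathbf{H}^{\otimes n}$ built from $\mathsf{S}$ and $\mathsf{T}$ as in the context. Then the sesquilinear form $\langle\cdot,\cdot\rangle_G$ on $\bigoplus_{n\in\mathbb{N}}\mathbf{H}^{\otimes n}$ given by $$\forall X\in\mathbf{H}^{\otimes k},\ \forall Y\in\mathbf{H}^{\otimes n}:\quad \langle X,Y\rangle_G:=\delta_{kn}\langle X,\mathsf{P}_nY\rangle$$ is an inner product, and for each $x\in\mathbf{H}$ the operators $\mathsf{d}^*(x)$ and $\mathsf{d}(x)$ are adjoint with respect to $\langle\cdot,\cdot\rangle_G$, i.e. $\langle\mathsf{d}^*(x)X,Y\rangle_G=\langle X,\mathsf{d}(x)Y\rangle_G$ for all $X,Y$. Moreover, for each $x\in\mathbf{H}$, $$\|\mathsf{d}^*(x)\|_{\mathrm{op}}\le\frac{\|x\|}{\sqrt{(1-\|\mathsf{S}\|_{\mathrm{op}})(1-\|\mathsf{T}\|_{\mathrm{op}})}},$$ where $\|\mathsf{d}^*(x)\|_{\mathrm{op}}$ is the operator norm with respect to the norm $\|\cdot\|_G$ associated to $\langle\cdot,\cdot\rangle_G$.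
   Context: Notation: $\mathbb{N}^*=\{1,2,\dots\}$, $[k]=\{1,\dots,k\}$ (empty if $k\le 0$), $[a,b]=\{a,\dots,b\}$. $\mathscr{B}_{\mathbf{K}}$ is the algebra of bounded operators on a Hilbert space $\mathbf{K}$, with operator norm $\|\cdot\|_{\mathrm{op}}$. Inner products are conjugate-linear in the first and linear in the second variable. $\mathbf{H}^{\otimes n}$ is the Hilbert space tensor power with its usual inner product $\langle\cdot,\cdot\rangle$, $\mathbf{H}^{\otimes 0}:=\mathbb{C}\varOmega$ with $\varOmega$ a unit vector (vacuum), and the full Fock space $\bigoplus_{n\in\mathbb{N}}\mathbf{H}^{\otimes n}$ is the (algebraic) direct sum. Group: $G(m,1,n)$ is generated by reflections $s_0,s_1,\dots,s_{n-1}$ on $\mathbb{C}^n$ subject to $s_0^m=s_1^2=\dots=s_{n-1}^2=1$; $s_0s_1s_0s_1=s_1s_0s_1s_0$; $s_is_{i+1}s_i=s_{i+1}s_is_{i+1}$ for $i\in[n-2]$; $s_is_j=s_js_i$ for $i,j\in[0,n-1]$, $|i-j|\ge 2$. Put $t_1:=s_0$, $t_{i+1}:=s_it_is_i$ for $i\in[n-1]$, and $\varPi=\{t_1,\dots,t_n,s_1,\dots,s_{n-1}\}$ (a generating set). The length is $\mathrm{l}(g):=\min\{k\in\mathbb{N}\mid\exists r_1,\dots,r_k\in\varPi:\ g=r_1\cdots r_k\}$. A linear map $\varphi:\mathbb{C}G(m,1,n)\to\mathscr{B}_{\mathbf{K}}$ is quasimultiplicative if $\varphi(1)=\mathrm{id}_{\mathbf{K}}$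 and $\mathrm{l}(uv)=\mathrm{l}(u)+\mathrm{l}(v)$ implies $\varphi(uv)=\varphi(u)\varphi(v)$ for all $u,v\in G(m,1,n)$. Operators on $\mathbf{H}^{\otimes n}$, $n\in\mathbb{N}^*$: for $i\in[n-1]$, $j\in[n]$, $$\mathsf{S}_i:=\mathrm{id}_{\mathbf{H}}^{\otimes(i-1)}\otimes\mathsf{S}\otimes\mathrm{id}_{\mathbf{H}}^{\otimes(n-i-1)},\qquad \mathsf{T}_j:=\mathrm{id}_{\mathbf{H}}^{\otimes(j-1)}\otimes\mathsf{T}\otimes\mathrm{id}_{\mathbf{H}}^{\otimes(n-j)}.$$ Let $\varphi:\mathbb{C}G(m,1,n)\to\mathscr{B}_{\mathbf{H}^{\otimes n}}$ be the quasimultiplicative linear map with $\varphi(1)=\mathrm{id}_{\mathbf{H}^{\otimes n}}$, $\varphi(s_i)=\mathsf{S}_i$ and $\varphi(t_j)=\mathsf{T}_j$. Define $\mathsf{P}_0:=\mathrm{id}_{\mathbb{C}\varOmega}$ and, for $n\in\mathbb{N}^*$, $\mathsf{P}_n:=\sum_{u\in G(m,1,n)}\varphi(u)$. Free creation and annihilation operators, for $x,x_1,\dots,x_n\in\mathbf{H}$: $\mathsf{l}^*(x)\varOmega=x$, $\mathsf{l}^*(x)\,x_1\otimes\dots\otimes x_n=x\otimes x_1\otimes\dots\otimes x_n$; $\mathsf{l}(x)\varOmega=0$, $\mathsf{l}(x)\,x_1\otimes\dots\otimes x_n=\langle x,x_1\rangle\,x_2\otimes\dots\otimes x_n$ (for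 $n=1$ this is $\langle x,x_1\rangle\varOmega$). For $n\in\mathbb{N}^*$ put $$\mathsf{R}_n:=\Big(\mathrm{id}_{\mathbf{H}^{\otimes n}}+\sum_{i\in[m-1]}\mathsf{T}_1^i\Big)\Big(\mathrm{id}_{\mathbf{H}^{\otimes n}}+\sum_{j\in[n-1]}\mathsf{S}_1\mathsf{S}_2\cdots\mathsf{S}_j\Big)\in\mathscr{B}_{\mathbf{H}^{\otimes n}}.$$ The creation and annihilation operators are $\mathsf{d}^*(x):=\mathsf{l}^*(x)$ and $\mathsf{d}(x)\,x_1\otimes\dots\otimes x_n:=\mathsf{l}(x)\,\mathsf{R}_n\,x_1\otimes\dots\otimes x_n$ for $n\in\mathbb{N}^*$, with $\mathsf{d}(x)\varOmega=0$.
   Formalization: The quasimultiplicative φ is assumed to exist for every n≥1: (1)–(2) do not ensure it, since for m≥2 it forces S(T⊗id)=(id⊗T)S, which fails for S=q·id (q≠0), T non-scalar. For m=1 all t_j=1, so φ(t_j)=T_j is required only for m>1. *)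

(* Defs.v *)
From HB Require Import structures.
From mathcomp Require Import all_boot all_order all_algebra all_fingroup.
From mathcomp Require Import cyclic zify.

Set Implicit Arguments.
Unset Strict Implicit.
Unset Printing Implicit Defensive.

Import Order.TTheory GRing.Theory Num.Theory.

Local Open Scope ring_scope.

(** * The group G(m,1,n) *)

(* The group of n x n monomial matrices whose nonzero entries are m-th roots of
   unity. The pair (a, s) stands for the matrix whose row j has the single
   nonzero entry zeta ^ a_j, in column s j, where zeta is a primitive m-th root
   of unity (refl_mx below, a faithful representation). It is presented by the
   generators sgen 0, ..., sgen n.-1 and the relations rg_relations, see
   sgen_relations, sgen_generates and sgen_universal. Exponents live in 'I_m.-1.+1 = Z/m, so that
   m >= 1 is meant; for m = 1 this is the symmetric group. *)
Definition refl_group (m n : nat) : predArgType :=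
  ({ffun 'I_n -> 'I_m.-1.+1} * 'S_n)%type.

HB.instance Definition _ m n := Finite.on (refl_group m n).

Section ReflGroup.
Variables m n : nat.
Implicit Types u v w : refl_group m n.

Definition rg_one : refl_group m n := ([ffun=> 0], 1%g).
Definition rg_mul u v : refl_group m n :=
  ([ffun j => u.1 j + v.1 (u.2 j)], (u.2 * v.2)%g).
Definition rg_inv u : refl_group m n :=
  ([ffun j => - u.1 ((u.2)^-1%g j)], (u.2)^-1%g).

Lemma rg_mulA : associative rg_mul.
Proof.
move=> u v w; congr pair; last by rewrite /= mulgA.
by apply/ffunP => j; rewrite !ffunE /= permM addrA.
Qed.

Lemma rg_mul1 : left_id rg_one rg_mul.
Proof.
case=> a s; congr pair; last by rewrite /= mul1g.
by apply/ffunP => j; rewrite !ffunE /= perm1 add0r.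
Qed.

Lemma rg_mulV : left_inverse rg_one rg_inv rg_mul.
Proof.
case=> a s; congr pair; last by rewrite /= mulVg.
by apply/ffunP => j; rewrite !ffunE /= addNr.
Qed.

HB.instance Definition _ :=
  Finite_isGroup.Build (refl_group m n) rg_mulA rg_mul1 rg_mulV.

Lemma rg_mulE u v :
  (u * v)%g = ([ffun j => u.1 j + v.1 (u.2 j)], (u.2 * v.2)%g) :> refl_group m n.
Proof. by []. Qed.

Lemma rg_oneE : 1%g = ([ffun=> 0], 1%g) :> refl_group m n.
Proof. by []. Qed.

(* The transposition exchanging the (0-based) indices i.-1 and i; it is 1 for
   i = 0 and when i is out of range. *)
Definition adj_tperm (i : nat) : 'S_n :=
  match insub i.-1, insub i with
  | Some a, Some b => tperm a b
  | _, _ => 1%g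
  end.

(* s_0 = diag(zeta, 1, ..., 1), and s_i, 1 <= i < n, permutes the coordinates
   i - 1 and i (counted from 0). *)
Definition sgen (i : nat) : refl_group m n :=
  if i is 0 then ([ffun j : 'I_n => inZp (val j == 0%N)], 1%g)
  else ([ffun=> 0], adj_tperm i).

(* tgen0 k is t_(k+1). *)
Fixpoint tgen0 (k : nat) : refl_group m n :=
  if k is k'.+1 then (sgen k * tgen0 k' * sgen k)%g else sgen 0.

Definition tgen (j : nat) : refl_group m n := tgen0 j.-1.

Definition Pigen : {set refl_group m n} :=
  ([set tgen (val j).+1 | j : 'I_n] :|: [set sgen (val i).+1 | i : 'I_n.-1])%SET.




Lemma adj_tpermE (i : nat) (hi1 : (i.-1 < n)%N) (hi : (i < n)%N) :
  adj_tperm i = tperm (Ordinal hi1) (Ordinal hi).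
Proof. by rewrite /adj_tperm !insubT. Qed.

Lemma adj_tpermK i : (adj_tperm i * adj_tperm i)%g = 1%g.
Proof.
rewrite /adj_tperm.
by case: insub (insub i) => [a|] [b|]; rewrite ?tperm2 ?mul1g.
Qed.

Lemma tgenE (j : nat) : (0 < j <= n)%N ->
  tgen j = ([ffun k : 'I_n => inZp (val k == j.-1)], 1%g).
Proof.
rewrite /tgen; case: j => //= k; elim: k => [//|k IH] hk.
rewrite /= IH ?(ltnW hk) // 2!rg_mulE /= mulg1 adj_tpermK.
congr pair; apply/ffunP => i; rewrite !ffunE /= add0r addr0.
congr inZp; congr nat_of_bool.
rewrite (@adj_tpermE k.+1 (ltnW hk) hk).
case: tpermP => [->|->|/eqP h1 /eqP h2] /=.
- by case: eqP; case: eqP; lia.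
- by rewrite !eqxx.
- by move: h1 h2; rewrite -!val_eqE /= => /negPf-> /negPf->.
Qed.

Lemma adj_tperm_val i (x : 'I_n) : (i < n)%N -> adj_tperm i x =
  (if x == i.-1 :> nat then i else if x == i :> nat then i.-1 else x) :> nat.
Proof.
move=> hi; have hi1 : (i.-1 < n)%N by lia.
rewrite (adj_tpermE hi1 hi).
case: tpermP => [->|->|/eqP h1 /eqP h2] /=; rewrite ?eqxx //.
  by case: eqP; lia.
by move: h1 h2; rewrite -!val_eqE /= => /negPf-> /negPf->.
Qed.

Definition rg_diag (b : {ffun 'I_n -> 'I_m.-1.+1}) : refl_group m n := (b, 1%g).

Lemma rg_diagD : {morph rg_diag : b c / b + c >-> (b * c)%g}.
Proof.
move=> b c; rewrite /rg_diag rg_mulE /= mulg1; congr pair.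
by apply/ffunP => j; rewrite !ffunE perm1.
Qed.

Lemma rg_diag0 : rg_diag 0 = 1%g.
Proof. by rewrite rg_oneE /rg_diag; congr pair; apply/ffunP => j; rewrite !ffunE. Qed.

Lemma rg_diagX b k : (rg_diag b ^+ k)%g = rg_diag (b *+ k).
Proof.
by elim: k => [|k IH]; rewrite ?expg0 ?rg_diag0 // expgS IH -rg_diagD mulrS.
Qed.

Lemma rg_diag_prod b : rg_diag b = (\prod_(j < n) tgen j.+1 ^+ b j)%g.
Proof.
rewrite [in LHS](_ : b =
    \sum_(j < n) [ffun k : 'I_n => inZp (val k == j)] *+ b j).
  rewrite (big_morph _ rg_diagD rg_diag0); apply: eq_bigr => j _.
  by rewrite tgenE ?ltn_ord // -rg_diagX.
apply/ffunP => k; rewrite sum_ffunE (bigD1 k) //= big1 ?addr0.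
  rewrite ffunMnE ffunE eqxx Zp_mulrn; apply/val_inj.
  by rewrite /= modnMml mul1n modn_small.
move=> j jk; rewrite ffunMnE ffunE Zp_mulrn; apply/val_inj.
by rewrite /= eq_sym val_eqE (negPf jk) !mod0n.
Qed.

Lemma gen_Pigen : <<Pigen>>%g = [set: refl_group m n].
Proof.
apply/eqP; rewrite eqEsubset subsetT /=; apply/subsetP => -[a s] _.
have -> : (a, s) = (rg_diag a * ([ffun=> 0], s))%g :> refl_group m n.
  rewrite rg_mulE /= mul1g; congr pair.
  by apply/ffunP => j; rewrite !ffunE addr0.
apply: groupM.
  rewrite rg_diag_prod group_prod // => j _; rewrite groupX // mem_gen //.
  by rewrite inE; apply/orP; left; apply/imsetP; exists j.
have permM : {morph (fun s => ([ffun=> 0], s) : refl_group m n) :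
                s t / (s * t)%g >-> (s * t)%g}.
  by move=> s1 s2; rewrite rg_mulE; congr pair; apply/ffunP => j;
     rewrite !ffunE addr0.
pose D : {set 'S_n} := [set s | (([ffun=> 0], s) : refl_group m n) \in <<Pigen>>%g].
have gD : group_set D.
  apply/group_setP; split; first by rewrite inE -rg_oneE group1.
  by move=> s1 s2; rewrite !inE permM; apply: groupM.
suff allD t : t \in Group gD by have := allD s; rewrite inE.
have adjD i (hi1 : (i < n)%N) (hi : (i.+1 < n)%N) :
    tperm (Ordinal hi1) (Ordinal hi) \in Group gD.
  rewrite -(adj_tpermE (i := i.+1)) inE mem_gen // inE; apply/orP; right.
  have hi' : (i < n.-1)%N by rewrite ltn_predRL.
  by apply/imsetP; exists (Ordinal hi').
have tpD (x : 'I_n) k (hk : (k < n)%N) : val x = 0%N ->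
    tperm x (Ordinal hk) \in Group gD.
  move=> x0; elim: k hk => [|k IH] hk.
    by rewrite (_ : Ordinal hk = x) ?tperm1 ?group1 //; apply: val_inj.
  have [->|xk] := eqVneq x (Ordinal (ltnW hk)); first exact: adjD.
  have -> : tperm x (Ordinal hk) =
      (tperm x (Ordinal (ltnW hk)) ^ tperm (Ordinal (ltnW hk)) (Ordinal hk))%g.
    rewrite tpermJ tpermL tpermD //; first by rewrite eq_sym.
    by rewrite -val_eqE /= x0.
  by rewrite groupJ ?adjD.
have [ts -> _] := prod_tpermP t; rewrite group_prod // => -[/= b c] _.
pose x := Ordinal (leq_ltn_trans (leq0n b) (ltn_ord b)).
have tp0 d : tperm x d \in Group gD by case: d => k hk; apply: tpD.
have [<-|bc] := eqVneq b c; first by rewrite tperm1; exact: (group1 (Group gD)).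
have [->|bx] := eqVneq b x; first exact: tp0.
have -> : tperm b c = (tperm x b ^ tperm x c)%g.
  by rewrite tpermJ tpermL (tpermD (x := x)) 1?eq_sym // tpermC.
by apply: (groupJ (G := Group gD)).
Qed.

(* The defining relations of G(m,1,n) in terms of s_0, ..., s_(n-1). *)
Definition rg_relations (gT : finGroupType) (r : nat -> gT) : Prop :=
  [/\ (0 < n)%N -> (r 0%N ^+ m = 1)%g,
      forall i, (0 < i < n)%N -> (r i * r i = 1)%g,
      (1 < n)%N -> (r 0%N * r 1%N * r 0%N * r 1%N =
                    r 1%N * r 0%N * r 1%N * r 0%N)%g,
      forall i, (0 < i)%N -> (i.+1 < n)%N ->
        (r i * r i.+1 * r i = r i.+1 * r i * r i.+1)%g
    & forall i j, (i.+1 < j)%N -> (j < n)%N -> (r i * r j = r j * r i)%g].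

Lemma sgen_relations : rg_relations sgen.
Proof.
split=> [n0 | [//|i] hi | n1 | [//|i] _ hi | i [//|j] ij jn].
- rewrite -[sgen 0]/(rg_diag _) rg_diagX -rg_diag0; congr rg_diag.
  apply/ffunP => j; rewrite ffunMnE !ffunE Zp_mulrn; apply/val_inj => /=.
  have E k : ((k * m) %% m.-1.+1 = 0)%N.
    by case: (m) => [|m'] /=; rewrite ?muln0 ?modn1 ?modnMl.
  exact: E.
- rewrite rg_mulE rg_oneE /= adj_tpermK; congr pair.
  by apply/ffunP => j; rewrite !ffunE addr0.
- rewrite !rg_mulE /= !mul1g !mulg1; congr pair.
  apply/ffunP => j; rewrite !ffunE /= !(perm1, permM, addr0, add0r).
  by rewrite -permM adj_tpermK perm1 addrC.
- rewrite !rg_mulE /=; congr pair.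
    by apply/ffunP => j; rewrite !ffunE !addr0.
  apply/permP => x; apply: val_inj; rewrite !permM /=.
  rewrite !adj_tperm_val ?(ltnW hi) //=.
  by do ?case: eqP; lia.
- rewrite !rg_mulE; case: i => [|i] in ij *; rewrite /=.
    rewrite mul1g mulg1; congr pair.
    apply/ffunP => k; rewrite !ffunE /= addr0 add0r.
    by congr inZp; rewrite adj_tperm_val //=; do ?case: eqP; lia.
  congr pair; first by apply/ffunP => k; rewrite !ffunE.
  apply/permP => x; apply: val_inj; rewrite !permM /=.
  have hi : (i.+1 < n)%N by lia.
  rewrite !adj_tperm_val //.
  by do ?case: eqP; lia.
Qed.

End ReflGroup.

Section OrderBound.
Variables (m : nat) (gT : finGroupType) (r : nat -> gT).
Local Open Scope group_scope.

Definition rg_sub (n : nat) : {group gT} := <<[set r (val i) | i : 'I_n]>>%G.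

Lemma rg_subP n i : (i < n)%N -> r i \in rg_sub n.
Proof. by move=> hi; apply: mem_gen; apply/imsetP; exists (Ordinal hi). Qed.

(* rg_c n d = r_n r_(n-1) ... r_(n-d+1) *)
Fixpoint rg_c (n d : nat) : gT :=
  if d is d'.+1 then rg_c n d' * r (n - d')%N else 1.

Lemma rg_relationsW n : rg_relations m n.+1 r -> rg_relations m n r.
Proof.
case=> h1 h2 h3 h4 h5; split.
- by move=> _; apply: h1.
- by move=> i /andP[i0 hi]; apply: h2; rewrite i0 ltnW.
- by move=> n1; apply: h3; rewrite ltnW.
- by move=> i i0 hi; apply: h4 => //; rewrite ltnW.
- by move=> i j ij jn; apply: h5 => //; rewrite ltnW.
Qed.

Section Step.
Variable n : nat.
Hypothesis rel : rg_relations m n.+1 r.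
Hypotheses (m0 : (0 < m)%N) (n0 : (0 < n)%N).

Lemma rg_c_low d i : (d <= n)%N -> (i + d < n)%N ->
  rg_c n d * r i = r i * rg_c n d.
Proof.
have [_ _ _ _ comm] := rel; elim: d => [|d IH] dn id /=; first by rewrite mul1g mulg1.
rewrite -mulgA -(comm i); [|lia|lia].
by rewrite !mulgA IH //; lia.
Qed.

Lemma rg_c_high d i : (d <= n)%N -> (i <= n)%N -> (n - d + 1 < i)%N ->
  rg_c n d * r i = r i.-1 * rg_c n d.
Proof.
have [_ _ _ braid comm] := rel; elim: d => [|d IH] dn hi id; first by lia.
have [e|ne] := eqVneq i (n - d).+1; last first.
  by rewrite /= -mulgA (comm (n - d)%N i) ?mulgA ?IH //; lia.
case: d => [|d] in IH dn id e *; first by lia.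
rewrite /=; have -> : (n - d)%N = i by lia.
have -> : (n - d.+1)%N = i.-1 by lia.
have b : r i * r i.-1 * r i = r i.-1 * r i * r i.-1.
  have := braid i.-1; rewrite prednK; last by lia.
  by move=> -> //; lia.
rewrite -!mulgA (mulgA (r i)) b !mulgA; congr (_ * _ * _).
by rewrite rg_c_low //; lia.
Qed.

Definition rg_tau : gT := rg_c n n * r 0%N * (rg_c n n)^-1.

Lemma rg_tau_cent i : (i < n)%N -> r i * rg_tau = rg_tau * r i.
Proof.
have [_ sq b01 _ comm] := rel; case: i => [|i] hi.
  have E : rg_c n n = rg_c n n.-1 * r 1%N.
    by rewrite -{2}(prednK n0) /=; congr (_ * r _); lia.
  have c0 : commute (r 0%N) (rg_c n n.-1).
    by rewrite /commute rg_c_low //; lia.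
  have -> : rg_tau =
      rg_c n n.-1 * (r 1%N * r 0%N * (r 1%N)^-1) * (rg_c n n.-1)^-1.
    by rewrite /rg_tau E invMg !mulgA.
  apply: commuteM; last exact: commuteV.
  apply: commuteM => //; rewrite /commute.
  have i1 : (r 1%N)^-1 = r 1%N by apply/eqP; rewrite eq_invg_mul sq //; lia.
  by rewrite i1 !mulgA b01.
have E : r i.+1 = r i.+2 ^ (rg_c n n)^-1.
  by rewrite conjgE invgK mulgA rg_c_high ?mulgK //; lia.
have -> : rg_tau = r 0%N ^ (rg_c n n)^-1 by rewrite conjgE invgK mulgA.
by rewrite E -!conjMg (comm 0%N i.+2).
Qed.

Lemma rg_tau_norm a : {in rg_sub n, forall x, x * rg_tau ^+ a = rg_tau ^+ a * x}.
Proof.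
have sub : rg_sub n \subset 'C[rg_tau].
  rewrite gen_subG; apply/subsetP => _ /imsetP[i _ ->].
  by apply/cent1P; rewrite /commute rg_tau_cent //; apply: ltn_ord.
by move=> x /(subsetP sub) /cent1P xt; apply: commuteX; apply: commute_sym.
Qed.

Definition rg_cosets : {set gT} :=
  \bigcup_(p : 'I_m.-1.+1 * 'I_n.+1)
     (rg_sub n :* (rg_tau ^+ p.1 * rg_c n p.2)).

Lemma rg_tau_m : rg_tau ^+ m = 1.
Proof.
have [h _ _ _ _] := rel.
have -> : rg_tau = r 0%N ^ (rg_c n n)^-1 by rewrite conjgE invgK mulgA.
by rewrite -conjXg h // conj1g.
Qed.

Lemma rg_cosets_stable i x : (i <= n)%N -> x \in rg_cosets ->
  x * r i \in rg_cosets.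
Proof.
have [_ sq _ _ _] := rel.
move=> hi /bigcupP[[a d] _ /= /rcosetP[y yK ->]].
have key (z : gT) (b e : nat) : z \in rg_sub n -> (e <= n)%N ->
    z * (rg_tau ^+ b * rg_c n e) \in rg_cosets.
  move=> zK en; rewrite (_ : rg_tau ^+ b = rg_tau ^+ (b %% m.-1.+1)); last first.
    rewrite prednK // [in LHS](divn_eq b m) expgD mulnC expgM rg_tau_m.
    by rewrite expg1n mul1g.
  apply/bigcupP; exists (inord (b %% m.-1.+1), inord e) => //=.
  by rewrite !inordK ?ltn_pmod //; rewrite mem_rcoset mulgK.
have dn : (d <= n)%N by rewrite -ltnS.
rewrite -!mulgA.
have [hi1|] := ltnP (i + d) n.
  rewrite rg_c_low // (mulgA _ (r i)).
  have iK : r i \in rg_sub n by apply: rg_subP; lia.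
  rewrite -rg_tau_norm // -(mulgA (r i)) (mulgA y).
  by apply: key => //; rewrite groupM.
rewrite leq_eqVlt => /orP[/eqP id|].
  case: i => [|i] in hi id *.
    have -> : nat_of_ord d = n by lia.
    rewrite (_ : rg_c n n * r 0%N = rg_tau * rg_c n n); last by rewrite mulgKV.
    by rewrite (mulgA (_ ^+ _)) -expgSr; apply: key.
  have -> : rg_c n d * r i.+1 = rg_c n d.+1 by congr (_ * r _); lia.
  by apply: key => //; lia.
rewrite leq_eqVlt => /orP[/eqP id|id]; last first.
  rewrite rg_c_high //; last by lia.
  have i1 : r i.-1 \in rg_sub n by apply: rg_subP; lia.
  rewrite (mulgA _ (r i.-1)) -rg_tau_norm // -(mulgA (r i.-1)) (mulgA y).
  by apply: key => //; rewrite groupM.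
case: (nat_of_ord d) dn id => [|d'] dn id; first by lia.
rewrite /= -(mulgA (rg_c n d')); have -> : (n - d')%N = i by lia.
by rewrite sq ?mulg1; [apply: key => //|]; lia.
Qed.

Lemma rg_sub_step : (#|rg_sub n.+1| <= (m * n.+1) * #|rg_sub n|)%N.
Proof.
have sub : rg_sub n.+1 \subset rg_cosets.
  apply/subsetP => x /gen_prodgP[k [c cP ->]].
  elim: k c cP => [|k IH] c cP.
    rewrite big_ord0; apply/bigcupP; exists (ord0, ord0) => //=.
    by rewrite mulg1 rcoset1 group1.
  rewrite big_ord_recr /=; have /imsetP[i _ ->] := cP ord_max.
  apply: rg_cosets_stable; first by rewrite -ltnS; exact: ltn_ord.
  by apply: (IH (fun j => c (widen_ord (leqnSn k) j))) => j; apply: cP.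
apply: leq_trans (subset_leq_card sub) _.
rewrite /rg_cosets (@leq_trans (\sum_(p : 'I_m.-1.+1 * 'I_n.+1) #|rg_sub n|)) //.
  elim/big_rec2: _ => [|p x A _ IH]; first by rewrite cards0.
  apply: leq_trans (leq_card_setU _ _) _.
  by rewrite card_rcoset leq_add2l.
by rewrite sum_nat_const cardT -cardE card_prod !card_ord prednK.
Qed.

End Step.

Lemma rg_sub_bound n : (0 < m)%N -> rg_relations m n r ->
  (#|rg_sub n| <= m ^ n * n`!)%N.
Proof.
move=> m0; elim: n => [|n IH] rel.
  have /subset_leq_card : rg_sub 0 \subset [1 gT].
    by rewrite gen_subG; apply/subsetP => y /imsetP[i]; have := ltn_ord i.
  by rewrite cards1.
have [->|n0] := posnP n.
  have [h _ _ _ _] := rel.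
  have /subset_leq_card/leq_trans -> // : rg_sub 1 \subset <[r 0%N]>.
    rewrite gen_subG; apply/subsetP => _ /imsetP[i _ ->].
    by rewrite (ord1 i) cycle_id.
  by rewrite expn1 muln1 dvdn_leq // order_dvdn h.
apply: leq_trans (rg_sub_step rel m0 n0) _.
rewrite expnS factS mulnACA leq_mul2l; apply/orP; right.
exact/IH/rg_relationsW.
Qed.

End OrderBound.

Lemma sgen_generates m n :
  <<[set sgen m n (val i) | i : 'I_n]>>%g = [set: refl_group m n].
Proof.
apply/eqP; rewrite eqEsubset subsetT /= -gen_Pigen gen_subG.
have sP i : (i < n)%N -> sgen m n i \in <<[set sgen m n (val i) | i : 'I_n]>>%g.
  by move=> hi; apply: mem_gen; apply/imsetP; exists (Ordinal hi).
apply/subsetP => x; rewrite inE => /orP[] /imsetP[i _ ->].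
  rewrite /tgen /=; case: i => k; rewrite /=.
  elim: k => [|k IH] hk; first exact: (sP 0%N).
  by rewrite -[tgen0 _ _ _]/(sgen m n k.+1 * tgen0 m n k * sgen m n k.+1)%g
    !groupM ?IH ?sP // ltnW.
by apply: sP; rewrite -ltn_predRL; exact: ltn_ord.
Qed.

Lemma sgen_universal m n (gT : finGroupType) (r : nat -> gT) : (0 < m)%N ->
  rg_relations m n r ->
  exists f : {morphism [set: refl_group m n] >-> gT},
    forall i, (i < n)%N -> f (sgen m n i) = r i.
Proof.
move=> m0 rel.
pose s i : refl_group m n * gT := (sgen m n i, r i).
have pX (a : refl_group m n) (b : gT) k : ((a, b) ^+ k = (a ^+ k, b ^+ k))%g.
  by elim: k => // k IH; rewrite !expgS IH.
have rels : rg_relations m n s.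
  have [a1 a2 a3 a4 a5] := sgen_relations m n; have [b1 b2 b3 b4 b5] := rel.
  split=> [n0|i hi|n1|i i0 hi|i j ij jn].
  - by rewrite pX a1 ?b1.
  - by congr pair; [apply: a2 | apply: b2].
  - by congr pair; [apply: a3 | apply: b3].
  - by congr pair; [apply: a4 | apply: b4].
  - by congr pair; [apply: a5 | apply: b5].
pose K := rg_sub s n.
have cK : (#|K| <= #|refl_group m n|)%N.
  rewrite card_prod card_ffun !card_ord card_Sn prednK //.
  exact: rg_sub_bound.
have fstK (u : refl_group m n) : exists v : gT, (u, v) \in K.
  have : u \in <<[set sgen m n (val i) | i : 'I_n]>>%g.
    by rewrite sgen_generates inE.
  move=> /gen_prodgP[k [c cP ->]]; elim: k c cP => [|k IH] c cP.
    by exists 1%g; rewrite big_ord0; exact: (group1 K).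
  rewrite big_ord_recr /=; have /imsetP[i _ ->] := cP ord_max.
  have [|v vK] := IH (fun j => c (widen_ord (leqnSn k) j)).
    by move=> j; apply: cP.
  exists (v * r i)%g.
  exact: (groupM (G := K) vK (rg_subP s (ltn_ord i))).
pose g (u : refl_group m n) : refl_group m n * gT := (u, xchoose (fstK u)).
have gK u : g u \in K by exact: (xchooseP (fstK u)).
have Kg : [set g u | u : refl_group m n] = K.
  apply/eqP; rewrite eqEcard; apply/andP; split.
    by apply/subsetP => _ /imsetP[u _ ->].
  by rewrite card_imset // => u v [].
have gU w : w \in K -> w = g w.1.
  by rewrite -{1}Kg => /imsetP[u _ ->].
have fM : {in [set: refl_group m n] &,
    {morph (fun u => (g u).2) : u v / (u * v)%g >-> (u * v)%g}}.
  move=> u v _ _; have := gU _ (groupM (G := K) (gK u) (gK v)).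
  by move=> /(congr1 snd) /= ->.
exists (Morphism fM) => i hi /=.
by have := gU _ (rg_subP s hi) => /(congr1 snd) /= ->.
Qed.

(* The reflection representation of G(m,1,n). *)
Definition refl_mx (F : fieldType) (zeta : F) m n (u : refl_group m n) : 'M[F]_n :=
  \matrix_(i, j) (zeta ^+ u.1 i *+ (u.2 i == j)).

Lemma refl_mxM (F : fieldType) (zeta : F) m n : (0 < m)%N -> zeta ^+ m = 1 ->
  {morph @refl_mx F zeta m n : u v / (u * v)%g >-> u *m v}.
Proof.
move=> m0 zm u v; apply/matrixP => i k; rewrite !mxE (bigD1 (u.2 i)) //= big1.
    rewrite !mxE eqxx mulr1n addr0 permM ffunE mulrnAr -exprD /=.
  congr (_ *+ _); rewrite -[RHS](expr_mod _ zm).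
  have m1 : m.-1.+1 = m by rewrite prednK.
  by congr (_ ^+ _); exact: (congr1 (modn _) m1).
by move=> j ji; rewrite !mxE eq_sym (negPf ji) mulr0n mul0r.
Qed.

Lemma refl_mx_inj (F : fieldType) (zeta : F) m n : m.-primitive_root zeta ->
  injective (@refl_mx F zeta m n).
Proof.
move=> zP; have m0 := prim_order_gt0 zP; move=> [a s] [b t] /matrixP E.
have z0 k : zeta ^+ k != 0.
  apply: expf_neq0; apply/eqP => z0; have := prim_expr_order zP.
  by rewrite z0 expr0n gtn_eqF // => /eqP; rewrite eq_sym oner_eq0.
have st : s = t.
  apply/permP => i; have := E i (s i); rewrite !mxE /= eqxx mulr1n eq_sym.
  by case: eqVneq => // _ /eqP; rewrite mulr0n (negPf (z0 _)).
congr pair => //; apply/ffunP => i; have := E i (s i).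
rewrite !mxE /= -st eqxx !mulr1n => /eqP; rewrite (eq_prim_root_expr zP).
by move=> /eqP; rewrite !modn_small ?(leq_trans (ltn_ord _)) ?prednK // => /val_inj.
Qed.

(** * Word length *)

Lemma word_ex (gT : finGroupType) (Pi : {set gT}) (gen : <<Pi>>%g = [set: gT])
    (g : gT) :
  exists k, [exists r : k.-tuple gT,
    all (mem Pi) r && (g == (\prod_(x <- r) x)%g)].
Proof.
have : g \in <<Pi>>%g by rewrite gen inE.
move=> /gen_prodgP[k [c cPi ->]]; exists k.
apply/existsP; exists [tuple c i | i < k]; apply/andP; split.
  by apply/allP => x /mapP[i _ ->]; exact: cPi.
by rewrite big_tuple; apply/eqP/eq_bigr => i _; rewrite tnth_mktuple.
Qed.

Definition word_length (gT : finGroupType) (Pi : {set gT})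
  (gen : <<Pi>>%g = [set: gT]) (g : gT) : nat := ex_minn (word_ex gen g).

Definition rg_length (m n : nat) : refl_group m n -> nat :=
  word_length (gen_Pigen m n).

From mathcomp Require Import complex.
From mathcomp Require Import all_classical all_reals all_analysis.

Import numFieldNormedType.Exports.

Local Open Scope complex_scope.

(* The group algebra C[gT], as the free C-module with basis gelt; its product is
   not needed. *)
Definition group_algebra (R : realType) (gT : finType) := {ffun gT -> R[i]^o}.

Definition gelt (R : realType) (gT : finType) (u : gT) : group_algebra R gT :=
  [ffun v => (v == u)%:R].

Local Open Scope classical_set_scope.

(** * Hilbert spaces and bounded operators *)

Definition inner_product (R : realType) (V : lmodType R[i])
    (f : V -> V -> R[i]) : Prop :=
  [/\ forall x (a : R[i]) y z, f x (a *: y + z) = a * f x y + f x z,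
      forall x y, f y x = (f x y)^*
    & forall x, x != 0 -> 0 < f x x].

HB.mixin Record isHilbert (R : realType) H of CompleteNormedModule R[i] H := {
  inner : H -> H -> R[i];
  innerP : inner_product inner;
  inner_normE : forall x, inner x x = `|x| ^+ 2
}.

#[short(type="hilbertType")]
HB.structure Definition Hilbert (R : realType) :=
  {H of CompleteNormedModule R[i] H & isHilbert R H}.

(* The norm of the library takes its values in R[i]. *)
Definition hnorm (R : realType) (H : hilbertType R) (x : H) : R :=
  complex.Re `|x|.

Definition opnorm_wrt (R : realType) (V W : Type) (NV : V -> R) (NW : W -> R)
    (A : V -> W) : \bar R :=
  ereal_sup [set (NW (A v))%:E | v in [set v | NV v <= 1]].

Definition opnorm (R : realType) (H K : hilbertType R) (A : H -> K) : \bar R :=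
  opnorm_wrt (@hnorm R H) (@hnorm R K) A.

Definition bounded_operator (R : realType) (H K : hilbertType R)
    (A : H -> K) : Prop :=
  linear A /\ (opnorm A < +oo)%E.

(* B = A^* *)
Definition is_adjoint (R : realType) (H : hilbertType R) (A B : H -> H) : Prop :=
  forall x y, inner (A x) y = inner x (B y).

Definition quasimultiplicative (R : realType) (gT : finGroupType)
    (len : gT -> nat) (K : hilbertType R)
    (phi : group_algebra R gT -> K -> K) : Prop :=
  [/\ linear phi,
      forall a, bounded_operator (phi a),
      phi (gelt R 1%g) = id
    & forall u v, len (u * v)%g = (len u + len v)%N ->
        phi (gelt R (u * v)%g) = phi (gelt R u) \o phi (gelt R v)].

(** * Tensor powers *)

Definition is_hilbert_tensor (R : realType) (H K L : hilbertType R)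
    (tens : H -> K -> L) : Prop :=
  [/\ forall (a : R[i]) x x' y, tens (a *: x + x') y = a *: tens x y + tens x' y,
      forall (a : R[i]) x y y', tens x (a *: y + y') = a *: tens x y + tens x y',
      forall x x' y y', inner (tens x y) (tens x' y') = inner x x' * inner y y'
    & dense [set \sum_(p <- s) tens p.1 p.2 | s in [set: seq (H * K)]]].

(* A realization of the Hilbert space tensor powers F n of H: F 0 is spanned by
   the unit vector vac, and F n.+1 is the Hilbert tensor product of H and F n.
   Realizations exist for every H (complete the algebraic tensor powers) and are
   unique up to a unique unitary compatible with vac and tcons, so a statement
   about the tensor powers is quantified over all realizations. In particular
   H (x) H is F 2, where x (x) y is tcons x (tcons y vac). *)
Record tensor_powers (R : realType) (H : hilbertType R) := TensorPowers {
  tpow :> nat -> hilbertType R;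
  vac : tpow 0%N;
  tcons : forall n, H -> tpow n -> tpow n.+1;
  vac_unit : inner vac vac = 1;
  vac_span : forall X : tpow 0%N, exists c : R[i], X = c *: vac;
  tcons_tensor : forall n, is_hilbert_tensor (@tcons n)
}.

Section Operators.
Variables (R : realType) (H : hilbertType R) (F : tensor_powers H).

(* In the next definitions, density makes the bounded operator satisfying the
   given equation unique; xget 0 selects it. *)

(* A (x) id, for A on H *)
Definition tens_left (A : H -> H) (n : nat) : F n.+1 -> F n.+1 :=
  xget 0 [set B : F n.+1 -> F n.+1 | bounded_operator B /\
    forall x X, B (tcons x X) = tcons (A x) X].

(* id_H (x) A *)
Definition tens_right (k n : nat) (A : F k -> F n) : F k.+1 -> F n.+1 :=
  xget 0 [set B : F k.+1 -> F n.+1 | bounded_operator B /\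
    forall x X, B (tcons x X) = tcons x (A X)].

(* tcat Y X = X (x) Y *)
Fixpoint tcat (n : nat) (Y : F n) (k : nat) : F k -> F (k + n)%N :=
  match k return F k -> F (k + n)%N with
  | 0 => fun X => inner (vac F) X *: Y
  | k'.+1 => tens_right (@tcat n Y k')
  end.

(* A (x) id, for A on F k *)
Definition tens_id (k : nat) (A : F k -> F k) (n : nat) :
    F (k + n)%N -> F (k + n)%N :=
  xget 0 [set B : F (k + n)%N -> F (k + n)%N | bounded_operator B /\
    forall X Y, B (tcat Y X) = tcat Y (A X)].

(* Top0 A n j is the operator acting as A on the tensor factor number j,
   counted from 0. *)
Fixpoint Top0 (A : H -> H) (n j : nat) : F n -> F n :=
  match n return F n -> F n with
  | 0 => id
  | n'.+1 => if j is j'.+1 then tens_right (@Top0 A n' j') else @tens_left A n'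
  end.

(* Sop0 A n i is the operator acting as A on the tensor factors number i and
   i.+1, counted from 0. *)
Fixpoint Sop0 (A : F 2%N -> F 2%N) (n i : nat) : F n -> F n :=
  match n return F n -> F n with
  | 0 => id
  | n'.+1 =>
    match i with
    | i'.+1 => tens_right (@Sop0 A n' i')
    | 0 => match n' return F n'.+1 -> F n'.+1 with
           | 0 => id
           | n''.+1 => @tens_id 2%N A n''
           end
    end
  end.

(* T_j, 1 <= j <= n, and S_i, 1 <= i < n *)
Definition Top (T : H -> H) (n j : nat) : F n -> F n := @Top0 T n j.-1.
Definition Sop (S : F 2%N -> F 2%N) (n i : nat) : F n -> F n := @Sop0 S n i.-1.

Definition Rop (m : nat) (S : F 2%N -> F 2%N) (T : H -> H) (n : nat) : F n -> F n :=
  ((id : F n -> F n) + \sum_(1 <= i < m) iter i (@Top T n 1)) \o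
  ((id : F n -> F n) +
     \sum_(1 <= j < n) \big[comp/id]_(1 <= k < j.+1) @Sop S n k).

(* l(x) on F n.+1; l^*(x) is tcons x *)
Definition lann (x : H) (n : nat) : F n.+1 -> F n :=
  xget 0 [set A : F n.+1 -> F n | bounded_operator A /\
    forall y Y, A (tcons y Y) = inner x y *: Y].

(* phi is the quasimultiplicative map with phi (s_i) = S_i, phi (t_j) = T_j.
   For m = 1 all t_j are 1, and only phi (1) = id is required of them. *)
Definition is_phi (m : nat) (S : F 2%N -> F 2%N) (T : H -> H) (n : nat)
    (phi : group_algebra R (refl_group m n) -> F n -> F n) : Prop :=
  [/\ quasimultiplicative (@rg_length m n) phi,
      forall i, (1 <= i < n)%N -> phi (gelt R (sgen m n i)) = @Sop S n i
    & (1 < m)%N -> forall j, (1 <= j <= n)%N ->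
        phi (gelt R (tgen m n j)) = @Top T n j].

Definition Pop (m : nat)
    (phi : forall n, group_algebra R (refl_group m n) -> F n -> F n) (n : nat) :
    F n -> F n :=
  match n return F n -> F n with
  | 0 => id
  | n'.+1 => \sum_(u : refl_group m n'.+1) phi n'.+1 (gelt R u)
  end.

End Operators.

(** * The algebraic full Fock space *)

Record fock (R : realType) (H : hilbertType R) (F : tensor_powers H) := Fock {
  fcomp :> forall n, F n;
  fcomp_fin : exists N, forall n, (N <= n)%N -> fcomp n = 0
}.

Section FockModule.
Variables (R : realType) (H : hilbertType R) (F : tensor_powers H).
Implicit Types X Y Z : fock F.

Lemma fockP X Y : (forall n, X n = Y n) -> X = Y.
Proof.
case: X Y => [X hX] [Y hY] /= E.
have {E} E : X = Y by apply: functional_extensionality_dep.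
by subst Y; congr Fock; exact: Prop_irrelevance.
Qed.

HB.instance Definition _ := gen_eqMixin (fock F).
HB.instance Definition _ := gen_choiceMixin (fock F).

Lemma fock0_fin : exists N, forall n, (N <= n)%N -> (0 : F n) = 0.
Proof. by exists 0%N. Qed.

Lemma fockD_fin X Y : exists N, forall n, (N <= n)%N -> X n + Y n = 0.
Proof.
case: (fcomp_fin X) (fcomp_fin Y) => [N hN] [M hM]; exists (maxn N M) => n.
by rewrite geq_max => /andP[Nn Mn]; rewrite hN // hM // addr0.
Qed.

Lemma fockN_fin X : exists N, forall n, (N <= n)%N -> - X n = 0.
Proof. by case: (fcomp_fin X) => [N hN]; exists N => n /hN ->; rewrite oppr0. Qed.

Lemma fockZ_fin (a : R[i]) X : exists N, forall n, (N <= n)%N -> a *: X n = 0.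
Proof. by case: (fcomp_fin X) => [N hN]; exists N => n /hN ->; rewrite scaler0. Qed.

Definition fock_zero : fock F := Fock fock0_fin.
Definition fock_add X Y : fock F := Fock (fockD_fin X Y).
Definition fock_opp X : fock F := Fock (fockN_fin X).
Definition fock_scale (a : R[i]) X : fock F := Fock (fockZ_fin a X).

Lemma fock_addA : associative fock_add.
Proof. by move=> X Y Z; apply: fockP => n /=; rewrite addrA. Qed.
Lemma fock_addC : commutative fock_add.
Proof. by move=> X Y; apply: fockP => n /=; rewrite addrC. Qed.
Lemma fock_add0 : left_id fock_zero fock_add.
Proof. by move=> X; apply: fockP => n /=; rewrite add0r. Qed.
Lemma fock_addN : left_inverse fock_zero fock_opp fock_add.
Proof. by move=> X; apply: fockP => n /=; rewrite addNr. Qed.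

HB.instance Definition _ := GRing.isZmodule.Build (fock F)
  fock_addA fock_addC fock_add0 fock_addN.

Lemma fock_scaleA a b X : fock_scale a (fock_scale b X) = fock_scale (a * b) X.
Proof. by apply: fockP => n /=; rewrite scalerA. Qed.
Lemma fock_scale1 : left_id 1 fock_scale.
Proof. by move=> X; apply: fockP => n /=; rewrite scale1r. Qed.
Lemma fock_scaleDr : right_distributive fock_scale +%R.
Proof. by move=> a X Y; apply: fockP => n /=; rewrite scalerDr. Qed.
Lemma fock_scaleDl X : {morph fock_scale^~ X : a b / a + b}.
Proof. by move=> a b; apply: fockP => n /=; rewrite scalerDl. Qed.

HB.instance Definition _ := GRing.Zmodule_isLmodule.Build R[i] (fock F)
  fock_scaleA fock_scale1 fock_scaleDr fock_scaleDl.

End FockModule.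


Section ZeroPreserving.
Variables (R : realType) (H : hilbertType R) (F : tensor_powers H).

Lemma xget_bounded0 (K L : hilbertType R) (P : (K -> L) -> Prop) :
  xget (0 : K -> L) [set B | bounded_operator B /\ P B] 0 = 0.
Proof.
case: xgetP => [B _ [[linB _] _]|//].
by have := linB (-1) 0 0; rewrite scaler0 addr0 scaleN1r addNr.
Qed.

Lemma Top0_0 T n j : Top0 T j (0 : F n) = 0.
Proof. by case: n j => [|n] [|j] //=; exact: xget_bounded0. Qed.

Lemma Sop0_0 S n i : Sop0 S i (0 : F n) = 0.
Proof. by case: n i => [|[|n]] [|i] //=; exact: xget_bounded0. Qed.

Lemma Rop_0 m S T n : Rop m S T (0 : F n) = 0.
Proof.
rewrite /Rop /= !fctE !fct_sumE.
rewrite (_ : \sum_(1 <= j < n) _ = 0); last first.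
  rewrite big1 // => j _; elim/big_ind: _ => // [A B A0 B0|i _] /=.
    by rewrite B0 A0.
  exact: Sop0_0.
rewrite addr0 big1 ?addr0 // => i _.
by elim: i => //= i ->; exact: Top0_0.
Qed.

End ZeroPreserving.

Section FockOperators.
Variables (R : realType) (H : hilbertType R) (F : tensor_powers H).
Implicit Types X Y : fock F.

Lemma tcons0 (x : H) n : tcons x (0 : F n) = 0.
Proof.
have [_ tD _ _] := tcons_tensor F n; have := tD (-1) x 0 0.
by rewrite scaler0 addr0 scaleN1r addNr.
Qed.

Definition create_fun (x : H) X : forall n, F n :=
  fun n => if n is n'.+1 return F n then tcons x (X n') else 0.

Lemma create_fin x X :
  exists N, forall n, (N <= n)%N -> create_fun x X n = 0.
Proof.
case: (fcomp_fin X) => [N hN]; exists N.+1 => -[//|n] /hN /= ->.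
exact: tcons0.
Qed.

(* d^*(x) *)
Definition create (x : H) X : fock F := Fock (create_fin x X).

Variables (m : nat) (S : F 2%N -> F 2%N) (T : H -> H).

Lemma annihilate_fin x X : exists N, forall n, (N <= n)%N ->
  lann x (Rop m S T (X n.+1)) = 0.
Proof.
case: (fcomp_fin X) => [N hN]; exists N => n Nn.
by rewrite hN ?(leqW Nn) // Rop_0; exact: xget_bounded0.
Qed.

(* d(x); the component X 0 in C vac is sent to 0. *)
Definition annihilate (x : H) X : fock F := Fock (annihilate_fin x X).

Variable phi : forall n, group_algebra R (refl_group m n) -> F n -> F n.

(* Different degrees are orthogonal, and only finitely many terms are nonzero;
   see form_G_same and form_G_diff. *)
Definition form_G X Y : R[i] :=
  \sum_(n \in [set: nat]) inner (X n) (Pop phi (Y n)).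

Definition norm_G X : R := Num.sqrt (complex.Re (form_G X X)).

(* The inclusion of F k in the Fock space. *)
Definition fock_in_fun (k : nat) (X : F k) (n : nat) : F n :=
  if k =P n is ReflectT e then ecast n (F n) e X else 0.

Lemma fock_in_fin k (X : F k) :
  exists N, forall n, (N <= n)%N -> fock_in_fun X n = 0.
Proof.
exists k.+1 => n kn; rewrite /fock_in_fun; case: eqP => // e.
by exfalso; move: kn; rewrite e ltnn.
Qed.

Definition fock_in k (X : F k) : fock F := Fock (fock_in_fin X).

Lemma fock_in_same k (X : F k) : fock_in X k = X.
Proof.
by rewrite /= /fock_in_fun; case: eqP => // e; rewrite (eq_irrelevance e erefl).
Qed.

Lemma fock_in_diff k n (X : F k) : k <> n -> fock_in X n = 0.
Proof. by rewrite /= /fock_in_fun; case: eqP. Qed.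

Lemma inner0l (K : hilbertType R) (y : K) : inner 0 y = 0.
Proof.
have [lin conj _] := @innerP R K; rewrite conj.
have := lin y (-1) 0 0; rewrite scaler0 addr0 mulN1r addNr => ->.
exact: conjC0.
Qed.

Lemma form_G_same k (X Y : F k) :
  form_G (fock_in X) (fock_in Y) = inner X (Pop phi Y).
Proof.
rewrite /form_G -(fsbig_widen [set k : nat] setT) //; last first.
  by move=> n [_ /= /nesym kn];
  rewrite /preimage /mkset -[LHS]/(inner (fock_in X n) _) (fock_in_diff X kn) inner0l.
by rewrite fsbig_set1 !fock_in_same.
Qed.

Lemma form_G_diff k n (X : F k) (Y : F n) :
  (forall p a, (0 < p)%N -> bounded_operator (@phi p a)) -> k <> n ->
  form_G (fock_in X) (fock_in Y) = 0.
Proof.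
move=> phib kn; rewrite /form_G -(fsbig_widen [set k : nat] setT) //; last first.
  by move=> p [_ /= /nesym kp];
  rewrite /preimage /mkset -[LHS]/(inner (fock_in X p) _) (fock_in_diff X kp) inner0l.
rewrite fsbig_set1 fock_in_same (fock_in_diff Y (nesym kn)).
have -> : Pop phi (0 : F k) = 0.
  case: k {X kn} => [//|k] /=; rewrite fct_sumE big1 // => u _.
  have [lin _] := phib k.+1 (gelt R u) isT.
  by have := lin (-1) 0 0; rewrite scaler0 addr0 scaleN1r addNr.
have [lin _ _] := @innerP R (F k).
by have := lin X (-1) 0 0; rewrite scaler0 addr0 mulN1r addNr.
Qed.

End FockOperators.

(* Main.v *)
Require Import Defs.
From HB Require Import structures.
From mathcomp Require Import all_boot all_order all_algebra all_fingroup.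
From mathcomp Require Import complex.
From mathcomp Require Import all_classical all_reals all_analysis.
From mathcomp Require Import ring lra zify.

Set Implicit Arguments.
Unset Strict Implicit.
Unset Printing Implicit Defensive.

Import Order.TTheory GRing.Theory Num.Theory numFieldNormedType.Exports.

Local Open Scope classical_set_scope.
Local Open Scope complex_scope.
Local Open Scope ring_scope.

(** Write Theta for the sum of the T_1^i over 0 <= i < m and A_n for the sum of
    the products S_1 ... S_k over 0 <= k < n, so that R_n = Theta A_n.

    The recursion. Every element of G(m,1,n+1) is in exactly one way a product
    u' t_1^i s_1 ... s_k, where u' comes from G(m,1,n) by shifting all indices by
    one ([rg_cons_bij], [rg_consE]), and the lengths of the factors add up
    ([rg_length_cons]). The reason is that the length of (a, s) is the sum of the
    exponents a_j plus the number of inversions of s ([rg_length_size]): this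
    number grows by at most one when a generator is appended, and the normal form
    is a word of that size. Quasimultiplicativity turns the bijection into
    P_(n+1) = (1 (x) P_n) R_(n+1) ([Pop_rec]). As l(x) (1 (x) B) = B l(x) and
    l(x) is adjoint to x (x) -, the recursion gives the adjointness of creation and
    annihilation operators ([create_annihilate]). The same
    principle, that two reduced words of one group element have the same image
    under phi, gives the braid relations of the S_i and, for m > 1, the relations
    S_1 T_1 = T_2 S_1 and S_1 T_2 = T_1 S_1 ([phi_braid], [Sop_braid], [Sop_Top]).

    Symmetry. Since A_(n+2) = 1 + S_1 (1 (x) A_(n+1)), unfolding the recursion
    twice writes P_(n+2) as (1 (x) P_(n+1)) Theta plus an operator of the form
    B* M B, where M is the product of 1 (x) 1 (x) P_n, Theta_1 Theta_2 and S_1. These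
    are symmetric and commute pairwise, hence M is symmetric ([Pop_at_adj]).

    Positivity. For 0 <= t <= 1 replace S by t S and Theta by (1 - t) + t Theta in
    the recursion. The operators P_n(t) form a Lipschitz path of symmetric
    operators from the identity to P_n. They are bounded below uniformly in t:
    P_(n+1)(t) is the product of the adjoint of A_(n+1)(t), of Theta(t) and of
    1 (x) P_n(t). The first factor is handled by the identity
    (1 - D_k) (1 + D_1 + ... + D_k) = (1 + D_1 + ... + D_(k-1)) (1 - D_k S_1) with
    D_k = S_k ... S_1 ([descent_sum_lower]), and the second one by the geometric
    sum identity (1 - T) Theta = 1 - T^m ([theta_lower]). A symmetric operator
    that is bounded below and nonnegative is strictly positive with a constant that
    depends only on its bounds ([pos_lower]), so positivity propagates along the
    path in finitely many steps ([homotopy_pos]).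

    The norm of the creation operators. P_(n+1) = Q R with Q = 1 (x) P_n
    nonnegative and both P_(n+1) and Q symmetric, so R is symmetric for the form of
    Q. Its norm for that form is then at most its operator norm ([krein_bound]),
    which is at most the product of two geometric series. Hence
    P_(n+1) <= (1 (x) P_n) / ((1 - |S|) (1 - |T|)) ([Pop_le]), and
    <x (x) X, (1 (x) P_n) (x (x) X)> is |x|^2 <X, P_n X>.

    Operators on tensor products. The operators A (x) 1, 1 (x) A and l(x) exist and
    inherit bounds and positivity because a bound on finite sums of simple tensors
    is the nonnegativity of a sum of products of Gram matrices ([gram_ge0]). *)

(** * Positive semidefinite forms *)

Section Forms.
Variable R : realType.
Implicit Types (V W : lmodType R[i]) (a : R[i]).

(** Forms that may degenerate, such as c <y, z> - <A y, A z> for a contraction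
    A / sqrt c: these are the forms that encode operator inequalities. *)
Definition psd_form V (k : V -> V -> R[i]) : Prop :=
  [/\ forall x a y z, k x (a *: y + z) = a * k x y + k x z,
      forall x y, k y x = (k x y)^*
    & forall x, 0 <= k x x].

Lemma inner_product_psd V (f : V -> V -> R[i]) : inner_product f -> psd_form f.
Proof.
case=> lin conj pos; split=> // x.
have [->|/pos/ltW//] := eqVneq x 0.
by have := lin 0 (-1) 0 0; rewrite scaler0 addr0 mulN1r addNr => ->.
Qed.

Section FormTheory.
Variables (V : lmodType R[i]) (k : V -> V -> R[i]).
Hypothesis kP : psd_form k.

Lemma formC x y : k y x = (k x y)^*. Proof. by case: kP. Qed.

Lemma form0r x : k x 0 = 0.
Proof.
by have [lin _ _] := kP; have := lin x (-1) 0 0; rewrite scaler0 addr0 mulN1r addNr.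
Qed.

Lemma formDr x y z : k x (y + z) = k x y + k x z.
Proof. by have [lin _ _] := kP; rewrite -[y]scale1r lin mul1r scale1r. Qed.

Lemma formZr x a y : k x (a *: y) = a * k x y.
Proof. by have [lin _ _] := kP; rewrite -[_ *: y]addr0 lin form0r addr0. Qed.

Lemma form0l y : k 0 y = 0.
Proof. by rewrite formC form0r conjC0. Qed.

Lemma formDl x y z : k (x + y) z = k x z + k y z.
Proof. by rewrite formC formDr rmorphD /= -!formC. Qed.

Lemma formZl a x y : k (a *: x) y = a^* * k x y.
Proof. by rewrite formC formZr rmorphM /= -formC. Qed.

Lemma form_sumr (I : Type) (s : seq I) (F : I -> V) x :
  k x (\sum_(i <- s) F i) = \sum_(i <- s) k x (F i).
Proof. by elim/big_rec2: _ => [|i y z _ <-]; rewrite ?form0r ?formDr. Qed.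

Lemma form_suml (I : Type) (s : seq I) (F : I -> V) y :
  k (\sum_(i <- s) F i) y = \sum_(i <- s) k (F i) y.
Proof. by elim/big_rec2: _ => [|i z x _ <-]; rewrite ?form0l ?formDl. Qed.

End FormTheory.

(** Evaluate the form at f(x, x) y - f(x, y) x. *)
Lemma form_cauchy_schwarz V (f : V -> V -> R[i]) : inner_product f ->
  forall x y, f y x * f x y <= f x x * f y y.
Proof.
move=> fP x y; have kP := inner_product_psd fP.
have [->|x0] := eqVneq x 0.
  by rewrite !(form0r kP) !(form0l kP) !mul0r.
have [_ _ pos] := fP; have xx := pos _ x0.
have cxx : (f x x)^* = f x x by rewrite -(formC kP).
have [_ _ /(_ (f x x *: y + (- f x y) *: x))] := kP.
rewrite !(formDl kP, formDr kP, formZl kP, formZr kP) cxx rmorphN /= -(formC kP).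
set E := (X in 0 <= X).
have -> : E = f x x * (f x x * f y y - f y x * f x y) by rewrite /E; ring.
by rewrite pmulr_rge0 // subr_ge0.
Qed.

(** The sum of the entries of the Hadamard product of two Gram matrices. *)
Definition gram V W (f : V -> V -> R[i]) (k : W -> W -> R[i]) (s : seq (V * W)) : R[i] :=
  \sum_(p <- s) \sum_(q <- s) f p.1 q.1 * k p.2 q.2.

(** The Schur product theorem. Splitting every first component along the first
    vector x of the list and its orthogonal complement separates a square, which is
    f(x, x) k(Y, Y), from a sum of the same kind over a shorter list. *)
Lemma gram_ge0 V W (f : V -> V -> R[i]) (k : W -> W -> R[i]) (s : seq (V * W)) :
  inner_product f -> psd_form k -> 0 <= gram f k s.
Proof.
move=> fP kP; have gP := inner_product_psd fP.
have [n] := ubnP (size s); elim: n s => // n IH [|[x y] s] /= sn.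
  by rewrite /gram big_nil.
have [x0|x0] := eqVneq x 0.
  rewrite (_ : gram _ _ _ = gram f k s); first exact: IH.
  rewrite /gram big_cons big1 => [|q _]; last by rewrite x0 (form0l gP) mul0r.
  by rewrite add0r; apply: eq_bigr => p _; rewrite big_cons x0 (form0r gP) mul0r add0r.
have [_ _ pos] := fP; have xx := pos _ x0.
pose c z := f x z / f x x.
pose pr z := z + (- c z) *: x.
have cx : c x = 1 by rewrite /c divff // gt_eqF.
have prx : pr x = 0 by rewrite /pr cx scaleN1r subrr.
have cxx : (f x x)^* = f x x by rewrite -(formC gP).
have fE z w : f z w = f (pr z) (pr w) + (c z)^* * c w * f x x.
  have fz t : f x t = c t * f x x by rewrite /c divfK // gt_eqF.
  have zf t : f t x = (c t)^* * f x x by rewrite (formC gP) fz rmorphM /= cxx.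
  rewrite /pr !(formDl gP, formDr gP, formZl gP, formZr gP) rmorphN /=.
  by rewrite (fz w) (zf z); ring.
pose s1 := (x, y) :: s.
pose Y := \sum_(p <- s1) c p.1 *: p.2.
pose s2 := [seq (pr p.1, p.2) | p <- s].
rewrite (_ : gram f k s1 = gram f k s2 + f x x * k Y Y).
  rewrite addr_ge0 ?IH ?size_map // mulr_ge0 ?(ltW xx) //.
  by have [_ _] := kP; apply.
have -> : gram f k s2 = \sum_(p <- s1) \sum_(q <- s1) f (pr p.1) (pr q.1) * k p.2 q.2.
  rewrite [RHS]big_cons [X in _ = X + _]big1 ?add0r; last first.
    by move=> q _; rewrite /= prx (form0l gP) mul0r.
  rewrite /gram big_map; apply: eq_bigr => p _.
  by rewrite [RHS]big_cons /= prx (form0r gP) mul0r add0r big_map.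
rewrite /Y (form_suml kP) mulr_sumr -big_split /=; apply: eq_bigr => p _.
rewrite (form_sumr kP) mulr_sumr -big_split /=; apply: eq_bigr => q _.
by rewrite fE (formZr kP) (formZl kP) /=; ring.
Qed.

End Forms.

Section HilbertBasics.
Variables (R : realType).
Implicit Types (H K : hilbertType R).

Lemma inner_psd H : psd_form (@inner R H).
Proof. exact/inner_product_psd/innerP. Qed.

Lemma innerC H (x y : H) : inner y x = (inner x y)^*.
Proof. exact: formC (inner_psd H) _ _. Qed.
Lemma innerDr H (x y z : H) : inner x (y + z) = inner x y + inner x z.
Proof. exact: formDr (inner_psd H) _ _ _. Qed.
Lemma innerZr H (x y : H) a : inner x (a *: y) = a * inner x y.
Proof. exact: formZr (inner_psd H) _ _ _. Qed.
Lemma innerNr H (x y : H) : inner x (- y) = - inner x y.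
Proof. by rewrite -scaleN1r innerZr mulN1r. Qed.
Lemma innerBr H (x y z : H) : inner x (y - z) = inner x y - inner x z.
Proof. by rewrite innerDr innerNr. Qed.
Lemma inner_sumr H (x : H) (I : Type) (s : seq I) (F : I -> H) :
  inner x (\sum_(i <- s) F i) = \sum_(i <- s) inner x (F i).
Proof. exact: (form_sumr (inner_psd H)). Qed.
Lemma innerDl H (x y z : H) : inner (x + y) z = inner x z + inner y z.
Proof. exact: formDl (inner_psd H) _ _ _. Qed.
Lemma innerZl H (x y : H) a : inner (a *: x) y = a^* * inner x y.
Proof. exact: formZl (inner_psd H) _ _ _. Qed.
Lemma innerNl H (x y : H) : inner (- x) y = - inner x y.
Proof. by rewrite -scaleN1r innerZl rmorphN rmorph1 mulN1r. Qed.
Lemma inner_suml H (x : H) (I : Type) (s : seq I) (F : I -> H) :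
  inner (\sum_(i <- s) F i) x = \sum_(i <- s) inner (F i) x.
Proof. exact: (form_suml (inner_psd H)). Qed.

Lemma normE H (x : H) : `|x| = (hnorm x)%:C.
Proof. by rewrite RRe_real // ger0_real // normr_ge0. Qed.

Lemma hnorm_ge0 H (x : H) : 0 <= hnorm x.
Proof. by rewrite -ler0c -normE normr_ge0. Qed.

Lemma innerE H (x : H) : inner x x = (hnorm x ^+ 2)%:C.
Proof. by rewrite inner_normE normE rmorphXn. Qed.

Lemma hnorm0 H : hnorm (0 : H) = 0.
Proof. by rewrite /hnorm normr0. Qed.

Lemma hnorm_eq0 H (x : H) : hnorm x = 0 -> x = 0.
Proof. by move=> x0; apply/eqP; rewrite -normr_eq0 normE x0. Qed.

Lemma hnormD H (x y : H) : hnorm (x + y) <= hnorm x + hnorm y.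
Proof. by rewrite -lecR rmorphD /= -!normE ler_normD. Qed.

Lemma hnormN H (x : H) : hnorm (- x) = hnorm x.
Proof. by rewrite /hnorm normrN. Qed.

Lemma hnormBC H (x y : H) : hnorm (x - y) = hnorm (y - x).
Proof. by rewrite /hnorm distrC. Qed.

Lemma hnormB H (x y : H) : hnorm (x - y) <= hnorm x + hnorm y.
Proof. by rewrite -(hnormN y) hnormD. Qed.

Lemma hnormBB H (x y : H) : hnorm x - hnorm y <= hnorm (x - y).
Proof. by rewrite lerBlDr; apply: le_trans (hnormD _ _); rewrite subrK. Qed.

Lemma hnormZ H (a : R[i]) (x : H) : hnorm (a *: x) = complex.Re `|a| * hnorm x.
Proof.
apply: complexI; rewrite rmorphM /= RRe_real ?ger0_real ?normr_ge0 //.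
by rewrite -!normE normrZ.
Qed.

Lemma normRe_real (t : R) : complex.Re `|t%:C| = `|t|.
Proof. by rewrite normc_def /= expr0n addr0 sqrtr_sqr. Qed.

Lemma hnormZr H (t : R) (x : H) : hnorm (t%:C *: x) = `|t| * hnorm x.
Proof. by rewrite hnormZ normRe_real. Qed.

Definition rinner H (x y : H) : R := complex.Re (inner x y).

Lemma ReD (z w : R[i]) : complex.Re (z + w) = complex.Re z + complex.Re w.
Proof. by case: z w => [? ?] [? ?]. Qed.
Lemma ReN (z : R[i]) : complex.Re (- z) = - complex.Re z.
Proof. by case: z. Qed.
Lemma ReJ (z : R[i]) : complex.Re (z^*) = complex.Re z.
Proof. by case: z. Qed.
Lemma ReMr (t : R) (z : R[i]) : complex.Re (t%:C * z) = t * complex.Re z.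
Proof. by case: z => [? ?] /=; rewrite mul0r subr0. Qed.

Lemma rinnerC H (x y : H) : rinner x y = rinner y x.
Proof. by rewrite /rinner innerC ReJ. Qed.
Lemma rinnerDl H (x y z : H) : rinner (x + y) z = rinner x z + rinner y z.
Proof. by rewrite /rinner innerDl ReD. Qed.
Lemma rinnerDr H (x y z : H) : rinner x (y + z) = rinner x y + rinner x z.
Proof. by rewrite /rinner innerDr ReD. Qed.
Lemma rinnerNl H (x y : H) : rinner (- x) y = - rinner x y.
Proof. by rewrite /rinner innerNl ReN. Qed.
Lemma rinnerNr H (x y : H) : rinner x (- y) = - rinner x y.
Proof. by rewrite /rinner innerNr ReN. Qed.
Lemma rinnerZl H (t : R) (x y : H) : rinner (t%:C *: x) y = t * rinner x y.
Proof. by rewrite /rinner innerZl (_ : (t%:C)^* = t%:C) ?ReMr //; exact: conjc_real. Qed.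
Lemma rinnerZr H (t : R) (x y : H) : rinner x (t%:C *: y) = t * rinner x y.
Proof. by rewrite /rinner innerZr ReMr. Qed.

Definition rinnerE := (rinnerDl, rinnerDr, rinnerNl, rinnerNr, rinnerZl, rinnerZr).

Lemma rinnerxx H (x : H) : rinner x x = hnorm x ^+ 2.
Proof. by rewrite /rinner innerE. Qed.

Lemma norm_rinner H (x y : H) : complex.Re `|inner x y| <= hnorm x * hnorm y.
Proof.
have := form_cauchy_schwarz (@innerP R H) x y.
rewrite (innerC x y) mulrC -normCK !innerE -rmorphM /= -[X in X ^+ 2]RRe_real.
  rewrite -rmorphXn lecR -exprMn ler_sqr // nnegrE ?mulr_ge0 ?hnorm_ge0 //.
  by rewrite -ler0c RRe_real ?normr_ge0 // ger0_real ?normr_ge0.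
by rewrite ger0_real ?normr_ge0.
Qed.

Lemma Re_le_norm (z : R[i]) : `|complex.Re z| <= complex.Re `|z|.
Proof.
by case: z => a b; rewrite normc_def /= -sqrtr_sqr ler_wsqrtr // lerDl sqr_ge0.
Qed.

Lemma rinner_le H (x y : H) : `|rinner x y| <= hnorm x * hnorm y.
Proof. exact: le_trans (Re_le_norm _) (norm_rinner _ _). Qed.

Lemma inner_ext H (x y : H) : (forall z, inner z x = inner z y) -> x = y.
Proof.
move=> E; apply/subr0_eq/hnorm_eq0/eqP; rewrite -sqrf_eq0 -rinnerxx /rinner.
by rewrite innerBr E subrr.
Qed.

Lemma inner_extl H (x y : H) : (forall z, inner x z = inner y z) -> x = y.
Proof. by move=> E; apply: inner_ext => z; rewrite innerC E -innerC. Qed.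

End HilbertBasics.

(** * Bounded operators *)

Section BoundedOperators.
Variable R : realType.
Implicit Types H K L : hilbertType R.

Section Linear.
Variables (V W : lmodType R[i]) (A : V -> W).
Hypothesis linA : linear A.

Lemma lin0 : A 0 = 0.
Proof. by have := linA (-1) 0 0; rewrite scaler0 addr0 scaleN1r addNr. Qed.
Lemma linD x y : A (x + y) = A x + A y.
Proof. by rewrite -[x]scale1r linA !scale1r. Qed.
Lemma linZ a x : A (a *: x) = a *: A x.
Proof. by rewrite -[a *: x]addr0 linA lin0 addr0. Qed.
Lemma linN x : A (- x) = - A x.
Proof. by rewrite -scaleN1r linZ scaleN1r. Qed.
Lemma linB x y : A (x - y) = A x - A y.
Proof. by rewrite linD linN. Qed.
Lemma lin_sum (I : Type) (s : seq I) (F : I -> V) :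
  A (\sum_(i <- s) F i) = \sum_(i <- s) A (F i).
Proof. exact: (big_morph A linD lin0). Qed.

End Linear.

(** Boundedness with an explicit constant, which stays available when operators are
    composed, added and extended. *)
Definition bounded_by H K (M : R) (A : H -> K) : Prop :=
  [/\ linear A, 0 <= M & forall x, hnorm (A x) <= M * hnorm x].

Lemma bounded_by_lin H K M (A : H -> K) : bounded_by M A -> linear A.
Proof. by case. Qed.

(** The norm of the operator is a supremum over the unit ball, so that the bound
    follows by homogeneity. *)
Lemma opnorm_bounded_by H K (A : H -> K) :
  bounded_operator A -> bounded_by (fine (opnorm A)) A.
Proof.
move=> [linA fin].
have ub x : hnorm x <= 1 -> ((hnorm (A x))%:E <= opnorm A)%E.
  by move=> x1; apply: ereal_sup_ubound; exists x.
have A0 : (0 <= opnorm A)%E.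
  by apply: le_trans (ub 0 _); rewrite ?hnorm0 ?ler01 // lee_fin hnorm_ge0.
have finA : opnorm A \is a fin_num by rewrite ge0_fin_numE.
split=> [//||x]; first exact: fine_ge0.
have [->|x0] := eqVneq x 0; first by rewrite (lin0 linA) !hnorm0 mulr0.
have nx : 0 < hnorm x.
  by rewrite lt_neqAle hnorm_ge0 andbT eq_sym; apply: contraNneq x0 => /hnorm_eq0->.
have := ub ((hnorm x)^-1%:C *: x); rewrite (linZ linA) !hnormZr.
rewrite ger0_norm ?invr_ge0 ?hnorm_ge0 // mulVf ?gt_eqF // => /(_ (lexx _)).
by rewrite -[X in (_ <= X)%E]fineK // lee_fin ler_pdivrMl // mulrC.
Qed.

Lemma bounded_byP H K (A : H -> K) :
  bounded_operator A <-> exists M, bounded_by M A.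
Proof.
split=> [/opnorm_bounded_by|[M [linA M0 leM]]]; first by exists (fine (opnorm A)).
split=> //; apply: (@le_lt_trans _ _ M%:E); last exact: ltry.
apply: ge_ereal_sup => _ [x /= x1 <-]; rewrite lee_fin.
by apply: le_trans (leM x) _; rewrite ler_piMr.
Qed.

End BoundedOperators.

Section Density.
Variables (R : realType) (H : hilbertType R).

Lemma dense_approx (D : set H) : dense D ->
  forall X (e : R), 0 < e -> exists2 d, D d & hnorm (X - d) < e.
Proof.
move=> dD X e e0; have e0' : 0 < e%:C by rewrite ltcR.
have [|d [/= /interior_subset dX Dd]] := dD (ball X e%:C)^°%classic _ (@open_interior _ _).
  by exists X; apply: nbhs_singleton; apply: nbhs_interior; apply: nbhsx_ballx.
exists d => //; move: dX; rewrite -ball_normE /= normE.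
by rewrite ltcR.
Qed.

(** The completeness of a Hilbert space in terms of its real-valued norm; the norm
    of the underlying normed module has complex values. *)
Lemma hcauchy_cvg (v : nat -> H) :
  (forall e : R, 0 < e -> exists N, forall i j, (N <= i)%N -> (N <= j)%N ->
     hnorm (v i - v j) < e) ->
  exists l, forall e : R, 0 < e -> exists N, forall i, (N <= i)%N ->
     hnorm (v i - l) < e.
Proof.
move=> cau.
have posE (e : R[i]) : 0 < e -> exists2 e', 0 < e' & e = e'%:C.
  move=> e0; exists (complex.Re e); last by rewrite RRe_real // gtr0_real.
  by rewrite -ltcR RRe_real // gtr0_real.
have /cauchy_cvg/cvg_ex[l vl] : cauchy (v @ \oo).
  apply/cauchy_ballP => _ /posE[e e0 ->]; have [N cN] := cau e e0.
  (* Cauchy filters are described by sets; the tails of the sequence are small. *)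
  pose tail : set H := [set v i | i in [set i | (N <= i)%N]].
  have tailF : (v @ \oo) tail by exists N => // i Ni; exists i.
  exists (tail, tail); first by split.
  case=> _ _ [/= [i /= Ni <-] [j /= Nj <-]].
  by rewrite -ball_normE /= normE ltcR; apply: cN.
exists l => e e0; have e0' : 0 < e%:C by rewrite ltcR.
have /cvgrPdist_lt/(_ _ e0')[N _ lN] := vl.
by exists N => i /lN /=; rewrite normE ltcR hnormBC.
Qed.

End Density.

(** * Linear maps out of a Hilbert tensor product *)

Lemma le_eps (R : realFieldType) (x y : R) :
  (exists2 C, 0 <= C & forall e, 0 < e <= 1 -> x <= y + C * e) -> x <= y.
Proof.
move=> [C C0 le]; rewrite leNgt; apply/negP => lt.
have C1 : 0 < C + 1 by rewrite ltr_wpDl.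
(* For this e the assumed inequality bounds x - y by half of itself. *)
pose e := Num.min 1 ((x - y) / (C + 1) / 2).
have e0 : 0 < e by rewrite lt_min ltr01 !divr_gt0 ?subr_gt0.
have e1 : e <= 1 by rewrite ge_min lexx.
have := le e; rewrite e0 e1 => /(_ isT); apply/negP; rewrite -ltNge.
have : e <= (x - y) / (C + 1) / 2 by rewrite ge_min lexx orbT.
have : (x - y) / (C + 1) * (C + 1) = x - y by rewrite divfK ?gt_eqF.
have : 0 < (x - y) / (C + 1) by rewrite divr_gt0 ?subr_gt0.
by set f := _ / _; clearbody e f; nra.
Qed.

Section HilbertTensor.
Variables (R : realType) (H K L : hilbertType R) (tens : H -> K -> L).
Hypothesis tensP : is_hilbert_tensor tens.

Lemma tensDl x x' y : tens (x + x') y = tens x y + tens x' y.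
Proof. by case: tensP => /(_ 1 x x' y); rewrite !scale1r. Qed.
Lemma tensDr x y y' : tens x (y + y') = tens x y + tens x y'.
Proof. by case: tensP => _ /(_ 1 x y y'); rewrite !scale1r. Qed.
Lemma tens0l y : tens 0 y = 0.
Proof.
case: tensP => /(_ (-1) 0 0 y) E _ _ _; move: E.
by rewrite scaler0 addr0 scaleN1r addNr.
Qed.
Lemma tens0r x : tens x 0 = 0.
Proof.
case: tensP => _ /(_ (-1) x 0 0) E _ _; move: E.
by rewrite scaler0 addr0 scaleN1r addNr.
Qed.
Lemma tensZl a x y : tens (a *: x) y = a *: tens x y.
Proof. by case: tensP => /(_ a x 0 y); rewrite tens0l !addr0. Qed.
Lemma tensZr a x y : tens x (a *: y) = a *: tens x y.
Proof. by case: tensP => _ /(_ a x y 0); rewrite tens0r !addr0. Qed.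
Lemma inner_tens x x' y y' :
  inner (tens x y) (tens x' y') = inner x x' * inner y y'.
Proof. by case: tensP. Qed.

Lemma hnorm_tens x y : hnorm (tens x y) = hnorm x * hnorm y.
Proof.
apply: (@pexpIrn _ 2) => //; rewrite ?nnegrE ?mulr_ge0 ?hnorm_ge0 //.
by apply: complexI; rewrite -innerE inner_tens !innerE -rmorphM exprMn.
Qed.

Definition tsum (s : seq (H * K)) : L := \sum_(p <- s) tens p.1 p.2.

Lemma tsum_dense X (e : R) : 0 < e -> exists s, hnorm (X - tsum s) < e.
Proof.
case: tensP => _ _ _ dL e0.
by have [_ [s _ <-] lt] := dense_approx dL X e0; exists s.
Qed.

(** All inequalities and equations below pass from finite sums of simple tensors to
    the whole space through this lemma. The Lipschitz constant may depend on X, so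
    that quadratic expressions are covered. *)
Lemma tens_closed_ge0 (f : L -> R) (X : L) :
  (exists2 C, 0 <= C &
     forall X', hnorm (X - X') <= 1 -> f X' <= f X + C * hnorm (X - X')) ->
  (forall s, 0 <= f (tsum s)) -> 0 <= f X.
Proof.
move=> [C C0 lip] pos; apply: le_eps; exists C => // e /andP[e0 e1].
have [s /ltW lt] := tsum_dense X e0.
apply: le_trans (pos s) _; apply: le_trans (lip _ (le_trans lt e1)) _.
by rewrite lerD2l ler_wpM2l.
Qed.

Section Extension.
Variables (L' : hilbertType R) (g : H -> K -> L') (M : R).
Hypothesis gl : forall y, linear (g^~ y).
Hypothesis M0 : 0 <= M.

Let gsum (s : seq (H * K)) : L' := \sum_(p <- s) g p.1 p.2.
Hypothesis gM : forall s, hnorm (gsum s) <= M * hnorm (tsum s).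

Let scal a (s : seq (H * K)) := [seq (a *: p.1, p.2) | p <- s].

Let tsum_scal a s : tsum (scal a s) = a *: tsum s.
Proof. by rewrite /tsum big_map scaler_sumr; apply: eq_bigr => p _; exact: tensZl. Qed.

Let gsum_scal a s : gsum (scal a s) = a *: gsum s.
Proof.
by rewrite /gsum big_map scaler_sumr; apply: eq_bigr => p _; exact: (linZ (gl _)).
Qed.

Let approx X l := forall e : R, 0 < e ->
  exists s, hnorm (X - tsum s) < e /\ hnorm (l - gsum s) < e.

Let approx_lin a X X' l l' :
  approx X l -> approx X' l' -> approx (a *: X + X') (a *: l + l').
Proof.
move=> A A' e e0; set c : R := complex.Re `|a|.
have c0 : 0 <= c by rewrite -ler0c RRe_real ?normr_ge0 // ger0_real ?normr_ge0.
pose e1 := e / (c + 1).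
have c1 : 0 < c + 1 by rewrite ltr_wpDl.
have e10 : 0 < e1 by rewrite divr_gt0.
have [s [s1 s2]] := A e1 e10; have [s' [s1' s2']] := A' e1 e10.
have key (V : hilbertType R) (x x' y y' : V) : hnorm (x - y) < e1 ->
    hnorm (x' - y') < e1 -> hnorm (a *: x + x' - (a *: y + y')) < e.
  move=> h h'; rewrite opprD addrACA -scalerBr.
  apply: le_lt_trans (hnormD _ _) _; rewrite hnormZ -/c.
  have -> : e = c * e1 + e1 by rewrite /e1; field; rewrite gt_eqF.
  by rewrite ler_ltD // ler_wpM2l // ltW.
exists (scal a s ++ s').
rewrite /tsum /gsum !big_cat -/(tsum _) -/(tsum _) -/(gsum _) -/(gsum _) /=.
by rewrite tsum_scal gsum_scal; split; apply: key.
Qed.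

Let approx_le X l : approx X l -> hnorm l <= M * hnorm X.
Proof.
move=> A; apply: le_eps; exists (M + 1) => [|e /andP[e0 _]]; first by rewrite addr_ge0.
have [s [s1 s2]] := A e e0.
have h1 : hnorm l <= hnorm (gsum s) + e.
  by rewrite -lerBlDl; apply: le_trans (hnormBB _ _) (ltW s2).
have h2 : hnorm (tsum s) <= hnorm X + e.
  by rewrite -lerBlDl; apply: le_trans (hnormBB _ _) _; rewrite hnormBC ltW.
apply: le_trans h1 _; rewrite mulrDl mul1r addrA lerD2r.
by apply: le_trans (gM s) _; rewrite -mulrDr ler_wpM2l.
Qed.

Let approx_ex X : exists l, approx X l.
Proof.
have pos n : 0 < n.+1%:R^-1 :> R by rewrite invr_gt0 ltr0n.
have small (e : R) : 0 < e -> exists N, forall n, (N <= n)%N -> n.+1%:R^-1 < e.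
  move=> e0; have [N eN] := ltr_add_invr e0; rewrite add0r in eN.
  exists N => n Nn; apply: le_lt_trans eN.
  by rewrite lef_pV2 ?posrE ?ltr0n // ler_nat ltnS.
have /choice[u uP] : forall n : nat, exists s, hnorm (X - tsum s) < n.+1%:R^-1.
  by move=> n; exact: tsum_dense (pos n).
have lip s s' : hnorm (gsum s - gsum s') <= M * hnorm (tsum s - tsum s').
  have := gM (s ++ scal (-1) s'); rewrite /tsum /gsum !big_cat /=.
  rewrite -/(tsum _) -/(tsum _) -/(gsum _) -/(gsum _) tsum_scal gsum_scal.
  by rewrite !scaleN1r.
have [e e0|l lP] := @hcauchy_cvg _ _ (gsum \o u).
  have e10 : 0 < e / (M * 2 + 1) by rewrite divr_gt0 // ltr_wpDl // mulr_ge0.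
  have [N NP] := small _ e10; exists N => i j Ni Nj /=.
  apply: le_lt_trans (lip _ _) _.
  have h : hnorm (tsum (u i) - tsum (u j)) <= e / (M * 2 + 1) * 2.
    rewrite -(subrKA X) mulr_natr; apply: le_trans (hnormD _ _) _.
    rewrite hnormBC mulr2n lerD // ltW //; apply: lt_trans (NP _ _) => //.
  apply: le_lt_trans (ler_wpM2l M0 h) _.
  have E : e = e / (M * 2 + 1) * (M * 2 + 1).
    by rewrite divfK // gt_eqF // ltr_wpDl // mulr_ge0.
  by rewrite [ltRHS]E; move: e10; set f := e / _; nra.
exists l => e e0; have [N NP] := lP e e0; have [N' NP'] := small e e0.
exists (u (maxn N N')); split; last by rewrite hnormBC NP // leq_maxl.
by apply: lt_trans (uP _) _; apply: NP'; rewrite leq_maxr.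
Qed.

(** The extension is the limit of its values along finite sums that converge to X.
    These values form a Cauchy sequence by the assumed bound. Linearity and
    uniqueness are read off from the relation that a pair (X, l) is approximated by
    pairs of corresponding finite sums, which is linear in (X, l). *)
Lemma tens_extend : exists2 B : L -> L', bounded_by M B &
  forall x y, B (tens x y) = g x y.
Proof.
have /choice[B BP] := approx_ex.
have uniq X l l' : approx X l -> approx X l' -> l = l'.
  move=> A A'; apply/subr0_eq/hnorm_eq0/le_anti; rewrite hnorm_ge0 andbT.
  have := approx_le (approx_lin (-1) A' A).
  by rewrite !scaleN1r !addNr hnorm0 mulr0 addrC.
exists B; first split=> //.
- by move=> a X X'; apply: uniq (BP _) _; apply: approx_lin.
- by move=> X; apply: approx_le.
move=> x y; apply: uniq (BP _) _ => e e0; exists [:: (x, y)].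
by rewrite /tsum /gsum !big_seq1 !subrr !hnorm0.
Qed.

End Extension.

Lemma inner_tsum s : inner (tsum s) (tsum s) = gram (@inner R H) (@inner R K) s.
Proof.
rewrite inner_suml; apply: eq_bigr => p _; rewrite inner_sumr.
by apply: eq_bigr => q _; rewrite inner_tens.
Qed.

Lemma tens_ext (L' : hilbertType R) (A B : L -> L') :
  bounded_operator A -> bounded_operator B ->
  (forall x y, A (tens x y) = B (tens x y)) -> A = B.
Proof.
move=> /bounded_byP[M [lA M0 leM]] /bounded_byP[N [lB N0 leN]] E.
apply/funext => X; apply/subr0_eq/hnorm_eq0/eqP.
rewrite eq_le hnorm_ge0 andbT -oppr_ge0.
apply: (tens_closed_ge0 (f := fun X => - hnorm (A X - B X))).
  exists (M + N); first exact: addr_ge0.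
  move=> X' _; rewrite lerNl opprD opprK lerBlDr.
  have -> : A X - B X = (A X' - B X') + (A (X - X') - B (X - X')).
    by rewrite (linB lA) (linB lB) addrACA -opprD !subrKC.
  apply: le_trans (hnormD _ _) _; rewrite lerD2l mulrDl.
  by apply: le_trans (hnormB _ _) _; rewrite lerD.
move=> s; rewrite (lin_sum lA) (lin_sum lB).
by rewrite (eq_bigr _ (fun p _ => E p.1 p.2)) subrr hnorm0 oppr0.
Qed.

End HilbertTensor.

(** * Norms and positivity on Hilbert tensor products *)

Section TensorMaps.
Variable R : realType.

Lemma gramC (V W : lmodType R[i]) (f : V -> V -> R[i]) (k : W -> W -> R[i]) s :
  gram f k s = gram k f [seq (p.2, p.1) | p <- s].
Proof.
rewrite /gram big_map; apply: eq_bigr => p _; rewrite big_map.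
by apply: eq_bigr => q _; rewrite mulrC.
Qed.

Lemma gramB (V W : lmodType R[i]) (f : V -> V -> R[i]) (k1 k2 : W -> W -> R[i])
    (c1 c2 : R[i]) s :
  gram f (fun y z => c1 * k1 y z - c2 * k2 y z) s = c1 * gram f k1 s - c2 * gram f k2 s.
Proof.
rewrite /gram 2!mulr_sumr -sumrB; apply: eq_bigr => p _.
by rewrite 2!mulr_sumr -sumrB; apply: eq_bigr => q _; ring.
Qed.

Lemma psd_formB (V : lmodType R[i]) (k1 k2 : V -> V -> R[i]) (c1 c2 : R) :
  psd_form k1 -> psd_form k2 ->
  (forall x, c2%:C * k2 x x <= c1%:C * k1 x x) ->
  psd_form (fun x y => c1%:C * k1 x y - c2%:C * k2 x y).
Proof.
move=> k1P k2P le; split=> [x a y z|x y|x]; last by rewrite subr_ge0.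
  by rewrite !(formDr k1P, formZr k1P, formDr k2P, formZr k2P); ring.
rewrite (formC k1P) (formC k2P) rmorphB !rmorphM /=.
have cR (c : R) : (c%:C)^* = c%:C by exact: conjc_real.
by rewrite !cR.
Qed.

Lemma psd_form_lin (V W : lmodType R[i]) (A : V -> W) (k : W -> W -> R[i]) :
  linear A -> psd_form k -> psd_form (fun x y => k (A x) (A y)).
Proof.
move=> lA kP; split=> [x a y z|x y|x]; last by case: kP.
  by rewrite lA (formDr kP) (formZr kP).
exact: formC.
Qed.

Lemma le_sqr_hnorm (H K : hilbertType R) (c1 c2 : R) (x : H) (y : K) :
  0 <= c1 -> 0 <= c2 ->
  ((c1 ^+ 2)%:C * inner x x <= (c2 ^+ 2)%:C * inner y y) =
  (c1 * hnorm x <= c2 * hnorm y).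
Proof.
move=> c10 c20; rewrite !innerE -!rmorphM lecR -!exprMn ler_sqr //;
  by rewrite nnegrE mulr_ge0 ?hnorm_ge0.
Qed.

Section Generic.
Variables (H K L : hilbertType R) (tens : H -> K -> L).
Hypothesis tensP : is_hilbert_tensor tens.

(** The squared norms of both sides are Gram sums, so that an operator bound becomes
    an inequality between such sums. *)
Lemma gram_le (L' : hilbertType R) (g : H -> K -> L') (f : H -> H -> R[i])
    (k : K -> K -> R[i]) (M : R) :
  0 <= M ->
  (forall x x' y y', inner (g x y) (g x' y') = f x x' * k y y') ->
  (forall s, gram f k s <= (M ^+ 2)%:C * gram (@inner R H) (@inner R K) s) ->
  forall s, hnorm (\sum_(p <- s) g p.1 p.2) <= M * hnorm (tsum tens s).
Proof.
move=> M0 gE le s; rewrite -[X in X <= _]mul1r -le_sqr_hnorm // expr1n mul1r.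
apply: le_trans (_ : _ <= gram f k s) _; last by rewrite inner_tsum.
rewrite inner_suml le_eqVlt; apply/orP; left; apply/eqP/eq_bigr => p _; rewrite inner_sumr.
by apply: eq_bigr => q _; rewrite gE.
Qed.

(** 1 (x) A has the norm bound of A: the form M^2 <y, z> - <A y, A z> is positive
    semidefinite. *)
Lemma tens_mapr (K' L' : hilbertType R) (tens' : H -> K' -> L')
    (tensP' : is_hilbert_tensor tens') (A : K -> K') (M : R) :
  bounded_by M A ->
  exists2 B : L -> L', bounded_by M B & forall x y, B (tens x y) = tens' x (A y).
Proof.
move=> [lA M0 leM]; apply: tens_extend => // [y a x x'|].
  by rewrite (tensDl tensP') (tensZl tensP').
apply: (gram_le (g := fun x y => tens' x (A y)) (f := @inner R H)
  (k := fun y y' => inner (A y) (A y'))) => //.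
  by move=> x x' y y'; rewrite (inner_tens tensP').
move=> s; rewrite -subr_ge0 -[X in _ - X]mul1r -gramB.
apply: gram_ge0; first exact: innerP.
apply: (@psd_formB _ _ _ (M ^+ 2) 1); first exact: inner_psd.
  exact: psd_form_lin (inner_psd _).
by move=> x; rewrite -(expr1n R 2) le_sqr_hnorm // mul1r.
Qed.

Lemma tens_mapl (A : H -> H) (M : R) :
  bounded_by M A ->
  exists2 B : L -> L, bounded_by M B & forall x y, B (tens x y) = tens (A x) y.
Proof.
move=> [lA M0 leM]; apply: tens_extend => // [y a x x'|].
  by rewrite lA (tensDl tensP) (tensZl tensP).
apply: (gram_le (g := fun x y => tens (A x) y) (f := fun x x' => inner (A x) (A x'))
  (k := @inner R K)) => //.
  by move=> x x' y y'; rewrite (inner_tens tensP).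
move=> s; rewrite [X in X <= _]gramC [gram (@inner R H) _ _]gramC.
rewrite -subr_ge0 -[X in _ - X]mul1r -gramB.
apply: gram_ge0; first exact: innerP.
apply: (@psd_formB _ _ _ (M ^+ 2) 1); first exact: inner_psd.
  exact: psd_form_lin (inner_psd _).
by move=> x; rewrite -(expr1n R 2) le_sqr_hnorm // mul1r.
Qed.

(** Contraction with x; Cauchy-Schwarz says that |x|^2 <y, z> - <y, x> <x, z> is
    positive semidefinite. *)
Lemma tens_contract (x : H) :
  exists2 B : L -> K, bounded_by (hnorm x) B &
    forall y Y, B (tens y Y) = inner x y *: Y.
Proof.
apply: tens_extend => // [Y a y y'||]; last 1 first.
- apply: (gram_le (g := fun y Y => inner x y *: Y)
    (f := fun y y' => (inner x y)^* * inner x y') (k := @inner R K)).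
  + exact: hnorm_ge0.
  + by move=> y y' Y Y'; rewrite innerZl innerZr mulrA.
  move=> s; rewrite [X in X <= _]gramC [gram (@inner R H) _ _]gramC.
  rewrite -subr_ge0 -[X in _ - X]mul1r -gramB.
  apply: gram_ge0; first exact: innerP.
  apply: (@psd_formB _ _ _ (hnorm x ^+ 2) 1); first exact: inner_psd.
    split=> [y a z z'|y z|y].
    + by rewrite innerDr innerZr; ring.
    + by rewrite rmorphM /= conjCK mulrC.
    + by rewrite mulrC mul_conjC_ge0.
  move=> y; rewrite mul1r -innerE -innerC.
  exact: (form_cauchy_schwarz (@innerP R H)).
- by rewrite innerDr innerZr scalerDl scalerA.
- exact: hnorm_ge0.
Qed.

Lemma tens_inner_ext (L' : hilbertType R) (A : L -> L') (V : L') (W : L) :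
  bounded_operator A ->
  (forall x y, inner (A (tens x y)) V = inner (tens x y) W) ->
  forall X, inner (A X) V = inner X W.
Proof.
move=> /bounded_byP[M [lA M0 leM]] E X; pose d X := inner (A X) V - inner X W.
have dD Y Z : d (Y + Z) = d Y + d Z.
  by rewrite /d (linD lA) !innerDl opprD addrACA.
suff: 0 <= - complex.Re `|d X|.
  rewrite oppr_ge0 -lecR RRe_real ?ger0_real ?normr_ge0 //.
  by rewrite normr_le0 subr_eq0 => /eqP.
have ReD0 (a b : R[i]) : complex.Re `|a + b| <= complex.Re `|a| + complex.Re `|b|.
  rewrite -ReD -lecR !RRe_real ?ler_normD //;
    by rewrite ?rpredD ?normr_real.
have ReN0 (a : R[i]) : complex.Re `|- a| = complex.Re `|a| by rewrite normrN.
apply: (tens_closed_ge0 tensP (f := fun X => - complex.Re `|d X|)).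
  exists (M * hnorm V + hnorm W).
    by rewrite addr_ge0 ?mulr_ge0 ?hnorm_ge0.
  move=> X' _; rewrite lerNl opprD opprK lerBlDr.
  have -> : d X = d X' + d (X - X') by rewrite -dD subrKC.
  apply: le_trans (ReD0 _ _) _; rewrite lerD2l /d.
  apply: le_trans (ReD0 _ _) _; rewrite ReN0 mulrDl lerD //; last first.
    by rewrite mulrC; exact: norm_rinner.
  apply: le_trans (norm_rinner _ _) _.
  by rewrite mulrAC ler_wpM2r ?hnorm_ge0.
move=> s; rewrite /d (lin_sum lA) !inner_suml -sumrB big1 ?normr0 ?oppr0 //.
by move=> p _; rewrite E subrr.
Qed.

(** The lower bound passes to 1 (x) A because <A y, A z> - d^2 <y, z> is positive
    semidefinite. *)
Lemma tens_lower (K' L' : hilbertType R) (tens' : H -> K' -> L')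
    (tensP' : is_hilbert_tensor tens') (A : K -> K') (B : L -> L') (d : R) :
  0 <= d -> linear A -> bounded_operator B ->
  (forall x y, B (tens x y) = tens' x (A y)) ->
  (forall y, d * hnorm y <= hnorm (A y)) ->
  forall X, d * hnorm X <= hnorm (B X).
Proof.
move=> d0 lA /bounded_byP[M [lB M0 leM]] BE low X; rewrite -subr_ge0.
apply: (tens_closed_ge0 tensP (f := fun X => hnorm (B X) - d * hnorm X)).
  exists (M + d); first exact: addr_ge0.
  move=> X' _.
  have h1 : hnorm X <= hnorm X' + hnorm (X - X').
    by apply: le_trans (hnormD _ _); rewrite subrKC.
  have h2 : hnorm (B X') <= hnorm (B X) + M * hnorm (X - X').
    rewrite hnormBC; apply: le_trans (lerD (lexx _) (leM _)).
    by apply: le_trans (hnormD _ _); rewrite -(linD lB) subrKC.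
  have := ler_wpM2l d0 h1; rewrite mulrDl mulrDr; lra.
move=> s; rewrite subr_ge0 -[X in _ <= X]mul1r -le_sqr_hnorm //.
rewrite expr1n mul1r /tsum (lin_sum lB) -[X in _ * X]/(inner (tsum tens s) (tsum tens s)).
rewrite inner_tsum // inner_suml.
rewrite (eq_bigr (fun p => \sum_(q <- s) inner p.1 q.1 * inner (A p.2) (A q.2))); last first.
  move=> p _; rewrite inner_sumr; apply: eq_bigr => q _.
  by rewrite !BE (inner_tens tensP').
rewrite -[X in _ <= X]/(gram _ (fun y y' => inner (A y) (A y')) s).
rewrite -subr_ge0 -[X in X - _]mul1r -gramB.
apply: gram_ge0; first exact: innerP.
apply: (@psd_formB _ _ _ 1 (d ^+ 2)); first exact: psd_form_lin (inner_psd _).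
  exact: inner_psd.
by move=> x; rewrite -(expr1n R 2) le_sqr_hnorm // mul1r.
Qed.

Lemma tens_pos (A : K -> K) (B : L -> L) :
  linear A -> bounded_operator B ->
  (forall x y, B (tens x y) = tens x (A y)) ->
  (forall x y, inner (A x) y = inner x (A y)) ->
  (forall y, 0 <= rinner y (A y)) ->
  forall X, 0 <= rinner X (B X).
Proof.
move=> lA /bounded_byP[M [lB M0 leM]] BE symA pos X.
apply: (tens_closed_ge0 tensP (f := fun X => rinner X (B X))).
  exists (M * hnorm X + M * (hnorm X + 1)).
    by rewrite addr_ge0 ?mulr_ge0 ?addr_ge0 ?hnorm_ge0.
  move=> X' le1.
  have hX' : hnorm X' <= hnorm X + 1.
    rewrite -lerBlDl; apply: le_trans (hnormBB _ _) _.
    by rewrite hnormBC.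
  have -> : rinner X' (B X') = rinner X (B X) +
      (rinner (X' - X) (B X) + rinner X' (B (X' - X))).
    by rewrite (linB lB) !rinnerE; ring.
  rewrite lerD2l mulrDl hnormBC lerD //.
    apply: le_trans (ler_norm _) _; apply: le_trans (rinner_le _ _) _.
    by rewrite mulrC ler_wpM2r ?hnorm_ge0 // leM.
  apply: le_trans (ler_norm _) _; apply: le_trans (rinner_le _ _) _.
  rewrite mulrAC mulrC; apply: ler_pM; rewrite ?hnorm_ge0 ?leM //.
move=> s; rewrite /rinner /tsum (lin_sum lB) inner_suml.
rewrite (eq_bigr (fun p => \sum_(q <- s) inner p.1 q.1 * inner p.2 (A q.2))); last first.
  move=> p _; rewrite inner_sumr; apply: eq_bigr => q _.
  by rewrite !BE (inner_tens tensP).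
have : 0 <= gram (@inner R H) (fun y y' => inner y (A y')) s.
  apply: gram_ge0; first exact: innerP.
  split=> [x a y z|x y|x].
  - by rewrite lA innerDr innerZr.
  - by rewrite -symA innerC.
  rewrite lecE /= -[X in _ && X]/(0 <= rinner x (A x)) pos andbT.
  have : (inner x (A x))^* = inner x (A x) by rewrite -innerC symA.
  by case: inner => a b [/eqP]; rewrite eq_sym -addr_eq0 -mulr2n mulrn_eq0.
by rewrite lecE => /andP[].
Qed.

End Generic.
End TensorMaps.

(** * Operators on the tensor powers *)

Section BoundedAlgebra.
Variable R : realType.
Implicit Types H K L : hilbertType R.

Lemma bounded_byW H K M (A : H -> K) : bounded_by M A -> bounded_operator A.
Proof. by move=> AM; apply/bounded_byP; exists M. Qed.

Lemma bounded_by_id H : bounded_by 1 (id : H -> H).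
Proof. by split=> // x; rewrite mul1r. Qed.

Lemma bounded_by0 H K : bounded_by 0 (0 : H -> K).
Proof.
have E x : (0 : H -> K) x = 0 by [].
by split=> // [a x y|x]; rewrite !E ?scaler0 ?addr0 // hnorm0 mul0r.
Qed.

Lemma bounded_by_comp H K L M N (A : K -> L) (B : H -> K) :
  bounded_by M A -> bounded_by N B -> bounded_by (M * N) (A \o B).
Proof.
move=> [lA M0 leM] [lB N0 leN]; split=> [a x y||x] /=; first by rewrite lB lA.
  exact: mulr_ge0.
by apply: le_trans (leM _) _; rewrite -mulrA ler_wpM2l.
Qed.

Lemma bounded_byD H K M N (A B : H -> K) :
  bounded_by M A -> bounded_by N B -> bounded_by (M + N) (A + B).
Proof.
move=> [lA M0 leM] [lB N0 leN]; split=> [a x y||x]; rewrite ?fctE.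
- by rewrite lB lA scalerDr addrACA.
- exact: addr_ge0.
- by apply: le_trans (hnormD _ _) _; rewrite mulrDl lerD.
Qed.

Lemma bounded_byZ H K M (t : R) (A : H -> K) :
  bounded_by M A -> bounded_by (`|t| * M) (t%:C \*: A).
Proof.
move=> [lA M0 leM]; split=> [a x y||x] /=.
- by rewrite lA scalerDr !scalerA mulrC.
- by rewrite mulr_ge0.
- by rewrite hnormZr -mulrA ler_wpM2l.
Qed.

Lemma bounded_by_sum H K (I : Type) (s : seq I) (M : I -> R) (A : I -> H -> K) :
  (forall i, bounded_by (M i) (A i)) ->
  bounded_by (\sum_(i <- s) M i) (\sum_(i <- s) A i).
Proof.
move=> AM; elim/big_rec2: _ => [|i B N _ BN]; first exact: bounded_by0.
exact: bounded_byD.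
Qed.

Lemma bounded_by_iter H M (A : H -> H) i :
  bounded_by M A -> bounded_by (M ^+ i) (iter i A).
Proof.
move=> AM; elim: i => [|i IH]; first exact: bounded_by_id.
by rewrite exprS; apply: bounded_by_comp AM IH.
Qed.

Lemma bounded_by_le H K M N (A : H -> K) : M <= N -> bounded_by M A -> bounded_by N A.
Proof.
move=> MN [lA M0 leM]; split=> // [|x]; first exact: le_trans MN.
by apply: le_trans (leM x) _; rewrite ler_wpM2r ?hnorm_ge0.
Qed.

Lemma bounded_operator_comp H K L (A : K -> L) (B : H -> K) :
  bounded_operator A -> bounded_operator B -> bounded_operator (A \o B).
Proof.
move=> /bounded_byP[M AM] /bounded_byP[N BN].
exact: bounded_byW (bounded_by_comp AM BN).
Qed.

Lemma bounded_operatorD H K (A B : H -> K) :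
  bounded_operator A -> bounded_operator B -> bounded_operator (A + B).
Proof.
move=> /bounded_byP[M AM] /bounded_byP[N BN].
exact: bounded_byW (bounded_byD AM BN).
Qed.

Lemma bounded_operatorZ H K (t : R) (A : H -> K) :
  bounded_operator A -> bounded_operator (t%:C \*: A).
Proof. by move=> /bounded_byP[M /(bounded_byZ t)/bounded_byW]. Qed.

Lemma bounded_operator_sum H K (I : Type) (s : seq I) (A : I -> H -> K) :
  (forall i, bounded_operator (A i)) -> bounded_operator (\sum_(i <- s) A i).
Proof.
move=> Ab; elim/big_rec: _ => [|i B _ BN]; last exact: bounded_operatorD.
exact: bounded_byW (@bounded_by0 _ _).
Qed.

Lemma bounded_operator_id H : bounded_operator (id : H -> H).
Proof. exact: bounded_byW (@bounded_by_id _). Qed.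

End BoundedAlgebra.

Section TensorPowers.
Variables (R : realType) (H : hilbertType R) (F : tensor_powers H).

Lemma tcons_ext k n (A B : F k.+1 -> F n) :
  bounded_operator A -> bounded_operator B ->
  (forall x X, A (tcons x X) = B (tcons x X)) -> A = B.
Proof. exact: (tens_ext (tcons_tensor F k)). Qed.

(** The operator selected by the definition is the one constructed by extension,
    since bounded operators that agree on simple tensors are equal. *)
Lemma tens_right_spec M k n (A : F k -> F n) : bounded_by M A ->
  bounded_by M (tens_right A) /\ forall x X, tens_right A (tcons x X) = tcons x (A X).
Proof.
move=> AM; have [B BM BE] := tens_mapr (tcons_tensor F k) (tcons_tensor F n) AM.
rewrite /tens_right (@xget_unique _ _ _ B) //.
  by split=> //; exact: bounded_byW BM.
move=> C [Cb CE]; apply: tcons_ext => // [|x X]; first exact: bounded_byW BM.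
by rewrite CE BE.
Qed.

Lemma tens_rightM M k n (A : F k -> F n) : bounded_by M A -> bounded_by M (tens_right A).
Proof. by case/tens_right_spec. Qed.

Lemma tens_rightb k n (A : F k -> F n) :
  bounded_operator A -> bounded_operator (tens_right A).
Proof. by move=> /bounded_byP[M /tens_rightM/bounded_byW]. Qed.

Lemma tens_rightE k n (A : F k -> F n) x X : bounded_operator A ->
  tens_right A (tcons x X) = tcons x (A X).
Proof. by move=> /bounded_byP[M /tens_right_spec[_ ->]]. Qed.

Lemma tens_right_eq k n (A : F k -> F n) (B : F k.+1 -> F n.+1) :
  bounded_operator A -> bounded_operator B ->
  (forall x X, B (tcons x X) = tcons x (A X)) -> tens_right A = B.
Proof.
move=> Ab Bb E; apply: tcons_ext => // [|x X]; first exact: tens_rightb.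
by rewrite tens_rightE.
Qed.

Lemma tens_right_id k : tens_right (id : F k -> F k) = id.
Proof. by apply: tens_right_eq => //; exact: bounded_operator_id. Qed.

Lemma tens_right_comp k n p (A : F n -> F p) (B : F k -> F n) :
  bounded_operator A -> bounded_operator B ->
  tens_right (A \o B) = tens_right A \o tens_right B.
Proof.
move=> Ab Bb; apply: tens_right_eq => [||x X]; first exact: bounded_operator_comp.
  by apply: bounded_operator_comp; exact: tens_rightb.
by rewrite /= !tens_rightE.
Qed.

Lemma tens_rightD k n (A B : F k -> F n) :
  bounded_operator A -> bounded_operator B ->
  tens_right (A + B) = tens_right A + tens_right B.
Proof.
move=> Ab Bb; apply: tens_right_eq => [||x X]; first exact: bounded_operatorD.
  by apply: bounded_operatorD; exact: tens_rightb.
by rewrite !fctE !tens_rightE // (tensDr (tcons_tensor F n)).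
Qed.

Lemma tens_rightZ k n t (A : F k -> F n) : bounded_operator A ->
  tens_right (t%:C \*: A) = t%:C \*: tens_right A.
Proof.
move=> Ab; apply: tens_right_eq => [||x X]; first exact: bounded_operatorZ.
  by apply: bounded_operatorZ; exact: tens_rightb.
by rewrite /= !tens_rightE // (tensZr (tcons_tensor F n)).
Qed.

Lemma tens_right0 k n : tens_right (0 : F k -> F n) = 0.
Proof.
apply: tens_right_eq => [||x X]; do ?exact: bounded_byW (@bounded_by0 _ _ _).
exact: esym (tens0r (tcons_tensor F n) x).
Qed.

Lemma tens_right_sum k n (I : Type) (s : seq I) (A : I -> F k -> F n) :
  (forall i, bounded_operator (A i)) ->
  tens_right (\sum_(i <- s) A i) = \sum_(i <- s) tens_right (A i).
Proof.
move=> Ab; elim: s => [|i s IH]; first by rewrite !big_nil tens_right0.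
by rewrite !big_cons tens_rightD ?IH //; exact: bounded_operator_sum.
Qed.

Lemma tens_right_adj k (A : F k -> F k) :
  bounded_operator A -> is_adjoint A A -> is_adjoint (tens_right A) (tens_right A).
Proof.
move=> Ab Aa X Y; apply: (tens_inner_ext (tcons_tensor F k)); first exact: tens_rightb.
move=> x {}X; rewrite innerC [RHS]innerC; congr (_ ^*).
symmetry; apply: (tens_inner_ext (tcons_tensor F k)); first exact: tens_rightb.
by move=> y {}Y; rewrite !tens_rightE // !(inner_tens (tcons_tensor F k)) Aa.
Qed.

Lemma tens_right_lower k (A : F k -> F k) d : 0 <= d -> bounded_operator A ->
  (forall X, d * hnorm X <= hnorm (A X)) ->
  forall X, d * hnorm X <= hnorm (tens_right A X).
Proof.
move=> d0 Ab; apply: (tens_lower (tcons_tensor F k) (tcons_tensor F k)) => //.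
- by case: Ab.
- exact: tens_rightb.
- by move=> x X; rewrite tens_rightE.
Qed.

Lemma tens_right_pos k (A : F k -> F k) : bounded_operator A -> is_adjoint A A ->
  (forall X, 0 <= rinner X (A X)) -> forall X, 0 <= rinner X (tens_right A X).
Proof.
move=> Ab Aa; apply: (tens_pos (tcons_tensor F k)) => //; first by case: Ab.
  exact: tens_rightb.
by move=> x X; rewrite tens_rightE.
Qed.

Lemma tens_left_spec M (A : H -> H) n : bounded_by M A ->
  bounded_by M (@tens_left _ _ F A n) /\
  forall x X, tens_left A (tcons x X : F n.+1) = tcons (A x) X.
Proof.
move=> AM; have [B BM BE] := tens_mapl (tcons_tensor F n) AM.
rewrite /tens_left (@xget_unique _ _ _ B) //.
  by split=> //; exact: bounded_byW BM.
move=> C [Cb CE]; apply: tcons_ext => // [|x X]; first exact: bounded_byW BM.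
by rewrite CE BE.
Qed.

Lemma tens_leftM M (A : H -> H) n : bounded_by M A -> bounded_by M (@tens_left _ _ F A n).
Proof. by case/(@tens_left_spec _ _ n). Qed.

Lemma tens_leftb (A : H -> H) n :
  bounded_operator A -> bounded_operator (@tens_left _ _ F A n).
Proof. by move=> /bounded_byP[M /(@tens_leftM _ _ n)/bounded_byW]. Qed.

Lemma tens_leftE (A : H -> H) n x (X : F n) : bounded_operator A ->
  tens_left A (tcons x X) = tcons (A x) X.
Proof. by move=> /bounded_byP[M /(@tens_left_spec _ _ n)[_ ->]]. Qed.

Lemma tens_left_adj n (A : H -> H) : bounded_operator A -> is_adjoint A A ->
  is_adjoint (@tens_left _ _ F A n) (@tens_left _ _ F A n).
Proof.
move=> Ab Aa X Y; apply: (tens_inner_ext (tcons_tensor F n)); first exact: tens_leftb.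
move=> x {}X; rewrite innerC [RHS]innerC; congr (_ ^*).
symmetry; apply: (tens_inner_ext (tcons_tensor F n)); first exact: tens_leftb.
by move=> y {}Y; rewrite !tens_leftE // !(inner_tens (tcons_tensor F n)) Aa.
Qed.

Lemma tens_left_right n (A : H -> H) (B : F n -> F n) :
  bounded_operator A -> bounded_operator B ->
  @tens_left _ _ F A n \o tens_right B = tens_right B \o @tens_left _ _ F A n.
Proof.
move=> Ab Bb; have rb := tens_rightb Bb; have lb := tens_leftb n Ab.
apply: tcons_ext => [||x X]; do ?exact: bounded_operator_comp.
by rewrite /= tens_rightE // !tens_leftE // tens_rightE.
Qed.

Lemma lann_spec (x : H) n :
  bounded_by (hnorm x) (@lann _ _ F x n) /\
  forall y Y, lann x (tcons y Y : F n.+1) = inner x y *: Y.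
Proof.
have [B BM BE] := tens_contract (tcons_tensor F n) x.
rewrite /lann (@xget_unique _ _ _ B) //.
  by split=> //; exact: bounded_byW BM.
move=> C [Cb CE]; apply: tcons_ext => // [|y Y]; first exact: bounded_byW BM.
by rewrite CE BE.
Qed.

Lemma lann_adj x n (X : F n) (Y : F n.+1) :
  inner (tcons x X) Y = inner X (lann x Y).
Proof.
have [lM lE] := lann_spec x n.
rewrite innerC [RHS]innerC; congr (_ ^*); symmetry.
apply: (tens_inner_ext (tcons_tensor F n)) => [|y {}Y]; first exact: bounded_byW lM.
by rewrite lE innerZl -innerC (inner_tens (tcons_tensor F n)).
Qed.

Lemma lann_tens_right x n (A : F n -> F n) Y : bounded_operator A ->
  lann x (tens_right A Y) = A (lann x Y).
Proof.
move=> Ab; have [lM lE] := lann_spec x n; have lb := bounded_byW lM.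
have [lA _] := Ab.
have rb := tens_rightb Ab.
suff: lann x (n := n) \o tens_right A = A \o lann x (n := n) by move/(congr1 (@^~ Y)).
apply: tcons_ext => [||y {}Y]; do ?exact: bounded_operator_comp.
by rewrite /= tens_rightE // !lE (linZ lA).
Qed.

Lemma tcat0E n (Y : F n) (X : F 0%N) : tcat Y X = inner (vac F) X *: Y.
Proof. by []. Qed.

Lemma dense_approxP (L : hilbertType R) (D : set L) :
  (forall X (e : R), 0 < e -> exists2 d, D d & hnorm (X - d) < e) -> dense D.
Proof.
move=> ap O [X OX] Oo; have : nbhs X O by apply: open_nbhs_nbhs; split.
move=> /nbhs_ballP[e /= e0 eO].
have eE : e = (complex.Re e)%:C by rewrite RRe_real // gtr0_real.
have [|d Dd lt] := ap X (complex.Re e); first by rewrite -ltcR -eE.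
exists d; split=> //; apply: eO; rewrite -ball_normE /= normE eE ltcR.
exact: lt.
Qed.

Lemma tcat_bounded k n (Y : F n) :
  is_hilbert_tensor (fun (X : F k) (Y : F n) => tcat Y X) ->
  bounded_by (hnorm Y) (@tcat _ _ F n Y k).
Proof.
move=> tP; split=> [a X X'||X]; last by rewrite (hnorm_tens tP) mulrC.
  by rewrite (tensDl tP) (tensZl tP).
exact: hnorm_ge0.
Qed.

(** Associativity of the tensor product: by induction on k, F (k + n) is a Hilbert
    tensor product of F k and F n. *)
Lemma tcat_tensor k n : is_hilbert_tensor (fun (X : F k) (Y : F n) => tcat Y X).
Proof.
elim: k => [|k IH].
  split=> [a X X' Y|a X Y Y'|X X' Y Y'|].
  - by rewrite !tcat0E innerDr innerZr scalerDl scalerA.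
  - by rewrite !tcat0E scalerDr !scalerA mulrC.
  - have [c ->] := vac_span X; have [c' ->] := vac_span X'.
    rewrite !tcat0E !innerZl !innerZr (vac_unit F); ring.
  - apply: dense_approxP => X e e0; exists X; last by rewrite subrr hnorm0.
    exists [:: (vac F, X)] => //.
    by rewrite big_seq1 /= (vac_unit F) scale1r.
have tb Y := tcat_bounded Y IH.
have tE (Y : F n) x X : tcat Y (tcons x X : F k.+1) = tcons x (tcat Y X).
  exact: (tens_rightE x X (bounded_byW (tb Y))).
have Tb (Y : F n) : bounded_by (hnorm Y) (@tcat _ _ F n Y k.+1) by exact: tens_rightM.
split=> [a X X' Y|a X Y Y'|X X' Y Y'|].
- exact: (bounded_by_lin (Tb Y)).
- suff: tens_right (@tcat _ _ F n (a *: Y + Y') k) =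
        (fun X => a *: tcat Y X + tcat Y' X) by move/(congr1 (@^~ X)).
  apply: tens_right_eq => [||x {}X]; first exact: bounded_byW (tb _).
    apply/bounded_byP; exists (complex.Re `|a| * hnorm Y + hnorm Y').
    have [l1 _ le1] := Tb Y; have [l2 _ le2] := Tb Y'.
    split=> [b Z Z'||Z].
    + rewrite l1 l2 !scalerDr !scalerA [a * b]mulrC.
      by rewrite addrACA.
    + by rewrite addr_ge0 ?mulr_ge0 ?hnorm_ge0 // -ler0c RRe_real ?normr_real.
    + apply: le_trans (hnormD _ _) _; rewrite mulrDl lerD // hnormZ -mulrA.
      by rewrite ler_wpM2l // -ler0c RRe_real ?normr_real.
  rewrite !tE (tensDr IH) (tensZr IH).
  by rewrite (tensDr (tcons_tensor F _)) (tensZr (tcons_tensor F _)).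
- suff E X1 : inner (tcat Y X1) (tcat Y' X') = inner X1 (inner Y Y' *: X').
    by rewrite E innerZr mulrC.
  apply: (tens_inner_ext (tcons_tensor F k)) => [|x {}X1]; first exact: bounded_byW (Tb _).
  suff E X2 : inner (tcat Y' X2) (tcat Y (tcons x X1 : F k.+1)) =
              inner X2 (inner Y' Y *: (tcons x X1 : F k.+1)).
    by rewrite innerC E !innerZr rmorphM /= -!innerC.
  apply: (tens_inner_ext (tcons_tensor F k)) => [|y {}X2]; first exact: bounded_byW (Tb _).
  rewrite !tE innerZr !(inner_tens (tcons_tensor F _)).
  by rewrite (inner_tens IH) mulrA mulrC.
- pose ts := tsum (fun (X : F k.+1) (Y : F n) => tcat Y X).
  pose D X := forall e : R, 0 < e -> exists s, hnorm (X - ts s) < e.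
  have DD X X' : D X -> D X' -> D (X + X').
    move=> DX DX' e e0; have e20 : 0 < e / 2 by rewrite divr_gt0.
    have [s sP] := DX _ e20; have [s' sP'] := DX' _ e20; exists (s ++ s').
    rewrite /ts /tsum big_cat /= opprD addrACA.
    by apply: le_lt_trans (hnormD _ _) _; rewrite [e]splitr ltrD.
  have D0 : D 0 by move=> e e0; exists [::]; rewrite /ts /tsum big_nil subrr hnorm0.
  have Dt x X : D (tcons x X).
    move=> e e0; have x1 : 0 < hnorm x + 1 by rewrite ltr_wpDl ?hnorm_ge0.
    have [s sP] := tsum_dense IH X (divr_gt0 e0 x1).
    exists [seq (tcons x p.1, p.2) | p <- s].
    have -> : ts [seq (tcons x p.1, p.2) | p <- s] =
        tcons x (tsum (fun (X : F k) (Y : F n) => tcat Y X) s).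
      rewrite /ts /tsum big_map.
      rewrite (big_morph _ (tensDr (tcons_tensor F _) x) (tens0r (tcons_tensor F _) x)).
      by apply: eq_bigr => p _; exact: tE.
    rewrite -scaleN1r -(tensZr (tcons_tensor F _)) -(tensDr (tcons_tensor F _)) scaleN1r.
    rewrite (hnorm_tens (tcons_tensor F _)).
    apply: (@le_lt_trans _ _ (hnorm x * (e / (hnorm x + 1)))).
      by rewrite ler_wpM2l ?hnorm_ge0 // ltW.
    have E : e = e / (hnorm x + 1) * (hnorm x + 1) by rewrite divfK ?gt_eqF.
    rewrite [ltRHS]E mulrDr mulr1 mulrC ltrDl divr_gt0 //.
  apply: dense_approxP => X e e0; have e20 : 0 < e / 2 by rewrite divr_gt0.
  have [s sP] := tsum_dense (tcons_tensor F _) X e20.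
  have Ds : D (tsum (tcons (t := F) (n := k + n)) s).
    by rewrite /tsum; elim/big_ind: _ => // p _; exact: Dt.
  have [s' sP'] := Ds _ e20; exists (ts s'); first by exists s'.
  rewrite -(subrKA (tsum (tcons (t := F) (n := k + n)) s)).
  by apply: le_lt_trans (hnormD _ _) _; rewrite [e]splitr ltrD.
Qed.

Lemma tcatb k n (Y : F n) : bounded_operator (@tcat _ _ F n Y k).
Proof. exact: bounded_byW (tcat_bounded Y (tcat_tensor k n)). Qed.

Lemma tcatE k n (Y : F n) x (X : F k) :
  tcat Y (tcons x X : F k.+1) = tcons x (tcat Y X).
Proof. exact: (tens_rightE x X (tcatb k Y)). Qed.

Lemma tens_id_spec M k (A : F k -> F k) n : bounded_by M A ->
  bounded_by M (tens_id A (n := n)) /\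
  forall X Y, tens_id A (tcat Y X : F (k + n)%N) = tcat Y (A X).
Proof.
move=> AM; have [B BM BE] := tens_mapl (tcat_tensor k n) AM.
rewrite /tens_id (@xget_unique _ _ _ B) //.
  by split=> //; exact: bounded_byW BM.
move=> C [Cb CE]; apply: (tens_ext (tcat_tensor k n)) => // [|x X].
  exact: bounded_byW BM.
by rewrite CE BE.
Qed.

Lemma tens_id_adj k (A : F k -> F k) n : bounded_operator A -> is_adjoint A A ->
  is_adjoint (tens_id A (n := n)) (tens_id A (n := n)).
Proof.
move=> /bounded_byP[M AM] Aa X Y; have [BM BE] := tens_id_spec n AM.
have T := tcat_tensor k n.
apply: (tens_inner_ext T); first exact: bounded_byW BM.
move=> x {}X; rewrite innerC [RHS]innerC; congr Num.conj.
symmetry; apply: (tens_inner_ext T); first exact: bounded_byW BM.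
by move=> y {}Y; rewrite !BE !(inner_tens T) Aa.
Qed.

Lemma tcat_tens_right k n (B : F n -> F n) (C : F (k + n)%N -> F (k + n)%N) Y :
  bounded_operator C -> (forall X : F k, C (tcat Y X) = tcat (B Y) X) ->
  forall X : F k.+1, tens_right C (tcat Y X) = tcat (B Y) X.
Proof.
move=> Cb E X; have rb := tens_rightb Cb.
suff: tens_right C \o tcat Y (k := k.+1) = tcat (B Y) (k := k.+1).
  by move/(congr1 (@^~ X)).
apply: tcons_ext => [||x {}X]; last first.
  by rewrite -[LHS]/(tens_right C (tcat Y (tcons x X : F k.+1))) !tcatE tens_rightE // E.
  exact: (tcatb k.+1 (B Y)).
exact: (bounded_operator_comp rb (tcatb k.+1 Y)).
Qed.

(** Both sides send X (x) Y, with X in F 2, to A X (x) B Y. *)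
Lemma tens_id2_right (A : F 2%N -> F 2%N) n (B : F n -> F n) :
  bounded_operator A -> bounded_operator B ->
  tens_id A (n := n) \o tens_right (tens_right B) =
  tens_right (tens_right B) \o tens_id A (n := n).
Proof.
move=> /bounded_byP[M AM] Bb; have [TM TE] := tens_id_spec n AM.
have rb := tens_rightb (tens_rightb Bb); have Tb := bounded_byW TM.
have E0 Y (Z : F 0%N) : B (tcat Y Z) = tcat (B Y) Z.
  by have [lB _] := Bb; rewrite !tcat0E (linZ lB).
have E1 Y := tcat_tens_right (k := 0) Bb (E0 Y).
have E Y := tcat_tens_right (k := 1) (tens_rightb Bb) (E1 Y).
apply: (tens_ext (tcat_tensor 2 n)) => [||X Y]; do ?exact: bounded_operator_comp.
rewrite -[LHS]/(tens_id A (tens_right (tens_right B) (tcat Y X))).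
rewrite -[RHS]/(tens_right (tens_right B) (tens_id A (tcat Y X))) TE.
by rewrite [X in tens_id A X](E Y X) TE; exact: esym (E Y (A X)).
Qed.

End TensorPowers.

(** * The length function of G(m,1,n) *)

Section Length.
Variables m n : nat.
Implicit Types u v : refl_group m n.
Local Open Scope group_scope.

Lemma rg_length_word u : exists r : seq (refl_group m n),
  [/\ all (mem (Pigen m n)) r, u = \prod_(x <- r) x & size r = rg_length u].
Proof.
rewrite /rg_length /word_length; case: ex_minnP => k /existsP[r /andP[rP /eqP uE]] _.
by exists r; split=> //; rewrite size_tuple.
Qed.

Lemma rg_length_le (r : seq (refl_group m n)) :
  all (mem (Pigen m n)) r -> (rg_length (\prod_(x <- r) x)%g <= size r)%N.
Proof.
move=> rP; rewrite /rg_length /word_length; case: ex_minnP => k _; apply.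
by apply/existsP; exists (in_tuple r); rewrite rP eqxx.
Qed.

(* Conversion would otherwise unfold the length into a search through all words. *)
#[local] Opaque rg_length.

Lemma rg_length1 : rg_length (1 : refl_group m n) = 0%N.
Proof.
by have := rg_length_le (r := [::]) isT; rewrite big_nil leqn0 => /eqP.
Qed.

Lemma rg_lengthM u v : (rg_length (u * v)%g <= rg_length u + rg_length v)%N.
Proof.
have [r [rP uE <-]] := rg_length_word u; have [r' [rP' vE <-]] := rg_length_word v.
by rewrite uE vE -big_cat -size_cat rg_length_le // all_cat rP.
Qed.

Lemma rg_length_gen x : x \in Pigen m n -> (rg_length x <= 1)%N.
Proof.
by move=> xP; have := rg_length_le (r := [:: x]); rewrite big_seq1 /= xP; apply.
Qed.

Lemma rg_lengthX u k : (rg_length (u ^+ k)%g <= rg_length u * k)%N.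
Proof.
elim: k => [|k IH]; first by rewrite expg0 rg_length1.
by rewrite expgS mulnS; apply: leq_trans (rg_lengthM _ _) _; rewrite leq_add2l.
Qed.

Definition ninv (s : 'S_n) : nat :=
  \sum_(p < n) \sum_(q < n) ((p < q) && (s q < s p)).

(** The closed formula for the length, see rg_length_size. *)
Definition rg_size u : nat := \sum_(j < n) u.1 j + ninv u.2.

Lemma ninv1 : ninv 1 = 0%N.
Proof.
rewrite /ninv big1 // => p _; rewrite big1 // => q _; rewrite !perm1.
by case: ltngtP.
Qed.

(** Exchanging the neighbouring values i - 1 and i of s changes the order of one
    pair only, namely of the positions that carry these values. *)
Lemma ninv_adj s i : (0 < i < n)%N -> (ninv (s * adj_tperm n i)%g <= (ninv s).+1)%N.
Proof.
case/andP=> i0 hi; have hi1 : (i.-1 < n)%N by lia.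
pose a := s^-1 (Ordinal hi1); pose b := s^-1 (Ordinal hi).
apply: (@leq_trans (\sum_(p < n) \sum_(q < n)
    (((p < q) && (s q < s p)) + ((p == a) && (q == b))))%N).
  apply: leq_sum => p _; apply: leq_sum => q _; rewrite !permM !adj_tperm_val //.
  have ea : (p == a) = (s p == i.-1 :> nat) by rewrite /a -(can2_eq (permK s) (permKV s)) -val_eqE.
  have eb : (q == b) = (s q == i :> nat) by rewrite /b -(can2_eq (permK s) (permKV s)) -val_eqE.
  rewrite ea eb; case: ltnP => //= _.
  move: (nat_of_ord (s p)) (nat_of_ord (s q)) => x y.
  by do 4?[case: eqP => ?]; do 2?[case: ltnP => ?]; rewrite /=; lia.
rewrite (eq_bigr (fun p : 'I_n => \sum_(q < n) ((p < q) && (s q < s p)) + (p == a))%N).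
  rewrite big_split /= -/(ninv s) -addn1 leq_add2l.
  by rewrite (bigD1 a) //= eqxx big1 // => p /negPf->.
move=> p _; rewrite big_split /=; congr addn.
rewrite (bigD1 b) //= eqxx andbT big1 ?addn0 // => q /negPf->.
by rewrite andbF.
Qed.

Lemma rg_size_gen u x : x \in Pigen m n -> (rg_size (u * x)%g <= (rg_size u).+1)%N.
Proof.
rewrite inE => /orP[] /imsetP[j _ ->].
  rewrite tgenE ?ltn_ord //= /rg_size rg_mulE /= mulg1 -addSn leq_add2r.
  pose b := u.2^-1 j.
  apply: (@leq_trans (\sum_(k < n) (u.1 k + (k == b)))%N).
    apply: leq_sum => k _; rewrite !ffunE /=.
    apply: leq_trans (leq_mod _ _) _; rewrite leq_add2l.
    apply: leq_trans (leq_mod _ _) _.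
    by rewrite /b -(can2_eq (permK _) (permKV _)).
  rewrite big_split /= -[X in (_ <= X)%N]addn1 leq_add2l.
  by rewrite (bigD1 b) //= eqxx big1 // => p /negPf->.
have hj : (0 < j.+1 < n)%N by rewrite /=; move: (ltn_ord j); lia.
rewrite /rg_size rg_mulE /= -addnS; apply: leq_add; last exact: ninv_adj.
by apply: leq_sum => k _; rewrite !ffunE addr0.
Qed.

Lemma rg_size_le u : (rg_size u <= rg_length u)%N.
Proof.
have [r [rP -> <-]] := rg_length_word u.
elim/last_ind: r rP => [|r x IH]; last first.
  rewrite all_rcons => /andP[xP rP]; rewrite -cats1 big_cat big_seq1 /= cats1 size_rcons.
  by apply: leq_trans (rg_size_gen _ xP) _; rewrite ltnS IH.
move=> _; rewrite big_nil /rg_size ninv1 addn0 big1 // => j _.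
by rewrite ffunE.
Qed.

End Length.

Section Lift.
Variables m n : nat.
Local Open Scope group_scope.

Definition cons_exp (i : 'I_m.-1.+1) (a : {ffun 'I_n -> 'I_m.-1.+1}) :
    {ffun 'I_n.+1 -> 'I_m.-1.+1} :=
  [ffun j => if unlift ord0 j is Some j' then a j' else i].

(** The element with first exponent i and 0 -> k, whose remaining entries come from
    u; every element of the larger group arises once. *)
Definition rg_cons (i : 'I_m.-1.+1) (k : 'I_n.+1) (u : refl_group m n) :
    refl_group m n.+1 := (cons_exp i u.1, lift_perm ord0 k u.2).

(** The embedding that adds a trivial first coordinate; it sends s_i to s_(i+1) and
    t_j to t_(j+1). *)
Definition rg_lift (u : refl_group m n) : refl_group m n.+1 := rg_cons ord0 ord0 u.

Lemma cons_exp0 i a : cons_exp i a ord0 = i.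
Proof. by rewrite ffunE unlift_none. Qed.
Lemma cons_expS i a j : cons_exp i a (lift ord0 j) = a j.
Proof. by rewrite ffunE liftK. Qed.

Lemma ord_cases (P : 'I_n.+1 -> Prop) : P ord0 -> (forall j, P (lift ord0 j)) ->
  forall j, P j.
Proof. by move=> P0 PS j; case: (unliftP ord0 j) => [j' ->|->]. Qed.

Lemma rg_liftM : {morph rg_lift : u v / u * v}.
Proof.
move=> u v; rewrite !rg_mulE /rg_lift /rg_cons /=; congr pair.
  apply/ffunP; apply: ord_cases => [|j].
    by rewrite [RHS]ffunE !cons_exp0 lift_perm_id cons_exp0 addr0.
  by rewrite [RHS]ffunE !cons_expS lift_perm_lift cons_expS ffunE.
by rewrite lift_permM.
Qed.

Lemma rg_lift1 : rg_lift 1 = 1.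
Proof. by apply: (mulgI (rg_lift 1)); rewrite -rg_liftM !mulg1. Qed.

Lemma rg_lift_prod (r : seq (refl_group m n)) :
  rg_lift (\prod_(x <- r) x) = \prod_(x <- r) rg_lift x.
Proof. exact: (big_morph _ rg_liftM rg_lift1). Qed.

Lemma rg_lift_sgen i : (0 < i < n)%N -> rg_lift (sgen m n i) = sgen m n.+1 i.+1.
Proof.
case: i => // i /= hi; rewrite /rg_lift /rg_cons /=; congr pair.
  by apply/ffunP; apply: ord_cases => [|j]; rewrite ?cons_exp0 ?cons_expS !ffunE.
apply/permP; apply: ord_cases => [|j]; apply: val_inj.
  by rewrite lift_perm_id /= adj_tperm_val.
rewrite lift_perm_lift /= adj_tperm_val //= adj_tperm_val //= /bump /=.
by do ?case: eqP; lia.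
Qed.

Lemma rg_lift_tgen j : (0 < j <= n)%N -> rg_lift (tgen m n j) = tgen m n.+1 j.+1.
Proof.
move=> hj; have hj1 : (j < n.+1)%N by lia.
rewrite !tgenE // /rg_lift /rg_cons /=; congr pair; last first.
  by rewrite lift_perm1.
apply/ffunP; apply: ord_cases => [|k]; rewrite ?cons_exp0 ?cons_expS !ffunE /=.
  by case: j hj {hj1} => // j _; apply: val_inj; rewrite /= mod0n.
by congr inZp; congr nat_of_bool; rewrite /bump; do 2?case: eqP; lia.
Qed.

Lemma Pigen_sgen i : (0 < i < n)%N -> sgen m n i \in Pigen m n.
Proof.
case: i => // i /= hi; rewrite inE; apply/orP; right; apply/imsetP.
have hi' : (i < n.-1)%N by lia.
by exists (Ordinal hi').
Qed.

Lemma Pigen_tgen j : (0 < j <= n)%N -> tgen m n j \in Pigen m n.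
Proof.
case: j => // j /= hj; rewrite inE; apply/orP; left; apply/imsetP.
by exists (Ordinal hj).
Qed.

Lemma PigenP x : x \in Pigen m n ->
  (exists2 j, (0 < j <= n)%N & x = tgen m n j) \/
  (exists2 i, (0 < i < n)%N & x = sgen m n i).
Proof.
rewrite inE => /orP[] /imsetP[j _ ->]; [left|right]; exists j.+1 => //=.
by move: (ltn_ord j); lia.
Qed.

End Lift.

Lemma Pigen_lift m n x : x \in Pigen m n -> rg_lift x \in Pigen m n.+1.
Proof.
case/PigenP => [[j hj ->]|[i hi ->]].
  by rewrite rg_lift_tgen // Pigen_tgen //; lia.
by rewrite rg_lift_sgen // Pigen_sgen //; lia.
Qed.

Section NormalForm.
Variables m n : nat.
Local Open Scope group_scope.

Definition rg_cycle k : refl_group m n.+1 := \prod_(j <- iota 1 k) sgen m n.+1 j.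

Lemma rg_cycleS k : rg_cycle k.+1 = rg_cycle k * sgen m n.+1 k.+1.
Proof. by rewrite /rg_cycle -[X in iota 1 X]addn1 iotaD big_cat big_seq1 /= add1n. Qed.

(** The normal form. Multiplying by s_1 ... s_k moves the value 0 to k and keeps
    the order of the other values. *)
Lemma rg_consE i (k : 'I_n.+1) u :
  rg_cons i k u = rg_lift u * tgen m n.+1 1 ^+ i * rg_cycle k.
Proof.
have E : rg_lift u * tgen m n.+1 1 ^+ i = rg_cons i ord0 u.
  rewrite tgenE // -/(rg_diag _) rg_diagX /rg_diag rg_mulE /rg_cons /= mulg1.
  congr pair; apply/ffunP; apply: ord_cases => [|j]; rewrite ffunE ?cons_exp0 ?cons_expS.
    rewrite lift_perm_id ffunMnE ffunE /= Zp_mulrn add0r; apply: val_inj.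
    by rewrite /= modnMml mul1n modn_small.
  by rewrite lift_perm_lift ffunMnE ffunE /= Zp_mulrn; apply: val_inj;
     rewrite /= ?mod0n ?mul0n ?mod0n ?addn0 ?modn_small.
rewrite E; case: k => k hk; elim: k hk => [|k IH] hk.
  by rewrite /rg_cycle big_nil mulg1; congr rg_cons; apply: val_inj.
rewrite rg_cycleS mulgA -(IH (ltnW hk)) rg_mulE /rg_cons /=; congr pair.
  by apply/ffunP => j; rewrite !ffunE addr0.
apply/permP; apply: ord_cases => [|j]; apply: val_inj; rewrite permM.
  by rewrite !lift_perm_id /= adj_tperm_val //= eqxx.
rewrite !lift_perm_lift /= adj_tperm_val //= /bump /=.
by do ?case: eqP; lia.
Qed.

Lemma rg_cons_bij :
  bijective (fun p : 'I_m.-1.+1 * 'I_n.+1 * refl_group m n => rg_cons p.1.1 p.1.2 p.2).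
Proof.
apply: inj_card_bij => [[[i k] [a s]] [[i' k'] [a' s']]|].
  rewrite /rg_cons /= => -[] /ffunP Ea Es.
  have Ei : i = i' by have := Ea ord0; rewrite !cons_exp0.
  have Ek : k = k'.
    by have /permP/(_ ord0) := Es; rewrite !lift_perm_id.
  rewrite -Ei -Ek; congr (_, (_, _)).
    by apply/ffunP => j; have := Ea (lift ord0 j); rewrite !cons_expS.
  apply/permP => j; have /permP/(_ (lift ord0 j)) := Es.
  by rewrite !lift_perm_lift Ek => /lift_inj.
rewrite !card_prod !card_ffun !card_ord !card_Sn expnS factS.
by rewrite leq_eqVlt; apply/orP; left; apply/eqP; lia.
Qed.

(** The new first position, with value k, is inverted with the k positions that
    carry smaller values. *)
Lemma rg_size_cons i k (u : refl_group m n) : rg_size (rg_cons i k u) = (rg_size u + i + k)%N.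
Proof.
rewrite /rg_size big_ord_recl /= cons_exp0.
under eq_bigr do rewrite cons_expS.
suff -> : ninv (lift_perm ord0 k u.2) = (k + ninv u.2)%N by lia.
set s := u.2; rewrite /ninv big_ord_recl; congr addn.
  rewrite big_ord_recl ltnn /= add0n.
  under eq_bigr => j _ do rewrite lift_perm_id lift_perm_lift /=.
  rewrite -(reindex_inj (h := s) (@perm_inj _ s) (P := predT)
    (F := fun x : 'I_n => nat_of_bool (bump k x < k)%N)) /=.
  rewrite (eq_bigr (fun x : 'I_n => nat_of_bool (x < k)%N)); last first.
    by move=> x _; congr nat_of_bool; rewrite /bump; lia.
  rewrite -big_mkcond /= sum1_card.
  have kn : (k <= n)%N by rewrite -ltnS.
  have inj : injective (widen_ord kn) by move=> x y /(congr1 val)/= /val_inj.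
  rewrite -[RHS](card_ord k) -(fintype.card_image inj).
  apply: eq_card => x; rewrite unfold_in.
  apply/idP/fintype.imageP => [xk|[y _ ->]]; last exact: (ltn_ord y).
  by exists (Ordinal xk) => //; apply: val_inj.
apply: eq_bigr => p _; rewrite big_ord_recl /= add0n.
apply: eq_bigr => q _; rewrite !lift_perm_lift /=.
by congr nat_of_bool; rewrite /bump; lia.
Qed.

End NormalForm.

(** * Reduced words *)

Section ReducedWords.
Local Open Scope group_scope.

(** Subadditivity of the length gives one inequality. The other one holds because
    the size is additive on the normal form and is a lower bound for the length. *)
Lemma rg_length_cons_eq m n : (forall u : refl_group m n, rg_length u = rg_size u) ->
  forall i k (u : refl_group m n), rg_length (rg_cons i k u) = (rg_length u + i + k)%N.
Proof.
move=> IH i k u; apply/eqP; rewrite eqn_leq; apply/andP; split; last first.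
  by rewrite IH -rg_size_cons rg_size_le.
have len_lift (v : refl_group m n) : (rg_length (rg_lift v) <= rg_length v)%N.
  have [r [rP -> <-]] := rg_length_word v.
  rewrite rg_lift_prod -(big_map _ predT id) -(size_map (@rg_lift m n)).
  apply: rg_length_le; rewrite all_map; apply/allP => x /(allP rP) /=.
  exact: Pigen_lift.
rewrite rg_consE; apply: leq_trans (rg_lengthM _ _) _; apply: leq_add.
  apply: leq_trans (rg_lengthM _ _) _; apply: leq_add => //.
  apply: leq_trans (rg_lengthX _ _) _; rewrite -[X in (_ <= X)%N]mul1n.
  by apply: leq_mul => //; apply: rg_length_gen; apply: Pigen_tgen.
have -> : rg_cycle m n k = \prod_(x <- [seq sgen m n.+1 j | j <- iota 1 k]) x.
  by rewrite big_map.
rewrite -[X in (_ <= X)%N](size_iota 1) -(size_map (sgen m n.+1)).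
apply: rg_length_le; apply/allP => _ /mapP[j + ->]; rewrite mem_iota => hj.
by apply: Pigen_sgen; move: hj (ltn_ord k); lia.
Qed.

Lemma rg_length_size m n (u : refl_group m n) : rg_length u = rg_size u.
Proof.
elim: n u => [|n IH] u.
  have -> : u = 1.
    by case: u => a s; congr pair; [apply/ffunP|apply/permP] => -[].
  rewrite rg_length1; symmetry; apply/eqP; rewrite -leqn0.
  exact: leq_trans (rg_size_le _) (eq_leq (rg_length1 _ _)).
have [c _ cK] := rg_cons_bij m n; rewrite -(cK u); case: (c u) => [[i k] v] /=.
by rewrite rg_length_cons_eq // rg_size_cons IH.
Qed.

Lemma rg_length_cons m n i k (u : refl_group m n) :
  rg_length (rg_cons i k u) = (rg_length u + i + k)%N.
Proof. exact: (rg_length_cons_eq (@rg_length_size m n)). Qed.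

(** Words of minimal length; quasimultiplicative maps are multiplicative on them. *)
Definition reduced m n (r : seq (refl_group m n)) : Prop :=
  all (mem (Pigen m n)) r /\ rg_length (\prod_(x <- r) x) = size r.

Lemma reduced_cons m n (x : refl_group m n) r : reduced (x :: r) ->
  [/\ x \in Pigen m n, rg_length x = 1%N & reduced r].
Proof.
case=> /= /andP[xP rP]; rewrite big_cons => E.
have h1 := rg_length_le rP; have h2 := rg_length_gen xP.
have := rg_lengthM x (\prod_(y <- r) y); rewrite E => h3.
by split=> //; [|split=> //]; lia.
Qed.

Definition cons_word m n i k (r : seq (refl_group m n)) : seq (refl_group m n.+1) :=
  [seq rg_lift x | x <- r] ++ nseq i (tgen m n.+1 1) ++
  [seq sgen m n.+1 j | j <- iota 1 k].

Lemma cons_wordE m n (i : 'I_m.-1.+1) (k : 'I_n.+1) (r : seq (refl_group m n)) :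
  \prod_(x <- cons_word i k r) x = rg_cons i k (\prod_(x <- r) x).
Proof.
rewrite /cons_word !big_cat /= rg_consE rg_lift_prod !big_map /= mulgA.
congr (_ * _ * _); elim: (nat_of_ord i) => [|j IH]; first by rewrite big_nil.
by rewrite /= big_cons IH -expgS.
Qed.

Lemma reduced_cons_word m n (i : 'I_m.-1.+1) (k : 'I_n.+1) (r : seq (refl_group m n)) :
  reduced r -> reduced (cons_word i k r).
Proof.
case=> rP rE; split; last first.
  by rewrite cons_wordE rg_length_cons rE !size_cat !size_map size_nseq size_iota addnA.
rewrite !all_cat; apply/and3P; split.
- rewrite all_map; apply/allP => x /(allP rP) /=; exact: Pigen_lift.
- by apply/allP => x /nseqP[-> _]; exact: Pigen_tgen.
- apply/allP => _ /mapP[j + ->]; rewrite mem_iota => hj.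
  by apply: Pigen_sgen; move: hj (ltn_ord k); lia.
Qed.

Lemma reduced_eq m n (r r' : seq (refl_group m n)) : reduced r ->
  all (mem (Pigen m n)) r' -> size r' = size r ->
  \prod_(x <- r') x = \prod_(x <- r) x -> reduced r'.
Proof. by case=> rP rE r'P sE pE; split=> //; rewrite pE rE sE. Qed.

Lemma reduced_nil m n : reduced (Nil (refl_group m n)).
Proof. by split=> //; rewrite big_nil rg_length1. Qed.

Lemma reduced_word m n (u : refl_group m n) : exists2 r, reduced r & u = \prod_(x <- r) x.
Proof.
have [r [rP uE rE]] := rg_length_word u; exists r; last exact: uE.
by split; [exact: rP | rewrite -uE rE].
Qed.

End ReducedWords.

Section Phi.
Variables (R : realType) (m n : nat) (K : hilbertType R).
Variable phi : group_algebra R (refl_group m n) -> K -> K.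
Hypothesis phiQ : quasimultiplicative (@rg_length m n) phi.

Definition word_op (r : seq (refl_group m n)) : K -> K :=
  foldr (fun x A => phi (gelt R x) \o A) id r.

Lemma word_op_cat r r' : word_op (r ++ r') = word_op r \o word_op r'.
Proof. by rewrite /word_op; elim: r => //= x r ->. Qed.

(** Every suffix of a reduced word is reduced, so that quasimultiplicativity can be
    applied one letter at a time. *)
Lemma phi_reduced r : reduced r -> phi (gelt R (\prod_(x <- r) x)%g) = word_op r.
Proof.
have [_ _ phi1 phiM] := phiQ.
elim: r => [_|x r IH xr]; first by rewrite big_nil.
have [xP x1 rR] := reduced_cons xr.
have [_ E] := xr; rewrite big_cons in E *; rewrite phiM /= ?IH //.
by have [_ ->] := rR; rewrite x1 E.
Qed.

Lemma phi_braid r r' : reduced r -> all (mem (Pigen m n)) r' -> size r' = size r ->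
  (\prod_(x <- r') x = \prod_(x <- r) x)%g -> word_op r = word_op r'.
Proof.
move=> rR r'P sE pE; rewrite -phi_reduced // -pE phi_reduced //.
exact: reduced_eq pE.
Qed.

End Phi.

(** * The recursion for P_n *)

Section Generators.
Variables (R : realType) (m : nat) (H : hilbertType R) (F : tensor_powers H).
Variables (S : F 2%N -> F 2%N) (T : H -> H).
Hypotheses (hm : (0 < m)%N) (Sb : bounded_operator S) (Tb : bounded_operator T).

Lemma Sop_right n i : Sop S (n := n.+1) i.+2 = tens_right (Sop S (n := n) i.+1).
Proof. by []. Qed.

Lemma Sop_left n : Sop S (n := n.+2) 1 = tens_id S (n := n).
Proof. by []. Qed.

Lemma Top_left n : Top T (n := n.+1) 1 = tens_left T (n := n) :> (F n.+1 -> F n.+1).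
Proof. by []. Qed.

Lemma Sop_bounded n i : bounded_operator (Sop S (n := n) i).
Proof.
rewrite /Sop; elim: n i.-1 => [|n IH] [|j] /=; do ?exact: bounded_operator_id.
  case: n {IH} => [|n]; first exact: bounded_operator_id.
  have [M SM] := (bounded_byP S).1 Sb.
  by have [/bounded_byW] := tens_id_spec n SM.
exact: tens_rightb.
Qed.

Lemma Top_bounded n j : bounded_operator (Top T j : F n -> F n).
Proof.
rewrite /Top; elim: n j.-1 => [|n IH] [|i] /=; do ?exact: bounded_operator_id.
  exact: tens_leftb.
exact: tens_rightb.
Qed.

Lemma Sop_bounded_by M n i : bounded_by M S -> (0 < i < n)%N ->
  bounded_by M (Sop S (n := n) i).
Proof.
move=> SM; case: i => // i /=; elim: i n => [|i IH] [|[|n]] // hn.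
  by rewrite Sop_left; case: (tens_id_spec n SM).
by rewrite Sop_right; apply: tens_rightM; apply: IH.
Qed.

Lemma Sop_adj n i : is_adjoint S S -> (0 < i < n)%N ->
  is_adjoint (Sop S (n := n) i) (Sop S (n := n) i).
Proof.
move=> Sa; case: i => // i /=; elim: i n => [|i IH] [|[|n]] // hn.
  by rewrite Sop_left; exact: (tens_id_adj (n := n) Sb Sa).
by rewrite Sop_right; apply: tens_right_adj; [exact: Sop_bounded | exact: IH].
Qed.

Definition cycle_op n k : F n -> F n := \big[comp/id]_(1 <= j < k.+1) Sop S (n := n) j.

Lemma cycle_op_foldr n k :
  cycle_op (n := n) k = foldr (fun j A => Sop S (n := n) j \o A) id (iota 1 k).
Proof. by rewrite /cycle_op unlock /index_iota subSS subn0. Qed.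

(** Theta and A_n, the two factors of R_n. *)
Definition theta_op n : F n.+1 -> F n.+1 := \sum_(i < m) iter i (Top T 1).
Definition coset_op n : F n -> F n := \sum_(k < n) cycle_op (n := n) k.

Lemma Rop_split n X : Rop m S T (X : F n.+1) = theta_op (coset_op X).
Proof.
have -> : theta_op (n := n) = (id : F n.+1 -> F n.+1) + \sum_(1 <= i < m) iter i (Top T 1).
  by rewrite /theta_op -(big_mkord predT (fun i => iter i (Top T 1))) big_ltn.
have -> : coset_op (n := n.+1) =
    (id : F n.+1 -> F n.+1) + \sum_(1 <= k < n.+1) cycle_op (n := n.+1) k.
  rewrite /coset_op -(big_mkord predT (cycle_op (n := n.+1))) big_ltn //.
  by rewrite {1}/cycle_op big_geq.
by [].
Qed.

Section PhiRelations.
Variable phi : forall n, group_algebra R (refl_group m n) -> F n -> F n.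
Hypothesis phiP : forall n, (0 < n)%N -> is_phi S T (@phi n).

(** For m = 1 the generators t_j are trivial. They have length 0, so
    that reduced words consist of the s_i only. *)
Lemma tgen_m1 n j : (m <= 1)%N -> (0 < j <= n)%N -> tgen m n j = 1%g.
Proof.
move=> m1 hj; rewrite tgenE // rg_oneE; congr pair; apply/ffunP => k; rewrite !ffunE.
have e : m.-1 = 0%N by lia.
by apply: val_inj; rewrite /= e modn1.
Qed.

(** On letters of reduced words, shifting the index corresponds to 1 (x) -. *)
Lemma phi_gen_lift n (x : refl_group m n) : x \in Pigen m n -> rg_length x = 1%N ->
  phi (gelt R (rg_lift x)) = tens_right (phi (gelt R x)).
Proof.
move=> xP x1.
have n0 : (0 < n)%N by case/PigenP: xP => -[j]; lia.
have [_ phiS phiT] := phiP n0; have [_ phiS' phiT'] := phiP (ltn0Sn n).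
case/PigenP: xP => [[j hj xE]|[i hi xE]]; rewrite xE.
  have m1 : (1 < m)%N.
    rewrite ltnNge; apply/negP => m1; move: x1.
    by rewrite xE tgen_m1 // rg_length1.
  rewrite rg_lift_tgen // phiT // phiT' //; last by lia.
  by case: j hj {xE}.
rewrite rg_lift_sgen // phiS // phiS' //; last by lia.
by case: i hi {xE}.
Qed.

Lemma phi_gen_bounded n (x : refl_group m n) : (0 < n)%N ->
  bounded_operator (phi (gelt R x)).
Proof. by move=> /phiP[[_ + _ _] _ _]; apply. Qed.

Lemma word_op_bounded n (r : seq (refl_group m n)) : reduced r ->
  bounded_operator (word_op (@phi n) r).
Proof.
elim: r => [_|x r IH /reduced_cons[xP _ rR]]; first exact: bounded_operator_id.
apply: bounded_operator_comp; last exact: IH.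
by apply: phi_gen_bounded; case/PigenP: xP => -[j]; lia.
Qed.

Lemma word_op_lift n (r : seq (refl_group m n)) : reduced r ->
  word_op (@phi n.+1) [seq rg_lift x | x <- r] = tens_right (word_op (@phi n) r).
Proof.
elim: r => [_|x r IH /reduced_cons[xP x1 rR]]; first by rewrite tens_right_id.
have n0 : (0 < n)%N by case/PigenP: xP => -[j]; lia.
rewrite [in RHS]/word_op /= tens_right_comp //.
- by rewrite -phi_gen_lift // -IH.
- exact: phi_gen_bounded.
- exact: word_op_bounded.
Qed.

Lemma word_op_cons n (i : 'I_m.-1.+1) (k : 'I_n.+1) (r : seq (refl_group m n)) :
  reduced r -> word_op (@phi n.+1) (cons_word i k r) =
    tens_right (word_op (@phi n) r) \o (iter i (Top T 1) \o cycle_op (n := n.+1) k).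
Proof.
move=> rR; rewrite /cons_word !word_op_cat word_op_lift //; congr (_ \o (_ \o _)).
  have [_ _ phiT] := phiP (ltn0Sn n).
  have [->//|i0] := posnP i.
  have m1 : (1 < m)%N by move: (ltn_ord i) i0 hm; lia.
  by elim: (nat_of_ord i) => //= j ->; rewrite phiT.
have [_ phiS _] := phiP (ltn0Sn n).
rewrite cycle_op_foldr /word_op.
have : all (fun j => (0 < j < n.+1)%N) (iota 1 k).
  by apply/allP => j; rewrite mem_iota; move: (ltn_ord k); lia.
by elim: (iota 1 k) => //= j s IH /andP[hj hs]; rewrite IH // phiS.
Qed.

Lemma Pop_bounded n : bounded_operator (Pop phi (n := n)).
Proof.
case: n => [|n]; first exact: bounded_operator_id.
by apply: bounded_operator_sum => u; exact: phi_gen_bounded.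
Qed.

(** The group is partitioned by the normal form, and phi is multiplicative on it.
    For n = 0 the only reduced word is empty, so that words give the identity even
    though phi is unconstrained there. *)
Lemma Pop_rec n (X : F n.+1) :
  Pop phi X = tens_right (Pop phi (n := n)) (Rop m S T X).
Proof.
have /choice[w wP] : forall u : refl_group m n,
    exists r, reduced r /\ u = (\prod_(x <- r) x)%g.
  by move=> u; have [r rR uE] := reduced_word u; exists r; split.
have PE : Pop phi (n := n) = \sum_(u : refl_group m n) word_op (@phi n) (w u).
  have PE n' : (0 < n')%N -> Pop phi (n := n') = \sum_(u : refl_group m n') phi (gelt R u).
    by case: n'.
  have [n0|n0] := posnP n; last first.
    rewrite PE //; apply: eq_bigr => u _; have [wR uE] := wP u.
    by have [Q _ _] := phiP n0; rewrite -(phi_reduced Q) // -uE.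
  move: w wP X; rewrite n0 => w wP X.
  have u1 u : u = 1%g :> refl_group m 0.
    by case: u => a s; congr pair; [apply/ffunP|apply/permP] => -[].
  rewrite (bigD1 1%g) //= [X in _ = _ + X]big1 ?addr0; last first.
    by move=> u; rewrite (u1 u) eqxx.
  have [[wA _] _] := wP 1%g.
  case: (w 1%g) wA => //= x r /andP[/PigenP[] [j]]; lia.
have wb u : bounded_operator (word_op (@phi n) (w u)).
  by apply: word_op_bounded; case: (wP u).
have [lP _] := tens_rightb (Pop_bounded n).
have tE Y : tens_right (Pop phi (n := n)) Y =
    \sum_(u : refl_group m n) tens_right (word_op (@phi n) (w u)) Y.
  by rewrite PE tens_right_sum // fct_sumE.
rewrite Rop_split /theta_op fct_sumE (lin_sum lP).
have [Q _ _] := phiP (ltn0Sn n).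
rewrite -[LHS]/((\sum_(u : refl_group m n.+1) phi (gelt R u)) X) fct_sumE.
rewrite (reindex _ (onW_bij _ (rg_cons_bij m n))) /=.
rewrite -(pair_bigA _ (fun p (u : refl_group m n) => phi (gelt R (rg_cons p.1 p.2 u)) X)) /=.
rewrite -(pair_bigA _ (fun i k => \sum_(u : refl_group m n) phi (gelt R (rg_cons i k u)) X)) /=.
have e : m.-1.+1 = m by rewrite prednK.
have iter_lin i : linear (iter i (Top T 1 : F n.+1 -> F n.+1)).
  have /bounded_byP[M TM] := Top_bounded n.+1 1.
  exact: (bounded_by_lin (bounded_by_iter i TM)).
transitivity (\sum_(i < m.-1.+1) tens_right (Pop phi (n := n))
    (iter i (Top T 1) (coset_op X))); last by rewrite e.
apply: eq_bigr => i _.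
rewrite /coset_op fct_sumE (lin_sum (iter_lin i)) (lin_sum lP).
apply: eq_bigr => k _; rewrite tE; apply: eq_bigr => u _.
have [wR uE] := wP u; rewrite [in LHS]uE -cons_wordE (phi_reduced Q); last first.
  exact: reduced_cons_word.
by rewrite word_op_cons.
Qed.

Lemma reduced_sgen1 n : reduced [:: sgen m n.+2 1].
Proof.
have h : (1 < n.+2)%N by [].
exact: (reduced_cons_word ord0 (Ordinal h) (@reduced_nil m n.+1)).
Qed.

Lemma sgen2K n i : (0 < i < n)%N -> (sgen m n i * sgen m n i = 1)%g.
Proof. by have [_ + _ _ _] := sgen_relations m n; apply. Qed.

(** Both sides are the images of reduced words of the same element. The word
    s_2 s_1 s_2 is in normal form, with u' = s_1, i = 0 and k = 2. *)
Lemma Sop_braid n :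
  Sop S (n := n.+3) 1 \o (Sop S 2 \o Sop S 1) = Sop S 2 \o (Sop S 1 \o Sop S 2).
Proof.
have [Q phiS _] := phiP (ltn0Sn n.+2).
have h : (2 < n.+3)%N by [].
pose s1 := sgen m n.+3 1; pose s2 := sgen m n.+3 2.
have [P1 P2] : s1 \in Pigen m n.+3 /\ s2 \in Pigen m n.+3 by rewrite !Pigen_sgen.
have rR : reduced [:: s2; s1; s2].
  rewrite /s2 -rg_lift_sgen // rg_lift_sgen // -{1}rg_lift_sgen //.
  exact: (reduced_cons_word ord0 (Ordinal h) (reduced_sgen1 n)).
have /(phi_braid Q rR) : all (mem (Pigen m n.+3)) [:: s1; s2; s1].
  by apply/and4P; split.
rewrite -[word_op _ [:: s2; s1; s2]]/(phi (gelt R s2) \o (phi (gelt R s1) \o phi (gelt R s2))).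
rewrite -[word_op _ [:: s1; s2; s1]]/(phi (gelt R s1) \o (phi (gelt R s2) \o phi (gelt R s1))).
rewrite !phiS // => ->//.
have [_ _ _ br _] := sgen_relations m n.+3.
by rewrite !big_cons !big_nil !mulg1 !mulgA br.
Qed.

(** Here t_2 s_1 and t_1 s_1 are in normal form, and t_2 = s_1 t_1 s_1. *)
Lemma Sop_Top n : (1 < m)%N ->
  Sop S (n := n.+2) 1 \o Top T 1 = Top T 2 \o Sop S 1 /\
  Sop S (n := n.+2) 1 \o Top T 2 = Top T 1 \o Sop S 1.
Proof.
move=> m1; have [Q phiS phiT] := phiP (ltn0Sn n.+1).
have h : (1 < n.+2)%N by [].
have h1 : (1 < m.-1.+1)%N by lia.
pose s1 := sgen m n.+2 1; pose t1 := tgen m n.+2 1; pose t2 := tgen m n.+2 2.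
have phiS1 : phi (gelt R s1) = Sop S 1 by exact: phiS.
have [phiT1 phiT2] : phi (gelt R t1) = Top T 1 /\ phi (gelt R t2) = Top T 2.
  by split; exact: phiT.
have E : t2 = (s1 * t1 * s1)%g by [].
have ss : (s1 * s1 = 1)%g by exact: sgen2K.
have [S1 [T1 T2]] : s1 \in Pigen m n.+2 /\ (t1 \in Pigen m n.+2 /\ t2 \in Pigen m n.+2).
  by rewrite Pigen_sgen // !Pigen_tgen.
have word2 x y : word_op (@phi n.+2) [:: x; y] = phi (gelt R x) \o phi (gelt R y) by [].
split.
  have rT : reduced [:: tgen m n.+1 1].
    exact: (reduced_cons_word (Ordinal h1) ord0 (@reduced_nil m n)).
  have rR : reduced [:: t2; s1].
    rewrite /t2 -rg_lift_tgen //.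
    exact: (reduced_cons_word ord0 (Ordinal h) rT).
  have /(phi_braid Q rR) : all (mem (Pigen m n.+2)) [:: s1; t1] by apply/and3P; split.
  rewrite !word2 phiS1 phiT1 phiT2 => ->//.
  by rewrite !big_cons !big_nil !mulg1 E -!mulgA ss mulg1.
have rR : reduced [:: t1; s1].
  exact: (reduced_cons_word (Ordinal h1) (Ordinal h) (@reduced_nil m n.+1)).
have /(phi_braid Q rR) : all (mem (Pigen m n.+2)) [:: s1; t2] by apply/and3P; split.
rewrite !word2 phiS1 phiT1 phiT2 => ->//.
by rewrite !big_cons !big_nil !mulg1 E !mulgA ss mul1g.
Qed.

End PhiRelations.
End Generators.

(** * Lower bounds, paths of operators and a norm comparison *)

Section BoundedMore.
Variable R : realType.
Implicit Types H K L : hilbertType R.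

Lemma adj_rinner H (A : H -> H) : is_adjoint A A ->
  forall x y, rinner (A x) y = rinner x (A y).
Proof. by move=> Aa x y; rewrite /rinner Aa. Qed.

End BoundedMore.

Section Homotopy.
Variables (R : realType).
Implicit Types (H K L : hilbertType R).

(** For a nonnegative symmetric A, evaluating its quadratic form at x - A x / M
    gives |A x|^2 <= M <x, A x>. *)
Lemma pos_lower H (A : H -> H) (M d : R) :
  bounded_by M A -> is_adjoint A A -> 0 < M -> 0 <= d ->
  (forall x, 0 <= rinner x (A x)) -> (forall x, d * hnorm x <= hnorm (A x)) ->
  forall x, d ^+ 2 / M * hnorm x ^+ 2 <= rinner x (A x).
Proof.
move=> [lA _ leM] /adj_rinner Aa M0 d0 pos low x.
have := pos (x + (- M^-1)%:C *: A x).
rewrite (linD lA) (linZ lA) !rinnerE -(Aa x (A x)) (rinnerxx (A x)).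
have h1 : rinner (A x) (A (A x)) <= M * hnorm (A x) ^+ 2.
  apply: le_trans (ler_norm _) _; apply: le_trans (rinner_le _ _) _.
  rewrite expr2 mulrCA; apply: ler_wpM2l; [exact: hnorm_ge0 | exact: leM].
have h2 : d ^+ 2 * hnorm x ^+ 2 <= hnorm (A x) ^+ 2.
  by rewrite -exprMn ler_pXn2r // nnegrE ?mulr_ge0 ?hnorm_ge0.
have Mi : 0 < M^-1 by rewrite invr_gt0.
have MM : M * M^-1 = 1 by rewrite mulfV ?gt_eqF.
set a := rinner x (A x); set b := rinner (A x) (A (A x)) in h1 *.
set c := hnorm (A x) ^+ 2 in h1 h2 *; set e := hnorm x ^+ 2 in h2 *.
move: Mi MM; set i := M^-1 => i0 Mi.
have h3 : i * (i * b) <= i * c.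
  rewrite ler_pM2l //; apply: le_trans (ler_wpM2l (ltW i0) h1) _.
  by rewrite mulrA [i * M]mulrC Mi mul1r.
have h4 : i * (d ^+ 2 * e) <= i * c by rewrite ler_pM2l.
rewrite mulrAC [_ * i]mulrC.
lra.
Qed.

Definition lipschitz_family H K (f : R -> H -> K) : Prop :=
  exists2 M, forall t, 0 <= t <= 1 -> bounded_by M (f t) &
  exists2 L, 0 <= L & forall t u, 0 <= t <= 1 -> 0 <= u <= 1 ->
    bounded_by (L * `|t - u|) (f t - f u).

(** If the form of f t is nonnegative then it is at least c = d^2 / M1 by pos_lower.
    A step of length at most c / L keeps it nonnegative. *)
Lemma homotopy_pos H (f : R -> H -> H) (d : R) :
  lipschitz_family f -> 0 < d ->
  (forall t, 0 <= t <= 1 -> is_adjoint (f t) (f t)) ->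
  (forall t x, 0 <= t <= 1 -> d * hnorm x <= hnorm (f t x)) ->
  (forall x, 0 <= rinner x (f 0 x)) ->
  exists2 c, 0 < c & forall x, c * hnorm x ^+ 2 <= rinner x (f 1 x).
Proof.
move=> [M fM [L L0 fL]] d0 fa low f0.
have M0 : 0 <= M by have [|_] := fM 0; rewrite ?lexx ?ler01.
pose M1 := M + 1; have M10 : 0 < M1 by rewrite ltr_wpDl.
pose c := d ^+ 2 / M1; have c0 : 0 < c by rewrite divr_gt0 // exprn_gt0.
have step t : 0 <= t <= 1 -> (forall x, 0 <= rinner x (f t x)) ->
    forall x, c * hnorm x ^+ 2 <= rinner x (f t x).
  move=> t01 pos; apply: pos_lower => //; [|exact: fa|exact: ltW|by move=> x; exact: low].
  by apply: bounded_by_le (fM _ t01); rewrite lerDl.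
have [N NP] : exists N : nat, L <= c * N.+1%:R.
  have [N] := ltr_add_invr (divr_gt0 c0 (ltr_wpDl L0 ltr01)).
  rewrite add0r => lt; exists N.
  have N1 : 0 < N.+1%:R :> R by rewrite ltr0n.
  rewrite ltr_pdivlMr in lt; last by rewrite ltr_wpDl.
  rewrite mulrC ltr_pdivrMr // in lt.
  by apply: le_trans (ltW lt); rewrite lerDl.
have N1 : 0 < N.+1%:R :> R by rewrite ltr0n.
pose tk k : R := k%:R / N.+1%:R.
(* The path is traversed at the points k / (N + 1). *)
have tk01 k : (k <= N.+1)%N -> 0 <= tk k <= 1.
  by move=> kN; rewrite divr_ge0 ?ler0n //= ler_pdivrMr // mul1r ler_nat.
exists c => // x; have <- : tk N.+1 = 1 by rewrite /tk divff ?gt_eqF.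
have : (N.+1 <= N.+1)%N by [].
elim: {-2}N.+1 x => [|k IH] x kN.
  by have := step 0; rewrite /tk mul0r; apply; rewrite ?lexx ?ler01.
apply: step => [|{}x]; first exact: tk01.
have kN' := ltnW kN; have h := IH x kN'.
have [_ _ /(_ x)] := fL (tk k.+1) (tk k) (tk01 _ kN) (tk01 _ kN').
have -> : tk k.+1 - tk k = N.+1%:R^-1 by rewrite /tk -mulrBl -natrB // subSnn mul1r.
have -> : `|N.+1%:R^-1| = N.+1%:R^-1 :> R by rewrite ger0_norm // invr_ge0 ler0n.
move=> hd.
have hd' : hnorm ((f (tk k.+1) - f (tk k)) x) <= c * hnorm x.
  by apply: le_trans hd _; rewrite ler_wpM2r ?hnorm_ge0 // ler_pdivrMr.
have : - (c * hnorm x ^+ 2) <= rinner x ((f (tk k.+1) - f (tk k)) x).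
  rewrite lerNl; apply: le_trans (ler_norm _) _; rewrite normrN.
  apply: le_trans (rinner_le _ _) _; rewrite expr2 mulrCA.
  by rewrite ler_wpM2l ?hnorm_ge0.
rewrite -[(_ - _) x]/(f (tk k.+1) x - f (tk k) x) !rinnerE; lra.
Qed.

Lemma lipschitz_const H K (A : H -> K) : bounded_operator A ->
  lipschitz_family (fun=> A).
Proof.
move=> /bounded_byP[M AM]; exists M => //; exists 0 => // t u _ _.
by rewrite subrr mul0r; exact: bounded_by0.
Qed.

Lemma lipschitz_comp H K L (f : R -> K -> L) (g : R -> H -> K) :
  lipschitz_family f -> lipschitz_family g -> lipschitz_family (fun t => f t \o g t).
Proof.
move=> [M fM [l l0 fl]] [N gN [l' l0' gl]]; exists (M * N) => [t t01|].
  by apply: bounded_by_comp; [exact: fM | exact: gN].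
have [M0 N0] : 0 <= M /\ 0 <= N.
  by split; [case: (fM 0)|case: (gN 0)]; rewrite ?lexx ?ler01.
exists (M * l' + l * N) => [|t u t01 u01]; first by rewrite addr_ge0 ?mulr_ge0.
have -> : (f t \o g t) - (f u \o g u) = (f t \o (g t - g u)) + ((f t - f u) \o g u).
  apply/funext => x; have [lf _ _] := fM t t01.
  rewrite -[LHS]/(f t (g t x) - f u (g u x)).
  rewrite -[RHS]/(f t (g t x - g u x) + (f t (g u x) - f u (g u x))).
  by rewrite (linB lf) subrKA.
rewrite (_ : _ * `|t - u| = M * (l' * `|t - u|) + (l * `|t - u|) * N); last by ring.
apply: bounded_byD.
  by apply: bounded_by_comp; [exact: fM | exact: gl].
by apply: bounded_by_comp; [exact: fl | exact: gN].
Qed.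

Lemma lipschitzD H K (f g : R -> H -> K) :
  lipschitz_family f -> lipschitz_family g -> lipschitz_family (fun t => f t + g t).
Proof.
move=> [M fM [l l0 fl]] [N gN [l' l0' gl]]; exists (M + N) => [t t01|].
  by apply: bounded_byD; [exact: fM | exact: gN].
exists (l + l') => [|t u t01 u01]; first exact: addr_ge0.
by rewrite opprD addrACA mulrDl; apply: bounded_byD; [exact: fl | exact: gl].
Qed.

Lemma lipschitz_sum H K n (f : nat -> R -> H -> K) :
  (forall i, (i < n)%N -> lipschitz_family (f i)) ->
  lipschitz_family (fun t => \sum_(i < n) f i t).
Proof.
elim: n => [_|n IH lf].
  rewrite (_ : (fun t => _) = fun=> 0); last by apply/funext => t; rewrite big_ord0.
  by apply: lipschitz_const; exact: bounded_byW (@bounded_by0 _ _ _).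
rewrite (_ : (fun t => _) = fun t => \sum_(i < n) f i t + f n t); last first.
  by apply/funext => t; rewrite big_ord_recr.
by apply: lipschitzD; [apply: IH => i /ltnW/lf | exact: lf].
Qed.

Lemma lipschitz_scale H K (a : R -> R) (A : H -> K) :
  (forall t, 0 <= t <= 1 -> `|a t| <= 1) ->
  (forall t u, `|a t - a u| = `|t - u|) ->
  bounded_operator A -> lipschitz_family (fun t => (a t)%:C \*: A).
Proof.
move=> a1 aL /bounded_byP[M AM]; have [_ M0 _] := AM; exists M => [t t01|].
  by apply: bounded_by_le (bounded_byZ (a t) AM); rewrite ler_piMl // a1.
exists M => // t u _ _; rewrite mulrC -(aL t u).
have -> : (a t)%:C \*: A - (a u)%:C \*: A = (a t - a u)%:C \*: A.
  by apply/funext => x; rewrite /= rmorphB /= scalerBl.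
exact: bounded_byZ.
Qed.

Lemma lipschitz_tens_right (H0 : hilbertType R) (F : tensor_powers H0) k n
    (f : R -> F k -> F n) :
  lipschitz_family f -> lipschitz_family (fun t => tens_right (f t)).
Proof.
move=> [M fM [l l0 fl]]; exists M => [t t01|]; first exact/tens_rightM/fM.
exists l => // t u t01 u01.
have fb v : 0 <= v <= 1 -> bounded_operator (f v) by move=> v01; exact: bounded_byW (fM v v01).
have Db : bounded_operator (f t - f u) := bounded_byW (fl t u t01 u01).
have -> : tens_right (f t) - tens_right (f u) = tens_right (f t - f u).
  apply/eqP; rewrite subr_eq -tens_rightD ?subrK //; exact: fb.
exact/tens_rightM/fl.
Qed.

End Homotopy.

Section ThetaLower.
Variables (R : realType) (K : hilbertType R) (T : K -> K) (q : R) (m : nat).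
Hypotheses (TM : bounded_by q T) (q1 : q < 1) (hm : (0 < m)%N).

(** (1 - T) ((1 - t) + t Theta) = 1 - ((1 - t) T + t T^m), and the subtracted operator
    has norm at most q. *)
Lemma theta_lower (t : R) X : 0 <= t <= 1 ->
  (1 - q) / 2 * hnorm X <=
    hnorm ((1 - t)%:C *: X + t%:C *: \sum_(i < m) iter i T X).
Proof.
move=> /andP[t0 t1]; set Y := _%:C *: X + _.
have [lT q0 leT] := TM; have [lm _ leTm] := bounded_by_iter m TM.
have E : Y - T Y = X - ((1 - t)%:C *: T X + t%:C *: iter m T X).
  (* The geometric sum telescopes. *)
  have tel : \sum_(i < m) iter i T X - T (\sum_(i < m) iter i T X) = X - iter m T X.
    rewrite (lin_sum lT) -sumrB -opprB -[X in - X](telescope_sumr (fun i => iter i T X) (leq0n m)).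
    by rewrite big_mkord -sumrN; apply: eq_bigr => i _; rewrite opprB.
  rewrite /Y (linD lT) !(linZ lT) opprD addrACA -!scalerBr tel.
  rewrite !scalerBr addrACA -scalerDl -rmorphD /= subrK rmorph1 scale1r.
  by rewrite opprD.
have h1 : hnorm (Y - T Y) <= 2 * hnorm Y.
  apply: le_trans (hnormB _ _) _; rewrite mulr2n mulrDl mul1r lerD2l.
  by apply: le_trans (leT _) _; rewrite ler_piMl ?hnorm_ge0 // ltW.
have h2 : hnorm ((1 - t)%:C *: T X + t%:C *: iter m T X) <= q * hnorm X.
  apply: le_trans (hnormD _ _) _; rewrite !hnormZr !ger0_norm ?subr_ge0 //.
  have qm : q ^+ m <= q by rewrite -[X in _ <= X]expr1 ler_wiXn2l // ltW.
  have a1 := leT X; have a2 : hnorm (iter m T X) <= q * hnorm X.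
    by apply: le_trans (leTm X) _; rewrite ler_wpM2r ?hnorm_ge0.
  have t1' : 0 <= 1 - t by rewrite subr_ge0.
  have := ler_wpM2l t0 a2; have := ler_wpM2l t1' a1; lra.
have := hnormBB X ((1 - t)%:C *: T X + t%:C *: iter m T X); rewrite -E => h3.
lra.
Qed.

End ThetaLower.

Section BraidSum.
Variables (R : realType) (K : hilbertType R) (s : nat -> K -> K) (n : nat) (q : R).
Hypothesis sq : forall i, (0 < i < n)%N -> bounded_by q (s i).
Hypotheses (q0 : 0 <= q) (q1 : q < 1).
Hypothesis braid : forall i X, (0 < i)%N -> (i.+1 < n)%N ->
  s i (s i.+1 (s i X)) = s i.+1 (s i (s i.+1 X)).
Hypothesis comm : forall i j X, (0 < i)%N -> (i.+1 < j)%N -> (j < n)%N ->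
  s i (s j X) = s j (s i X).

Fixpoint descent k (X : K) : K := if k is k'.+1 then s k (descent k' X) else X.

Lemma descent_far k i X : (k.+1 < i)%N -> (i < n)%N -> s i (descent k X) = descent k (s i X).
Proof.
by elim: k => //= k IH ki hi; rewrite -comm // IH // ltnW.
Qed.

Lemma descent_shift k i X : (0 < i < k)%N -> (k < n)%N ->
  s i (descent k X) = descent k (s i.+1 X).
Proof.
elim: k => [|k IH]; first by lia.
move=> /andP[i0]; rewrite ltnS leq_eqVlt => /orP[/eqP <-|ik] hk; last first.
  by rewrite /= comm ?IH //; lia.
case: i {IH} i0 hk => // i _ hk /=.
by rewrite braid // descent_far.
Qed.

(** D_j D_k S_1 = D_k D_(j+1) for D_k = s_k ... s_1: moving a letter through D_k raises
    its index by one. *)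
Lemma descentM j k X : (j < k)%N -> (k < n)%N ->
  descent j (descent k (s 1%N X)) = descent k (descent j.+1 X).
Proof.
elim: j => // j IH jk hk; rewrite [LHS]/= IH ?(ltnW jk) //.
by rewrite descent_shift.
Qed.

Lemma descent_bounded k : (k < n)%N -> bounded_by (q ^+ k) (descent k).
Proof.
elim: k => [_|k IH hk]; first exact: bounded_by_id.
rewrite exprS; apply: (bounded_by_comp (A := s k.+1) (B := descent k)).
  exact: sq.
exact/IH/ltnW.
Qed.

(** The identity (1 - D_k) (1 + D_1 + ... + D_k) =
    (1 + D_1 + ... + D_(k-1)) (1 - D_k s_1) reduces the length of the sum by one, at the
    price of a factor (1 - q) / 2. *)
Lemma descent_sum_lower k X : (0 < k <= n)%N ->
  ((1 - q) / 2) ^+ k.-1 * hnorm X <= hnorm (\sum_(j < k) descent j X).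
Proof.
case: k => // k /=; elim: k X => [|k IH] X hk.
  by rewrite big_ord1 expr0 mul1r.
pose Ad k X := \sum_(j < k) descent j X.
have [ld _ leD] := descent_bounded hk.
have [ls _ leS] := sq (i := 1%N) (leq_trans (isT : (1 < k.+2)%N) hk).
have Ad_lin l Y Z : (l <= n)%N -> Ad l (Y - Z) = Ad l Y - Ad l Z.
  move=> ln; rewrite /Ad -sumrB; apply: eq_bigr => j _.
  have [lj _ _] := descent_bounded (leq_trans (ltn_ord j) ln).
  exact: linB lj _ _.
have E : Ad k.+2 X - descent k.+1 (Ad k.+2 X) =
    Ad k.+1 (X - descent k.+1 (s 1%N X)).
  have recl : Ad k.+2 X = X + \sum_(j < k.+1) descent j.+1 X by rewrite /Ad big_ord_recl.
  have recr : Ad k.+2 X = Ad k.+1 X + descent k.+1 X by rewrite /Ad big_ord_recr.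
  rewrite Ad_lin ?(ltnW hk) //.
  have -> : Ad k.+1 (descent k.+1 (s 1%N X)) = descent k.+1 (Ad k.+2 X - X).
    rewrite recl [X + _]addrC addrK (lin_sum ld).
    by apply: eq_bigr => j _; rewrite descentM.
  by rewrite (linB ld) opprB {1}recr addrA.
have qk : q ^+ k.+1 <= 1 by rewrite exprn_ile1 // ltW.
have h1 : hnorm (Ad k.+2 X - descent k.+1 (Ad k.+2 X)) <= 2 * hnorm (Ad k.+2 X).
  apply: le_trans (hnormB _ _) _; rewrite mulr2n mulrDl mul1r lerD2l.
  by apply: le_trans (leD _) _; rewrite ler_piMl ?hnorm_ge0.
have h2 : (1 - q) * hnorm X <= hnorm (X - descent k.+1 (s 1%N X)).
  apply: le_trans (hnormBB _ _); rewrite mulrBl mul1r lerD2l lerN2.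
  apply: le_trans (leD _) _; apply: le_trans (leS X).
  by rewrite ler_piMl ?hnorm_ge0.
have := IH (X - descent k.+1 (s 1%N X)) (ltnW hk).
rewrite -/(Ad k.+1 _) -E => h3.
have c0 : 0 <= ((1 - q) / 2) ^+ k by rewrite exprn_ge0 // divr_ge0 // subr_ge0 ltW.
have h4 := ler_wpM2l c0 h2.
rewrite exprSr -mulrA -/(Ad k.+2 X).
move: h1 h3 h4; set c := _ ^+ k; lra.
Qed.

End BraidSum.

Section KreinBound.
Variables (R : realType) (K : hilbertType R) (Q A : K -> K) (M c : R).
Hypotheses (QM : bounded_by M Q) (Ac : bounded_by c A).
Hypotheses (Qa : is_adjoint Q Q) (QAa : is_adjoint (Q \o A) (Q \o A)).
Hypothesis Qpos : forall x, 0 <= rinner x (Q x).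

(** Let N k be the squared Q-norm of A^k x. Cauchy-Schwarz makes N logarithmically
    convex, so that it grows at least geometrically with ratio N 1 / N 0, while
    it grows at most like c^(2k). Hence N 1 <= c^2 N 0. *)
Lemma krein_bound x : rinner x (Q (A x)) <= c * rinner x (Q x).
Proof.
have [lQ M0 leM] := QM; have [_ c0 _] := Ac.
pose B u v := rinner u (Q v).
have BC u v : B u v = B v u by rewrite /B rinnerC (adj_rinner Qa).
have BA u v : B u (A v) = B (A u) v.
  rewrite (BC (A u)) /B -[LHS]/(rinner u ((Q \o A) v)) -(adj_rinner QAa).
  by rewrite rinnerC.
have Bcs u v : B u v ^+ 2 <= B u u * B v v.
  have h (t : R) : 0 <= B u u + t * B u v *+ 2 + t ^+ 2 * B v v.
    have := Qpos (u + t%:C *: v); rewrite (linD lQ) (linZ lQ) !rinnerE.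
    rewrite -!/(B _ _) (BC v u); lra.
  have vv : 0 <= B v v by exact: Qpos.
  have [v0|v0] := eqVneq (B v v) 0.
    rewrite v0 mulr0; have uu : 0 <= B u u by exact: Qpos.
    have [->|uv] := eqVneq (B u v) 0; first by rewrite expr0n.
    (* At this t the affine function of t takes the value -1. *)
    have := h (- (B u u + 1) / B u v / 2); rewrite v0 mulr0 addr0 -mulrnAr.
    by rewrite -[B u v *+ 2]mulr_natr mulrA mulrAC divfK ?divfK //; lra.
  have v1 : 0 < B v v by rewrite lt_neqAle eq_sym v0.
  have := h (- B u v / B v v).
  have -> : B u u + - B u v / B v v * B u v *+ 2 + (- B u v / B v v) ^+ 2 * B v v =
    (B u u * B v v - B u v ^+ 2) / B v v by field.
  by rewrite pmulr_lge0 ?invr_gt0 // subr_ge0.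
pose N k := B (iter k A x) (iter k A x).
have N0 k : 0 <= N k by exact: Qpos.
have Nlog k : N k.+1 ^+ 2 <= N k * N k.+2.
  have E : N k.+1 = B (iter k A x) (iter k.+2 A x) by rewrite /N [in RHS]iterS BA.
  by rewrite [X in X ^+ 2]E; exact: Bcs.
have Nle k : N k <= M * hnorm x ^+ 2 * (c ^+ 2) ^+ k.
  have [_ _ leA] := bounded_by_iter k Ac.
  apply: le_trans (ler_norm _) _; apply: le_trans (rinner_le _ _) _.
  have := ler_pM (hnorm_ge0 _) (hnorm_ge0 _) (leA x) (leA x) => h1.
  apply: le_trans (_ : _ <= hnorm (iter k A x) * (M * hnorm (iter k A x))) _.
    by rewrite ler_wpM2l ?hnorm_ge0.
  rewrite mulrCA; apply: le_trans (ler_wpM2l M0 h1) _.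
  by rewrite le_eqVlt exprAC; apply/orP; left; apply/eqP; ring.
suff le1 : N 1%N <= c ^+ 2 * N 0%N.
  have n0 : 0 <= c * B x x by rewrite mulr_ge0 ?Qpos.
  have : `|B x (A x)| <= `|c * B x x|.
    rewrite -ler_sqr ?nnegrE ?normr_ge0 // !real_normK ?num_real //.
    apply: le_trans (Bcs _ _) _; rewrite exprMn [B x x ^+ 2]expr2.
    by rewrite mulrCA ler_wpM2l ?Qpos.
  by rewrite (ger0_norm n0); apply: le_trans; exact: ler_norm.
rewrite leNgt; apply/negP => lt.
have N0p : 0 < N 0%N.
  rewrite lt_neqAle N0 andbT eq_sym; apply/negP => /eqP z.
  have := Nlog 0%N; rewrite z mul0r => h.
  by move: lt; rewrite z mulr0 ltNge; have : N 1%N ^+ 2 = 0 by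
    [apply/le_anti; rewrite h sqr_ge0 |]; move/eqP; rewrite sqrf_eq0 => /eqP ->; rewrite lexx.
pose rho := N 1%N / N 0%N.
have rc : c ^+ 2 < rho by rewrite ltr_pdivlMr.
have r0 : 0 < rho by apply: le_lt_trans rc; rewrite sqr_ge0.
have Nr k : 0 < N k /\ rho * N k <= N k.+1.
  elim: k => [|k [IH1 IH2]]; first by rewrite /rho divfK ?gt_eqF.
  have p : 0 < N k.+1 by apply: lt_le_trans IH2; rewrite mulr_gt0.
  split=> //; rewrite -(ler_pM2l IH1); apply: le_trans (Nlog k).
  by rewrite mulrCA mulrA expr2 ler_pM2r.
have Nge k : rho ^+ k * N 0%N <= N k.
  elim: k => [|k IH]; first by rewrite expr0 mul1r.
  by apply: le_trans (Nr k).2; rewrite exprS -mulrA ler_pM2l.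
pose r := c ^+ 2 / rho.
have r1 : `|r| < 1.
  by rewrite ger0_norm ?ltr_pdivrMr ?mul1r // divr_ge0 ?sqr_ge0 // ltW.
have key k : N 0%N <= M * hnorm x ^+ 2 * r ^+ k.
  rewrite /r expr_div_n mulrA ler_pdivlMr ?exprn_gt0 // mulrC.
  exact: le_trans (Nge k) (Nle k).
have M10 : 0 < M * hnorm x ^+ 2 + 1 by rewrite ltr_wpDl // mulr_ge0 ?sqr_ge0.
have e0 : 0 < N 0%N / (M * hnorm x ^+ 2 + 1) by rewrite divr_gt0.
have /cvgrPdist_lt/(_ _ e0)[k _ /(_ k (leqnn k)) /=] := cvg_expr r1.
rewrite sub0r normrN ltr_pdivlMr // => ltk.
have C0 : 0 <= M * hnorm x ^+ 2 by rewrite mulr_ge0 ?sqr_ge0.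
have := ler_wpM2l C0 (ler_norm (r ^+ k)); have := key k.
by move: ltk (normr_ge0 (r ^+ k)); set y := `|_|; rewrite mulrDr mulr1 [y * _]mulrC; lra.
Qed.

End KreinBound.

(** * Positivity of P_n and the bound on P_n *)

Section Ascent.
Variables (R : realType) (K : hilbertType R) (s : nat -> K -> K) (n : nat).
Hypothesis sa : forall i, (0 < i < n)%N -> is_adjoint (s i) (s i).

Fixpoint ascent k : K -> K := if k is k'.+1 then ascent k' \o s k else id.

Lemma descent_adj k X Y : (k < n)%N -> inner (descent s k X) Y = inner X (ascent k Y).
Proof.
elim: k Y => //= k IH Y hk; rewrite (sa (i := k.+1)) ?hk // IH //.
exact: ltnW.
Qed.

End Ascent.

Lemma geometric_le (R : realFieldType) (q : R) n : 0 <= q -> q < 1 ->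
  \sum_(i < n) q ^+ i <= (1 - q)^-1.
Proof.
move=> q0 q1; have q1' : 0 < 1 - q by rewrite subr_gt0.
rewrite -[leRHS]mul1r ler_pdivlMr // mulrC -opprB mulNr -subrX1 opprB.
by rewrite gerBl exprn_ge0.
Qed.

Section Positivity.
Variables (R : realType) (m : nat) (H : hilbertType R) (F : tensor_powers H).
Variables (S : F 2%N -> F 2%N) (T : H -> H) (s q : R).
Hypotheses (hm : (0 < m)%N) (Ss : bounded_by s S) (Tq : bounded_by q T).
Hypotheses (s1 : s < 1) (q1 : q < 1) (Sa : is_adjoint S S).
Let theta : H -> H := \sum_(i < m) iter i T.
Hypothesis theta_adj : is_adjoint theta theta.
Variable phi : forall n, group_algebra R (refl_group m n) -> F n -> F n.
Hypothesis phiP : forall n, (0 < n)%N -> is_phi S T (@phi n).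

Let Sb : bounded_operator S := bounded_byW Ss.
Let Tb : bounded_operator T := bounded_byW Tq.
Let s0 : 0 <= s. Proof. by case: Ss. Qed.
Let q0 : 0 <= q. Proof. by case: Tq. Qed.

Notation Sop n i := (@Sop R H F S n i).
Notation tr := tens_right.

Lemma thetab : bounded_operator theta.
Proof. by apply: bounded_operator_sum => i; exact: bounded_byW (bounded_by_iter i Tq). Qed.

Lemma theta_opE n : theta_op m T (n := n) = tens_left theta (n := n) :> (F n.+1 -> F n.+1).
Proof.
have TM := @tens_leftM _ _ F _ _ n Tq.
apply: tcons_ext => [||x X]; last 1 first.
- rewrite tens_leftE; last exact: thetab.
  rewrite /theta_op /theta !fct_sumE.
  have T0 := tens0l (tcons_tensor F n) X.
  rewrite (big_morph (fun x => tcons x X) (fun x y => tensDl (tcons_tensor F n) x y X) T0).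
  apply: eq_bigr => i _; elim: (nat_of_ord i) => //= j ->.
  by rewrite Top_left tens_leftE.
- apply: bounded_operator_sum => i; exact: bounded_byW (bounded_by_iter i TM).
- exact: tens_leftb thetab.
Qed.

Lemma tens_right_iter n i (A : F n -> F n) : bounded_operator A ->
  tr (iter i A) = iter i (tr A).
Proof.
move=> /bounded_byP[M AM]; elim: i => [|i IH]; first exact: tens_right_id.
rewrite -[LHS]/(tr (A \o iter i A)) tens_right_comp ?IH //; first exact: bounded_byW AM.
exact: bounded_byW (bounded_by_iter i AM).
Qed.

Lemma theta_op_bounded n : bounded_operator (theta_op m T (n := n) : F n.+1 -> F n.+1).
Proof. rewrite theta_opE; exact: tens_leftb thetab. Qed.

(** For m = 1 Theta is the identity; otherwise S_1 exchanges T_1 and T_2. *)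
Lemma Sop_theta n (X : F n.+2) :
  Sop n.+2 1 (theta_op m T X) = tr (theta_op m T (n := n)) (Sop n.+2 1 X) /\
  Sop n.+2 1 (tr (theta_op m T (n := n)) X) = theta_op m T (Sop n.+2 1 X).
Proof.
have TM := @tens_leftM _ _ F _ _ n Tq.
have [lS _] := Sop_bounded Sb n.+2 1.
have E : tr (theta_op m T (n := n)) = \sum_(i < m) iter i (Top T 2 : F n.+2 -> F n.+2).
  rewrite /theta_op tens_right_sum; last first.
    move=> i; exact: bounded_byW (bounded_by_iter i TM).
  by apply: eq_bigr => i _; rewrite tens_right_iter //; exact: bounded_byW TM.
rewrite E /theta_op !fct_sumE !(lin_sum lS).
have [m1|m1] := leqP m 1.
  have e : m = 1%N by lia.
  by rewrite e !big_ord1.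
have [/funeqP e1 /funeqP e2] := Sop_Top hm phiP n m1.
split; apply: eq_bigr => i _; elim: (nat_of_ord i) => //= j IH.
  by rewrite -[LHS]/((Sop n.+2 1 \o Top T 1) _) e1 /= IH.
by rewrite -[LHS]/((Sop n.+2 1 \o Top T 2) _) e2 /= IH.
Qed.

Lemma Sop_braid_gen n i X : (0 < i)%N -> (i.+1 < n)%N ->
  Sop n i (Sop n i.+1 (Sop n i X)) = Sop n i.+1 (Sop n i (Sop n i.+1 X)).
Proof.
case: i => // i _; elim: i n X => [|i IH] [|[|[|n]]] // X hn.
  have /funeqP := Sop_braid phiP n; exact.
(* For i > 1 both sides are 1 (x) - of the relation with smaller indices. *)
have b k := Sop_bounded Sb n.+2 k.
rewrite !Sop_right.
have -> : tr (Sop n.+2 i.+1) (tr (Sop n.+2 i.+2) (tr (Sop n.+2 i.+1) X)) =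
    tr (Sop n.+2 i.+1 \o (Sop n.+2 i.+2 \o Sop n.+2 i.+1)) X.
  by rewrite (tens_right_comp (b _) (bounded_operator_comp (b _) (b _)))
    (tens_right_comp (b _) (b _)).
have -> : tr (Sop n.+2 i.+2) (tr (Sop n.+2 i.+1) (tr (Sop n.+2 i.+2) X)) =
    tr (Sop n.+2 i.+2 \o (Sop n.+2 i.+1 \o Sop n.+2 i.+2)) X.
  by rewrite (tens_right_comp (b _) (bounded_operator_comp (b _) (b _)))
    (tens_right_comp (b _) (b _)).
by congr (tr _ X); apply/funext => Y; exact: IH.
Qed.

Lemma Sop_comm n i j X : (0 < i)%N -> (i.+1 < j)%N -> (j < n)%N ->
  Sop n i (Sop n j X) = Sop n j (Sop n i X).
Proof.
case: i => // i _; elim: i n j X => [|i IH] [|n] [|[|[|j]]] // X ij jn.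
  case: n X jn => [|n] // X jn.
  have /funeqP/(_ X) := tens_id2_right Sb (Sop_bounded Sb n j.+1).
  exact.
have b k := Sop_bounded Sb n k.
rewrite !Sop_right.
have -> : tr (Sop n i.+1) (tr (Sop n j.+2) X) = tr (Sop n i.+1 \o Sop n j.+2) X.
  by rewrite (tens_right_comp (b _) (b _)).
have -> : tr (Sop n j.+2) (tr (Sop n i.+1) X) = tr (Sop n j.+2 \o Sop n i.+1) X.
  by rewrite (tens_right_comp (b _) (b _)).
by congr (tr _ X); apply/funext => Y; exact: IH.
Qed.

(** The path from the identity to P_n: S is replaced by t S and Theta by
    (1 - t) + t Theta. *)
Definition Sop_at (t : R) n i : F n -> F n := t%:C \*: Sop n i.
Definition coset_at (t : R) n : F n -> F n := \sum_(k < n) ascent (Sop_at t (n := n)) k.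
Definition theta_at (t : R) n : F n.+1 -> F n.+1 :=
  (1 - t)%:C \*: id + t%:C \*: theta_op m T (n := n).
Fixpoint Pop_at (t : R) n : F n -> F n :=
  if n is n'.+1 then tr (@Pop_at t n') \o (@theta_at t n' \o @coset_at t n'.+1) else id.

Section AtTime.
Variable t : R.
Hypothesis t01 : 0 <= t <= 1.
Let t1 : `|t| <= 1.
Proof. by case/andP: t01 => t0 t1; rewrite ger0_norm. Qed.

Lemma Sop_at_bounded n i : bounded_operator (@Sop_at t n i).
Proof. exact/bounded_operatorZ/Sop_bounded. Qed.

Lemma Sop_at_bounded_by n i : (0 < i < n)%N -> bounded_by s (@Sop_at t n i).
Proof.
move=> hi; apply: bounded_by_le (bounded_byZ t (Sop_bounded_by Ss hi)).
by rewrite ler_piMl.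
Qed.

Lemma adjZ (K : hilbertType R) (A : K -> K) (u : R) : is_adjoint A A ->
  is_adjoint (u%:C \*: A) (u%:C \*: A).
Proof.
move=> Aa x y; rewrite /= innerZl innerZr Aa; congr (_ * _); exact: conjc_real.
Qed.

Lemma adjD (K : hilbertType R) (A B : K -> K) : is_adjoint A A -> is_adjoint B B ->
  is_adjoint (A + B) (A + B).
Proof. by move=> Aa Ba x y; rewrite !fctE innerDl innerDr Aa Ba. Qed.

Lemma Sop_at_adj n i : (0 < i < n)%N -> is_adjoint (@Sop_at t n i) (@Sop_at t n i).
Proof. by move=> hi; apply: adjZ; exact: Sop_adj. Qed.

Lemma Sop_at_right n i : @Sop_at t n.+1 i.+2 = tr (@Sop_at t n i.+1).
Proof. by rewrite /Sop_at tens_rightZ //; exact: Sop_bounded. Qed.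

Lemma theta_at_bounded n : bounded_operator (@theta_at t n).
Proof.
apply: bounded_operatorD; apply: bounded_operatorZ; first exact: bounded_operator_id.
exact: theta_op_bounded.
Qed.

Lemma theta_at_adj n : is_adjoint (@theta_at t n) (@theta_at t n).
Proof.
apply: adjD; first exact: adjZ.
apply: adjZ; rewrite theta_opE; apply: tens_left_adj => //; exact: thetab.
Qed.

Lemma theta_at_tens_right n (B : F n -> F n) X : bounded_operator B ->
  @theta_at t n (tr B X) = tr B (@theta_at t n X).
Proof.
move=> Bb; have [lB _] := tens_rightb Bb.
have /funeqP/(_ X) := tens_left_right thetab Bb; rewrite -theta_opE /= => E.
by rewrite /theta_at !fctE /= E (linD lB) !(linZ lB).
Qed.

Lemma Sop_at_Tht n (X : F n.+2) :
  @Sop_at t n.+2 1 (theta_at t X) = tr (@theta_at t n) (@Sop_at t n.+2 1 X) /\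
  @Sop_at t n.+2 1 (tr (@theta_at t n) X) = theta_at t (@Sop_at t n.+2 1 X).
Proof.
have [lS _] := Sop_at_bounded n.+2 1; have [lS' _] := Sop_bounded Sb n.+2 1.
have thb := theta_op_bounded n.
have trE Y : tr (@theta_at t n) Y = (1 - t)%:C *: Y + t%:C *: tr (theta_op m T (n := n)) Y.
  rewrite /theta_at tens_rightD; try (apply: bounded_operatorZ => //).
    rewrite !tens_rightZ ?tens_right_id //; exact: bounded_operator_id.
  exact: bounded_operator_id.
have [lt _] := tens_rightb thb; have [lt' _] := theta_op_bounded n.+1.
rewrite !trE /theta_at /Sop_at !fctE /= !(linD lS') !(linZ lS') (linZ lt) (linZ lt').
have [-> ->] := Sop_theta X.
by split; rewrite scalerDr !scalerA; congr (_ *: _ + _ *: _); rewrite mulrC // mulrAC.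
Qed.

Lemma Sop_at_tens_right2 n (B : F n -> F n) X : bounded_operator B ->
  @Sop_at t n.+2 1 (tr (tr B) X) = tr (tr B) (@Sop_at t n.+2 1 X).
Proof.
move=> Bb; have [lB _] := tens_rightb (tens_rightb Bb).
have /funeqP/(_ X) := tens_id2_right Sb Bb => /= E.
by rewrite /Sop_at /= (linZ lB) Sop_left E.
Qed.

Lemma ascent_bounded n k : bounded_operator (ascent (@Sop_at t n) k).
Proof.
elim: k => [|k IH]; first exact: bounded_operator_id.
by apply: bounded_operator_comp => //; exact: Sop_at_bounded.
Qed.

Lemma ascent_rec n k :
  ascent (@Sop_at t n.+2) k.+1 = @Sop_at t n.+2 1 \o tr (ascent (@Sop_at t n.+1) k).
Proof.
elim: k => [|k IH]; first by rewrite /= tens_right_id.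
rewrite -[LHS]/(ascent (@Sop_at t n.+2) k.+1 \o @Sop_at t n.+2 k.+2) IH.
rewrite -[ascent _ k.+1]/(ascent (@Sop_at t n.+1) k \o @Sop_at t n.+1 k.+1).
by rewrite tens_right_comp ?Sop_at_right //; [exact: ascent_bounded | exact: Sop_at_bounded].
Qed.

Lemma coset_at_bounded n : bounded_operator (@coset_at t n).
Proof. by apply: bounded_operator_sum => k; exact: ascent_bounded. Qed.

Lemma coset_at_rec n X : @coset_at t n.+2 X = X + @Sop_at t n.+2 1 (tr (@coset_at t n.+1) X).
Proof.
have [lS _] := Sop_at_bounded n.+2 1.
rewrite /coset_at tens_right_sum => [|k]; last exact: ascent_bounded.
rewrite !fct_sumE big_ord_recl (lin_sum lS); congr (_ + _).
by apply: eq_bigr => k _; rewrite -[LHS]/(ascent (@Sop_at t n.+2) k.+1 X) ascent_rec.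
Qed.

Lemma Pop_at_bounded n : bounded_operator (@Pop_at t n).
Proof.
elim: n => [|n IH]; first exact: bounded_operator_id.
apply: bounded_operator_comp; first exact: tens_rightb.
by apply: bounded_operator_comp; [exact: theta_at_bounded | exact: coset_at_bounded].
Qed.

Lemma Pop_at_S n X : @Pop_at t n.+1 X = tr (@Pop_at t n) (theta_at t (@coset_at t n.+1 X)).
Proof. by []. Qed.

(** With Q = 1 (x) P_(n+1), Q' = 1 (x) 1 (x) P_n and A = 1 (x) A_(n+1), the second summand
    of P_(n+2) = Q Theta_1 + Q Theta_1 S_1 A has matrix elements
    <M A X, A Y>, where M = Theta_2 Q' Theta_1 S_1. Here Q' commutes with all
    other factors, and S_1 exchanges Theta_1 and Theta_2, so that M is symmetric. *)
Lemma Pop_at_adj n : is_adjoint (@Pop_at t n) (@Pop_at t n).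
Proof.
suff [] : is_adjoint (@Pop_at t n) (@Pop_at t n) /\
    is_adjoint (@Pop_at t n.+1) (@Pop_at t n.+1) by [].
elim: n => [|n [IH0 IH1]]; split=> //.
  have coset_at1 X : @coset_at t 1 X = X by rewrite /coset_at fct_sumE big_ord1.
  by move=> X Y; rewrite !Pop_at_S !coset_at1 !tens_right_id; exact: theta_at_adj.
pose Q := tr (@Pop_at t n.+1); pose Q' := tr (tr (@Pop_at t n)).
pose th := @theta_at t n.+1; pose th2 := tr (@theta_at t n); pose A := tr (@coset_at t n.+1).
pose S1 := @Sop_at t n.+2 1.
have Pb := Pop_at_bounded n; have Qb := Pop_at_bounded n.+1.
have Qa : is_adjoint Q Q by exact: tens_right_adj.
have Qa' : is_adjoint Q' Q'.
  by apply: tens_right_adj; [exact: tens_rightb | exact: tens_right_adj].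
have tha : is_adjoint th th by exact: theta_at_adj.
have tha2 : is_adjoint th2 th2.
  by apply: tens_right_adj; [exact: theta_at_bounded | exact: theta_at_adj].
have Sa1 : is_adjoint S1 S1 by exact: Sop_at_adj.
have QE X : Q X = Q' (th2 (A X)).
  rewrite /Q -[@Pop_at t n.+1]/(tr (@Pop_at t n) \o (theta_at t (n := n) \o @coset_at t n.+1)).
  have b1 := theta_at_bounded n; have b2 := coset_at_bounded n.+1.
  rewrite (tens_right_comp (tens_rightb Pb) (bounded_operator_comp b1 b2)).
  by rewrite (tens_right_comp b1 b2).
have thQ X : th (Q X) = Q (th X) by exact: theta_at_tens_right.
have thQ' X : th (Q' X) = Q' (th X) by apply: theta_at_tens_right; exact: tens_rightb.
have thQ2 X : th2 (Q' X) = Q' (th2 X).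
  have b1 := theta_at_bounded n; have b2 := tens_rightb Pb.
  rewrite -[LHS]/((tr (@theta_at t n) \o tr (tr (@Pop_at t n))) X).
  rewrite -[RHS]/((tr (tr (@Pop_at t n)) \o tr (@theta_at t n)) X).
  rewrite -(tens_right_comp b1 b2) -(tens_right_comp b2 b1); congr (tr _ X).
  by apply/funext => Y; exact: theta_at_tens_right.
have SQ X : S1 (Q' X) = Q' (S1 X) by exact: Sop_at_tens_right2.
have Sth X : S1 (th X) = th2 (S1 X) by case: (Sop_at_Tht X).
have Sth2 X : S1 (th2 X) = th (S1 X) by case: (Sop_at_Tht X).
have PE X : @Pop_at t n.+2 X = Q (th X) + Q (th (S1 (A X))).
  have [lth _] := theta_at_bounded n.+1; have [lQ _] := tens_rightb Qb.
  by rewrite Pop_at_S coset_at_rec (linD lth) (linD lQ).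
have key X Y : inner (Q (th (S1 (A X)))) Y = inner (th2 (Q' (th (S1 (A X))))) (A Y).
  by rewrite Qa QE -Qa' -tha2.
move=> X Y; rewrite !PE innerDl innerDr; congr (_ + _).
  by rewrite Qa tha thQ.
rewrite key [RHS]innerC key -innerC tha2 Qa' tha Sa1.
by rewrite thQ' SQ Sth Sth2 thQ2.
Qed.

Lemma theta_at_lower n X : (1 - q) / 2 * hnorm X <= hnorm (@theta_at t n X).
Proof.
have := theta_lower (@tens_leftM _ _ F _ _ n Tq) q1 hm X t01.
by rewrite /theta_at /theta_op !fctE /= fct_sumE.
Qed.

End AtTime.

(** By symmetry P_(n+1) is also D Theta (1 (x) P_n) with D the sum of the S_k ... S_1,
    and each of the three factors is bounded below. *)
Lemma Pop_at_lower n : exists2 d, 0 < d &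
  forall t X, 0 <= t <= 1 -> d * hnorm X <= hnorm (@Pop_at t n X).
Proof.
elim: n => [|n [d d0 low]]; first by exists 1 => // t X _; rewrite mul1r.
have h1 : 0 < (1 - s) / 2 by rewrite divr_gt0 // subr_gt0.
have h2 : 0 < (1 - q) / 2 by rewrite divr_gt0 // subr_gt0.
exists (((1 - s) / 2) ^+ n * ((1 - q) / 2 * d)) => [|t X t01].
  by apply: mulr_gt0; [exact: exprn_gt0 | exact: mulr_gt0].
pose D X := \sum_(j < n.+1) descent (@Sop_at t n.+1) j X.
have -> : @Pop_at t n.+1 X = D (theta_at t (tr (@Pop_at t n) X)).
  apply: inner_extl => Y; rewrite Pop_at_adj // Pop_at_S.
  rewrite -(tens_right_adj (Pop_at_bounded t n) (Pop_at_adj t (n := n))) -theta_at_adj //.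
  rewrite /coset_at fct_sumE inner_sumr inner_suml; apply: eq_bigr => k _.
  by rewrite (descent_adj (n := n.+1)) //; move=> i; exact: Sop_at_adj.
have lS k : linear (Sop n.+1 k) by case: (Sop_bounded Sb n.+1 k).
have br i Y : (0 < i)%N -> (i.+1 < n.+1)%N ->
    @Sop_at t n.+1 i (@Sop_at t n.+1 i.+1 (@Sop_at t n.+1 i Y)) =
    @Sop_at t n.+1 i.+1 (@Sop_at t n.+1 i (@Sop_at t n.+1 i.+1 Y)).
  by move=> i0 hi; rewrite /Sop_at /= !(linZ (lS _)) Sop_braid_gen.
have cm i j Y : (0 < i)%N -> (i.+1 < j)%N -> (j < n.+1)%N ->
    @Sop_at t n.+1 i (@Sop_at t n.+1 j Y) = @Sop_at t n.+1 j (@Sop_at t n.+1 i Y).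
  by move=> i0 ij hj; rewrite /Sop_at /= !(linZ (lS _)) Sop_comm.
have dl := descent_sum_lower (@Sop_at_bounded_by t t01 n.+1) s0 s1 br cm (k := n.+1).
apply: le_trans (dl _ _); last by rewrite /= leqnn.
rewrite -(mulrA (_ ^+ n)); apply: ler_wpM2l; first by rewrite exprn_ge0 // ltW.
apply: le_trans (theta_at_lower t01 _); rewrite -(mulrA (_ / 2)).
apply: ler_wpM2l; first exact: ltW.
by apply: tens_right_lower; [exact: ltW|exact: Pop_at_bounded|move=> Y; exact: low].
Qed.

Lemma Pop_at_lipschitz n : lipschitz_family (fun t => @Pop_at t n).
Proof.
have Sop_at_lip n' i : lipschitz_family (fun t => @Sop_at t n' i).
  apply: (lipschitz_scale (a := id)) => // [t /andP[t0 t1]|]; first by rewrite ger0_norm.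
  exact: Sop_bounded.
have idb n' := @bounded_operator_id R (F n').
elim: n => [|n IH]; first exact: lipschitz_const.
apply: (lipschitz_comp (f := fun t => tr (@Pop_at t n))); first exact: lipschitz_tens_right.
apply: (lipschitz_comp (f := fun t => @theta_at t n)).
  apply: (lipschitzD (f := fun t => (1 - t)%:C \*: id)).
    apply: (lipschitz_scale (a := fun t => 1 - t)) => // [t /andP[t0 t1]|t u].
      by rewrite ger0_norm ?subr_ge0 // gerBl.
    by rewrite opprB addrC addrA subrK distrC.
  apply: (lipschitz_scale (a := id)) => // [t /andP[t0 t1]|]; first by rewrite ger0_norm.
  exact: theta_op_bounded.
apply: (lipschitz_sum (f := fun k t => ascent (@Sop_at t n.+1) k)) => k _.
elim: k => [|k IHk]; first exact: lipschitz_const.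
exact: (lipschitz_comp (f := fun t => ascent (@Sop_at t n.+1) k)).
Qed.

Lemma Pop_at_0 n X : @Pop_at 0 n X = X.
Proof.
elim: n X => [|n IH] X //; rewrite Pop_at_S.
have -> : @Pop_at 0 n = id by apply/funext => Y; exact: IH.
rewrite tens_right_id /theta_at !fctE /= subr0 scale1r scale0r addr0.
rewrite /coset_at fct_sumE big_ord_recl big1 ?addr0 // => k _ /=.
rewrite /Sop_at /= scale0r.
by have [l _] := ascent_bounded 0 n.+1 k; exact: lin0 l.
Qed.

Lemma Pop_at_1 n : @Pop_at 1 n = Pop phi (n := n).
Proof.
elim: n => // n IH; apply/funext => X.
rewrite Pop_at_S IH (Pop_rec hm Tb phiP) Rop_split //; congr (tr _ _).
rewrite /theta_at !fctE /= subrr scale0r add0r scale1r; congr theta_op.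
rewrite /coset_at /coset_op !fct_sumE; apply: eq_bigr => k _.
rewrite cycle_op_foldr; congr (_ X).
have foldr_comp r (B : F n.+1 -> F n.+1) :
    foldr (fun j A => Sop n.+1 j \o A) B r = foldr (fun j A => Sop n.+1 j \o A) id r \o B.
  by elim: r => //= j r ->.
elim: (nat_of_ord k) => // j IHj.
rewrite -[X in iota 1 X]addn1 iotaD foldr_cat foldr_comp -IHj add1n /=.
by congr (_ \o _); apply/funext => Y; rewrite /Sop_at /= scale1r.
Qed.

Lemma Pop_adj n : is_adjoint (Pop phi (n := n)) (Pop phi (n := n)).
Proof. by rewrite -Pop_at_1; exact: Pop_at_adj. Qed.

Lemma Pop_pos n : exists2 c, 0 < c &
  forall X : F n, c * hnorm X ^+ 2 <= rinner X (Pop phi X).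
Proof.
have [d d0 low] := Pop_at_lower n.
have [|||c c0 cP] := homotopy_pos (Pop_at_lipschitz n) d0.
- by move=> t _; exact: Pop_at_adj.
- by move=> t X; exact: low.
- by move=> X; rewrite Pop_at_0 rinnerxx sqr_ge0.
by exists c => // X; rewrite -Pop_at_1.
Qed.

Lemma Pop_ge0 n (X : F n) : 0 <= rinner X (Pop phi X).
Proof.
have [c c0 cP] := Pop_pos n; apply: le_trans (cP X).
by rewrite mulr_ge0 ?sqr_ge0 // ltW.
Qed.

(** Apply krein_bound to Q = 1 (x) P_n and to R_(n+1), whose norm is bounded by the
    product of two geometric series. *)
Lemma Pop_le n (X : F n.+1) :
  rinner X (Pop phi X) <=
  ((1 - s) * (1 - q))^-1 * rinner X (tr (Pop phi (n := n)) X).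
Proof.
have Pb := Pop_bounded phiP n.
have [M PM] := (bounded_byP _).1 (tens_rightb Pb).
pose A : F n.+1 -> F n.+1 := theta_op m T (n := n) \o coset_op S (n := n.+1).
have PE : tr (Pop phi (n := n)) \o A = Pop phi (n := n.+1).
  by apply/funext => Y; rewrite (Pop_rec hm Tb phiP) Rop_split.
have thM : bounded_by (1 - q)^-1 (theta_op m T (n := n) : F n.+1 -> F n.+1).
  have gq : \sum_(i < m) q ^+ i <= (1 - q)^-1 by exact: geometric_le.
  apply: (bounded_by_le gq).
  by apply: bounded_by_sum => i; apply: bounded_by_iter; exact: tens_leftM.
have csM : bounded_by (1 - s)^-1 (coset_op S (n := n.+1)).
  have gs : \sum_(i < n.+1) s ^+ i <= (1 - s)^-1 by exact: geometric_le.
  apply: (bounded_by_le gs).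
  apply: bounded_by_sum => k.
  have kn : all (fun j => 0 < j < n.+1)%N (iota 1 k).
    by apply/allP => j; rewrite mem_iota; move: (ltn_ord k); lia.
  rewrite cycle_op_foldr -[X in s ^+ X](size_iota 1).
  elim: (iota 1 k) kn => [_|j r IH /= /andP[hj hr]]; first exact: bounded_by_id.
  by rewrite exprS; apply: bounded_by_comp; [exact: Sop_bounded_by | exact: IH].
have AM : bounded_by ((1 - s) * (1 - q))^-1 A.
  by rewrite invfM mulrC; exact: bounded_by_comp.
rewrite -{1}PE; apply: (krein_bound PM AM).
- by apply: tens_right_adj => //; exact: Pop_adj.
- by rewrite PE; exact: Pop_adj.
- by apply: tens_right_pos => //; [exact: Pop_adj | exact: Pop_ge0].
Qed.

End Positivity.

(** * The form on the full Fock space *)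

Section FockForm.
Variables (R : realType) (H : hilbertType R) (F : tensor_powers H) (m : nat).
Variable phi : forall n, group_algebra R (refl_group m n) -> F n -> F n.

(** A bound on the degrees of one argument turns the form into a finite sum. *)
Lemma form_G_ord (X Y : fock F) N : (forall n, (N <= n)%N -> X n = 0) ->
  form_G phi X Y = \sum_(n < N) inner (X n) (Pop phi (Y n)).
Proof.
move=> XN; rewrite (fsbig_ord _ _ (fun n => inner (X n) (Pop phi (Y n)))) /form_G.
rewrite -(fsbig_widen `I_N setT) //.
by move=> n [_ /= /negP]; rewrite -leqNgt => /XN E;
   rewrite /preimage /mkset E inner0l.
Qed.

Hypothesis Pb : forall n, bounded_operator (Pop phi (n := n)).
Hypothesis Pa : forall n, is_adjoint (Pop phi (n := n)) (Pop phi (n := n)).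
Hypothesis Ppos : forall n, exists2 c, 0 < c &
  forall X : F n, c * hnorm X ^+ 2 <= rinner X (Pop phi X).

Lemma inner_PopE n (X : F n) : inner X (Pop phi X) = (rinner X (Pop phi X))%:C.
Proof.
have : (inner X (Pop phi X))^* = inner X (Pop phi X) by rewrite -innerC Pa.
rewrite /rinner; case: (inner X (Pop phi X)) => a b [/eqP].
by rewrite eq_sym -addr_eq0 -mulr2n mulrn_eq0 => /eqP ->.
Qed.

Lemma form_G_inner_product : inner_product (form_G phi).
Proof.
split=> [X a Y Z|X Y|X X0].
- have [N XN] := fcomp_fin X; rewrite !(form_G_ord _ XN) mulr_sumr -big_split /=.
  by apply: eq_bigr => n _; have [lP _] := Pb n; rewrite lP innerDr innerZr.
- have [N XN] := fcomp_fin X; have [M YM] := fcomp_fin Y.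
  rewrite (@form_G_ord X Y (maxn N M)) => [|n]; last by rewrite geq_max => /andP[/XN].
  rewrite (@form_G_ord Y X (maxn N M)) => [|n]; last by rewrite geq_max => /andP[_ /YM].
  rewrite rmorph_sum; apply: eq_bigr => n _; rewrite -Pa; exact: innerC.
- have [N XN] := fcomp_fin X.
  have [n Xn] : exists n, X n != 0.
    apply: contrapT => nX; move/eqP: X0; apply; apply: fockP => n.
    by apply/eqP; apply: contrapT => /negP h; apply: nX; exists n.
  have nN : (n < N)%N by rewrite ltnNge; apply: contraNN Xn => /XN ->.
  rewrite (form_G_ord _ XN) (eq_bigr (fun k : 'I_N => (rinner (X k) (Pop phi (X k)))%:C)).
    have P0 k (Z : F k) : 0 <= rinner Z (Pop phi Z).
      have [c c0 cP] := Ppos k; apply: le_trans (cP Z).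
      by rewrite mulr_ge0 ?sqr_ge0 // ltW.
    rewrite -rmorph_sum /= ltcR (bigD1 (Ordinal nN)) //=.
    apply: ltr_wpDr; first by apply: sumr_ge0 => k _; exact: P0.
    have [c c0 cP] := Ppos n; apply: lt_le_trans (cP _).
    rewrite mulr_gt0 // exprn_gt0 // lt_neqAle hnorm_ge0 andbT eq_sym.
    by apply: contraNneq Xn => /hnorm_eq0 ->.
  by move=> k _; exact: inner_PopE.
Qed.

Section Creation.
Variables (S : F 2%N -> F 2%N) (T : H -> H) (c : R).
Hypothesis Prec : forall n (X : F n.+1),
  Pop phi X = tens_right (Pop phi (n := n)) (Rop m S T X).
Hypothesis c0 : 0 <= c.
Hypothesis Ple : forall n (X : F n.+1),
  rinner X (Pop phi X) <= c * rinner X (tens_right (Pop phi (n := n)) X).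

Lemma form_G_create x (X Y : fock F) N : (forall n, (N <= n)%N -> X n = 0) ->
  form_G phi (create x X) Y = \sum_(n < N) inner (tcons x (X n)) (Pop phi (Y n.+1)).
Proof.
move=> XN; rewrite (@form_G_ord _ _ N.+1) => [|[//|n] Nn]; last first.
  by rewrite /= XN // tcons0.
by rewrite big_ord_recl /= inner0l add0r.
Qed.

Lemma create_annihilate x X Y :
  form_G phi (create x X) Y = form_G phi X (annihilate m S T x Y).
Proof.
have [N XN] := fcomp_fin X; rewrite (form_G_create _ _ XN) (form_G_ord _ XN).
by apply: eq_bigr => n _; rewrite Prec lann_adj lann_tens_right.
Qed.

(** Pop_le replaces P_(n+1) by 1 (x) P_n, whose form at x (x) X is |x|^2 <X, P_n X>. *)
Lemma create_norm x X : norm_G phi (create x X) <= Num.sqrt c * hnorm x * norm_G phi X.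
Proof.
have [N XN] := fcomp_fin X; rewrite /norm_G (form_G_create _ _ XN) (form_G_ord _ XN).
have ReS (f : nat -> R[i]) : complex.Re (\sum_(n < N) f n) = \sum_(n < N) complex.Re (f n).
  elim: N {XN} => [|k IH]; first by rewrite !big_ord0.
  by rewrite !big_ord_recr /= ReD IH.
rewrite (ReS (fun n => inner (tcons x (X n)) (Pop phi (create x X n.+1)))).
rewrite (ReS (fun n => inner (X n) (Pop phi (X n)))).
set f := (X in _ * Num.sqrt X).
have -> : Num.sqrt c * hnorm x * Num.sqrt f = Num.sqrt (c * hnorm x ^+ 2 * f).
  by rewrite (sqrtrM f (mulr_ge0 c0 (sqr_ge0 _))) (sqrtrM _ c0) sqrtr_sqr
    (ger0_norm (hnorm_ge0 x)).
apply: ler_wsqrtr; rewrite /f mulr_sumr.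
apply: ler_sum => n _; apply: le_trans (Ple (tcons x (X n))) _.
rewrite -mulrA ler_wpM2l // tens_rightE // /rinner (inner_tens (tcons_tensor F n)).
by rewrite innerE ReMr.
Qed.

Lemma create_opnorm x :
  (opnorm_wrt (norm_G phi) (norm_G phi) (create x) <= (Num.sqrt c * hnorm x)%:E)%E.
Proof.
apply: ge_ereal_sup => _ [X /= X1 <-]; rewrite lee_fin.
by apply: le_trans (create_norm x X) _; rewrite ler_piMr // mulr_ge0 ?sqrtr_ge0 ?hnorm_ge0.
Qed.

End Creation.
End FockForm.

Theorem theorem1p2 (R : realType) (m : nat) (hm : (0 < m)%N)
  (H : hilbertType R) (F : tensor_powers H)
  (S : F 2%N -> F 2%N)
  (S_bounded : bounded_operator S)
  (S_lt1 : (opnorm S < 1)%E)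
  (S_adj : is_adjoint S S)
  (S_braid : Sop S (n := 3%N) 2 \o Sop S 1 \o Sop S 2 =
             Sop S 1 \o Sop S 2 \o Sop S (n := 3%N) 1)
  (T : H -> H)
  (T_bounded : bounded_operator T)
  (T_lt1 : (opnorm T < 1)%E)
  (Tstar : nat -> H -> H)
  (Tstar_adj : forall i, is_adjoint (iter i T) (Tstar i))
  (T_sum_adj : \sum_(1 <= i < m) Tstar i = \sum_(1 <= i < m) iter i T)
  (T1_braid : Top T (n := 2%N) 1 \o S \o Top T 1 \o S =
              S \o Top T 1 \o S \o Top T 1)
  (T2_braid : Top T (n := 2%N) 2 \o S \o Top T 2 \o S =
              S \o Top T 2 \o S \o Top T 2)
  (phi : forall n, group_algebra R (refl_group m n) -> F n -> F n)
  (phiP : forall n, (0 < n)%N -> is_phi S T (phi n)) :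
  [/\ inner_product (form_G phi),
      forall (x : H) (X Y : fock F),
        form_G phi (create x X) Y = form_G phi X (annihilate m S T x Y)
    & forall x : H,
        (opnorm_wrt (norm_G phi) (norm_G phi) (create x) <=
         (hnorm x /
          Num.sqrt ((1 - fine (opnorm S)) * (1 - fine (opnorm T))))%:E)%E].
Proof.
have Ss := opnorm_bounded_by S_bounded; have Tq := opnorm_bounded_by T_bounded.
have fine_lt1 (u : \bar R) : (u < 1)%E -> fine u < 1 by case: u.
have s1 := fine_lt1 _ S_lt1; have q1 := fine_lt1 _ T_lt1.
have theta_adj : is_adjoint (\sum_(i < m) iter i T) (\sum_(i < m) iter i T).
  have E : \sum_(i < m) iter i T = (id : H -> H) + \sum_(1 <= i < m) iter i T.
    by rewrite -(big_mkord predT (fun i => iter i T)) big_ltn.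
  move=> x y; rewrite E !fctE innerDl innerDr -{2}T_sum_adj !fct_sumE.
  rewrite inner_suml inner_sumr; congr (_ + _).
  by apply: eq_bigr => i _; exact: Tstar_adj.
have Pb n := Pop_bounded phiP n.
have Pa n := Pop_adj hm Ss Tq s1 q1 S_adj theta_adj phiP (n := n).
have Ppos n := Pop_pos hm Ss Tq s1 q1 S_adj theta_adj phiP n.
have Prec n (X : F n.+1) := Pop_rec hm T_bounded phiP X.
have Ple n (X : F n.+1) := Pop_le hm Ss Tq s1 q1 S_adj theta_adj phiP X.
split=> [|x X Y|x].
- exact: form_G_inner_product Pb Pa Ppos.
- exact: (create_annihilate Pb Prec).
have c0 : 0 <= ((1 - fine (opnorm S)) * (1 - fine (opnorm T)))^-1.
  by rewrite invr_ge0 mulr_ge0 // subr_ge0 ltW.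
apply: le_trans (create_opnorm Pb c0 Ple x) _.
by rewrite sqrtrV 1?mulrC // mulr_ge0 // subr_ge0 ltW.
Qed.
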